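(* Let $\mathfrak{h}$ be a complex Hilbert space, let $X:=\mathcal{F}_+(\mathfrak{h})$ be the symmetric Fock space over $\mathfrak{h}$, let $I=[0,1]$, and set $A(t)=i\Phi(f_t)$ for $t\in I$, where $\Phi(f)$ denotes the Segal field operator of $f\in\mathfrak{h}$. Suppose that $I\ni t\mapsto f_t\in\mathfrak{h}$ is continuous. Then there exists a unique evolution system $U$ for $A$ on the maximal continuity subspace $$Y^{\circ}:=\Big\{y\in\bigcap_{\tau\in I}D(A(\tau)):\ t\mapsto A(t)y\text{ is continuous on } I\Big\},$$ and it is given, for $0\le s\le t\le1$, by $$U(t,s)=e^{\overline{\left(\int_s^ti\Phi(f_{\tau})\,d\tau\right)^{\circ}}}\;e^{-\frac i2\int_s^t\int_s^{\tau}\operatorname{Im}\langle f_{\tau},f_{\sigma}\rangle\,d\sigma\,d\tau}=W\Big(\int_s^tf_{\tau}\,d\tau\Big)\,e^{-\frac i2\int_s^t\int_s^{\tau}\operatorname{Im}\langle f_{\tau},f_{\sigma}\rangle\,d\sigma\,d\tau},$$ where $W(h):=e^{i\Phi(h)}$ denotes the Weyl operator for $h\in\mathfrak{h}$ and $\big(\int_s^ti\Phi(f_{\tau})\,d\tau\big)^{\circ}$ is the operator with domain $Y^{\circ}$ defined by $y\mapsto\int_s^ti\Phi(f_{\tau})y\,d\tau$, which is closable with closure generating a strongly continuous semigroup on $X$ (the first factor in the first formula being its value at time $1$).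
   Context: The inner product $\langle\cdot,\cdot\rangle$ of $\mathfrak{h}$ is antilinear in the first and linear in the second argument. $a(f)$ and $a^*(f)$ are the usual annihilation and creation operators in $\mathcal{F}_+(\mathfrak{h})$ ($a^*(f)$ linear and $a(f)$ antilinear in $f$, with $[a(f),a^*(g)]=\langle f,g\rangle$ on the finite particle subspace). The Segal field operator $\Phi(f)$ is the closure of $2^{-1/2}(a(f)+a^*(f))$; it is self-adjoint, and $[\Phi(f),\Phi(g)]=i\operatorname{Im}\langle f,g\rangle$ on a suitable dense subspace. Evolution system: let $\Delta=\{(s,t)\in I^2:s\le t\}$ and let $Y$ be a dense subspace of $X$ contained in $\bigcap_{\tau\in I}D(A(\tau))$. An evolution system for $A$ on $Y$ is a family of bounded operators $U(t,s)$ on $X$, $(s,t)\in\Delta$, such that (i) for every $y\in Y$ and $s\in[0,1)$ the map $[s,1]\ni t\mapsto U(t,s)y$ is a continuously differentiable solution, with values in $Y$, of the initial value problem $x'(t)=A(t)x(t)$ $(t\in[s,1])$, $x(s)=y$; (ii) $U(t,s)U(s,r)=U(t,r)$ for all $r\le s\le t$ in $I$, and $\Delta\ni(s,t)\mapsto U(t,s)$ is strongly continuous. *)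

(* Defs.v *)
From Stdlib Require Import ZArith Reals Lra Lia List Permutation.
From Stdlib Require Import FunctionalExtensionality PropExtensionality.
From Stdlib Require Import ProofIrrelevance ClassicalEpsilon.
From Coquelicot Require Import Coquelicot.

Set Implicit Arguments.
Unset Strict Implicit.
Unset Printing Implicit Defensive.

Open Scope R_scope.

(** * Complex Hilbert spaces *)

(* A complex Hilbert space is a real Banach space (so that [RInt], [filterdiff],
   [continuous_on] apply to functions of a real variable) whose scalar
   multiplication is extended to [C], and whose norm comes from an inner
   product, antilinear in the first and linear in the second argument.
   Antilinearity in the first argument follows from [inner_conj]. *)
Record HilbertSpace := {
  hilbert_banach :> CompleteNormedModule R_AbsRing;
  cscal : C -> hilbert_banach -> hilbert_banach;
  inner : hilbert_banach -> hilbert_banach -> C;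
  cscal_RtoC : forall (r : R) x, cscal (RtoC r) x = scal r x;
  cscal_assoc : forall (a b : C) x, cscal a (cscal b x) = cscal (a * b)%C x;
  cscal_plus_r : forall (a : C) x y,
    cscal a (plus x y) = plus (cscal a x) (cscal a y);
  cscal_plus_l : forall (a b : C) x,
    cscal (a + b)%C x = plus (cscal a x) (cscal b x);
  inner_plus_r : forall x y z, inner x (plus y z) = (inner x y + inner x z)%C;
  inner_cscal_r : forall (a : C) x y, inner x (cscal a y) = (a * inner x y)%C;
  inner_conj : forall x y, inner y x = Cconj (inner x y);
  inner_norm : forall x, inner x x = RtoC (norm x ^ 2)
}.

(** * Inner product of a norm satisfying the parallelogram law *)

Lemma minus_plus_l (G : AbelianGroup) (x y z : G) :
  minus (plus y z) x = minus z (minus x y).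
Proof.
assert (H : opp (minus x y) = plus y (opp x)).
{ unfold minus; transitivity (plus (opp x) (opp (opp y))).
  - exact (opp_plus x (opp y)).
  - rewrite opp_opp; apply plus_comm. }
unfold minus in *; rewrite H, plus_assoc.
f_equal; apply plus_comm.
Qed.

Section Parallelogram.

Variable X : NormedModule R_AbsRing.
Let N (x : X) := norm x ^ 2.
Hypothesis parallelogram : forall x y : X,
  N (plus x y) + N (minus x y) = 2 * N x + 2 * N y.

Definition polar (x y : X) : R :=
  (norm (plus x y) ^ 2 - norm x ^ 2 - norm y ^ 2) / 2.

Lemma norm_sq_plus3 (x y z : X) :
  N (plus (plus x y) z) =
  N (plus x z) + N (plus y z) + N (plus x y) - N x - N y - N z.
Proof.
pose proof (parallelogram (plus x z) y) as H1.
pose proof (parallelogram (plus y z) x) as H2.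
pose proof (parallelogram z (minus x y)) as H3.
pose proof (parallelogram x y) as H4.
assert (E1 : plus (plus x z) y = plus (plus x y) z).
{ rewrite <- !plus_assoc; f_equal; apply plus_comm. }
assert (E2 : plus (plus y z) x = plus (plus x y) z).
{ rewrite (plus_comm (plus y z) x), plus_assoc; reflexivity. }
assert (E3 : minus (plus x z) y = plus z (minus x y)).
{ unfold minus; rewrite (plus_comm x z), <- plus_assoc; reflexivity. }
assert (E4 : minus (plus y z) x = minus z (minus x y)).
{ apply (minus_plus_l (G := NormedModule.AbelianGroup R_AbsRing X)). }
rewrite E1, E3 in H1; rewrite E2, E4 in H2; lra.
Qed.

Lemma polar_plus_r (x y z : X) : polar x (plus y z) = polar x y + polar x z.
Proof.
pose proof (norm_sq_plus3 x y z) as H; unfold N in H.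
unfold polar; rewrite plus_assoc, H; lra.
Qed.

Lemma polar_sym (x y : X) : polar x y = polar y x.
Proof. unfold polar; rewrite (plus_comm x y); lra. Qed.

Lemma polar_diag (x : X) : polar x x = norm x ^ 2.
Proof.
pose proof (parallelogram x x) as H; unfold N in H.
assert (E0 : norm (minus x x) = 0).
{ transitivity (norm (zero : X)); [f_equal|].
  { exact (minus_eq_zero (G := NormedModule.AbelianGroup R_AbsRing X) x). }
  apply norm_zero. }
rewrite E0 in H; unfold polar; lra.
Qed.

Lemma polar_bound (x y : X) : Rabs (polar x y) <= norm x * norm y.
Proof.
pose proof (norm_triangle x y) as H1.
pose proof (norm_triangle_inv x (opp y)) as H2.
unfold minus in H2; rewrite opp_opp, norm_opp in H2.
pose proof (norm_ge_0 x) as Nx; pose proof (norm_ge_0 y) as Ny.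
pose proof (norm_ge_0 (plus x y)) as Nxy.
assert (H3 : norm (plus x y) ^ 2 <= (norm x + norm y) ^ 2)
  by (apply pow_incr; lra).
assert (H4 : (norm x - norm y) ^ 2 <= norm (plus x y) ^ 2).
{ rewrite <- (pow2_abs (norm x - norm y)); apply pow_incr.
  split; [apply Rabs_pos | exact H2]. }
unfold polar; apply Rabs_le; lra.
Qed.

Definition rscal (t : R) (y : X) : X := scal t y.

Lemma norm_scal_Rabs (t : R) (y : X) : norm (rscal t y) = Rabs t * norm y.
Proof.
apply Rle_antisym; [exact (norm_scal t y)|].
destruct (Req_dec t 0) as [E|E].
- rewrite E, Rabs_R0, Rmult_0_l; apply norm_ge_0.
- assert (H : norm y <= Rabs (/ t) * norm (rscal t y)).
  { replace y with (rscal (/ t) (rscal t y)) at 1; [exact (norm_scal _ _)|].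
    transitivity (rscal (/ t * t) y); [exact (scal_assoc _ _ _)|].
    rewrite Rinv_l by exact E; exact (scal_one y). }
  apply (Rmult_le_compat_l (Rabs t)) in H; [|apply Rabs_pos].
  rewrite <- Rmult_assoc, <- Rabs_mult, Rinv_r, Rabs_R1, Rmult_1_l in H; auto.
Qed.

Lemma scal_Rplus (s t : R) (y : X) :
  rscal (s + t) y = plus (rscal s y) (rscal t y).
Proof. exact (scal_distr_r s t y). Qed.

Lemma scal_R1 (y : X) : rscal 1 y = y.
Proof. exact (scal_one y). Qed.

Lemma polar_scal_nat (x y : X) (t : R) (n : nat) :
  polar x (rscal (INR n * t) y) = INR n * polar x (rscal t y).
Proof.
induction n as [|n IH].
- simpl; rewrite !Rmult_0_l.
  pose proof (polar_bound x (rscal 0 y)) as H.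
  assert (E0 : norm (rscal 0 y) = 0).
  { rewrite norm_scal_Rabs, Rabs_R0; ring. }
  rewrite E0, Rmult_0_r in H.
  destruct (Req_dec (polar x (rscal 0 y)) 0) as [E|E]; [exact E|].
  apply Rabs_pos_lt in E; lra.
- rewrite S_INR, !Rmult_plus_distr_r, Rmult_1_l.
  rewrite scal_Rplus, polar_plus_r, IH, Rmult_1_l; reflexivity.
Qed.

Lemma polar_scal_opp (x y : X) (t : R) :
  polar x (rscal (- t) y) = - polar x (rscal t y).
Proof.
assert (H : polar x (plus (rscal (- t) y) (rscal t y)) = 0).
{ rewrite <- scal_Rplus.
  replace (- t + t) with (INR 0 * 0) by (simpl; lra).
  rewrite polar_scal_nat; simpl; ring. }
rewrite polar_plus_r in H; lra.
Qed.

Lemma polar_scal_r (x y : X) (t : R) : polar x (rscal t y) = t * polar x y.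
Proof.
set (c := norm x * norm y).
pose (g := fun s => polar x (rscal s y) - s * polar x y).
assert (gadd : forall s u, g (s + u) = g s + g u).
{ intros s u; unfold g; rewrite scal_Rplus, polar_plus_r.
  ring. }
assert (gnat : forall n, g (INR n) = 0).
{ intro n; unfold g; pose proof (polar_scal_nat x y 1 n) as H.
  rewrite Rmult_1_r, scal_R1 in H; rewrite H; ring. }
assert (gopp : forall s, g (- s) = - g s).
{ intro s; unfold g; rewrite polar_scal_opp; ring. }
assert (gZ : forall z : Z, g (IZR z) = 0).
{ intro z; destruct (ZArith_dec.Z_le_gt_dec 0 z) as [Hz|Hz].
  - rewrite <- (Z2Nat.id z Hz), <- INR_IZR_INZ; apply gnat.
  - rewrite <- (Z.opp_involutive z), opp_IZR, gopp.
    rewrite <- (Z2Nat.id (- z)) by lia.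
    rewrite <- INR_IZR_INZ, gnat; ring. }
assert (gb01 : forall s, 0 <= s <= 1 -> Rabs (g s) <= 2 * c).
{ intros s Hs; unfold g.
  pose proof (polar_bound x (rscal s y)) as H1; rewrite norm_scal_Rabs in H1.
  pose proof (polar_bound x y) as H2; fold c in H2.
  assert (H3 : Rabs (s * polar x y) <= c).
  { rewrite Rabs_mult, (Rabs_pos_eq s) by lra.
    pose proof (Rabs_pos (polar x y)); nra. }
  assert (H4 : norm x * (Rabs s * norm y) <= c).
  { rewrite (Rabs_pos_eq s) by lra.
    assert (0 <= c)
      by (apply Rmult_le_pos; apply norm_ge_0).
    unfold c in *; nra. }
  pose proof (Rabs_triang (polar x (rscal s y)) (- (s * polar x y))) as H5.
  rewrite Rabs_Ropp in H5; 
  unfold Rminus; lra. }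
assert (gb : forall s, Rabs (g s) <= 2 * c).
{ intro s; destruct (base_Int_part s) as [H1 H2].
  replace s with (IZR (Int_part s) + (s - IZR (Int_part s))) by ring.
  rewrite gadd, gZ, Rplus_0_l; apply gb01; lra. }
assert (gn : forall n, g (INR n * t) = INR n * g t).
{ intro n; unfold g; rewrite polar_scal_nat; ring. }
assert (g0 : g t = 0).
{ destruct (Req_dec (g t) 0) as [E|E]; [exact E|exfalso].
  apply Rabs_pos_lt in E.
  destruct (nfloor_ex (2 * c / Rabs (g t))) as [n Hn].
  { assert (0 <= c) by (apply Rmult_le_pos; apply norm_ge_0).
    apply Rmult_le_pos; [lra | left; now apply Rinv_0_lt_compat]. }
  pose proof (gb (INR (S n) * t)) as H.
  rewrite gn, Rabs_mult, Rabs_pos_eq in H by apply pos_INR.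
  rewrite S_INR in H; destruct Hn as [_ Hn].
  apply (Rmult_lt_compat_r (Rabs (g t))) in Hn; [|exact E].
  unfold Rdiv in Hn; rewrite Rmult_assoc, Rinv_l, Rmult_1_r in Hn; lra. }
unfold g in g0; lra.
Qed.

End Parallelogram.

(** * The dual of a semi-inner product space *)

(* [K] is a positive semidefinite kernel on an index set [B]; it makes the
   formal linear combinations of elements of [B] a semi-inner product space.
   The bounded antilinear functionals on that space form (by Riesz) the
   Hilbert space obtained from it by separation and completion; a functional is
   given by its values on [B]. The functionals compatible with a relation [E]
   on [B] form a closed subspace, which is the space constructed here. *)
Section KernelSpace.

Variables (B : Type) (K : B -> B -> C) (E : B -> B -> Prop).

Fixpoint lin_ext (p : B -> C) (v : list (C * B)) : C :=
  match v with
  | nil => 0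
  | (c, b) :: v' => (c * p b + lin_ext p v')%C
  end.

Fixpoint antilin_ext (p : B -> C) (v : list (C * B)) : C :=
  match v with
  | nil => 0
  | (c, b) :: v' => (Cconj c * p b + antilin_ext p v')%C
  end.

Definition kernel_form (u v : list (C * B)) : C :=
  antilin_ext (fun b => lin_ext (K b) v) u.

Definition seminorm (v : list (C * B)) : R := sqrt (Re (kernel_form v v)).

Definition positive_kernel := forall v, 0 <= Re (kernel_form v v).

Hypothesis Kpos : positive_kernel.

Record functional := {
  value :> B -> C;
  value_compat : forall b b', E b b' -> value b = value b';
  value_bounded : exists M : R, forall v,
    Cmod (antilin_ext value v) <= M * seminorm v
}.

Lemma functional_eq (p q : functional) : (forall b, p b = q b) -> p = q.
Proof.
destruct p as [p p1 p2], q as [q q1 q2]; simpl; intro H.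
assert (E0 : p = q) by (apply functional_extensionality; exact H).
subst q; f_equal; apply proof_irrelevance.
Qed.

Lemma antilin_ext_plus (p q : B -> C) v :
  antilin_ext (fun b => p b + q b)%C v = (antilin_ext p v + antilin_ext q v)%C.
Proof.
induction v as [|[c b] v IH]; simpl; [ring|rewrite IH; ring].
Qed.

Lemma antilin_ext_mult (a : C) (p : B -> C) v :
  antilin_ext (fun b => a * p b)%C v = (a * antilin_ext p v)%C.
Proof.
induction v as [|[c b] v IH]; simpl; [ring|rewrite IH; ring].
Qed.

Lemma antilin_ext_ext (p q : B -> C) v :
  (forall b, p b = q b) -> antilin_ext p v = antilin_ext q v.
Proof.
intro H; induction v as [|[c b] v IH]; simpl; [easy|now rewrite IH, H].
Qed.

Lemma antilin_ext_app (p : B -> C) u v :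
  antilin_ext p (u ++ v) = (antilin_ext p u + antilin_ext p v)%C.
Proof.
induction u as [|[c b] u IH]; simpl; [ring|rewrite IH; ring].
Qed.

Lemma lin_ext_app (p : B -> C) u v :
  lin_ext p (u ++ v) = (lin_ext p u + lin_ext p v)%C.
Proof.
induction u as [|[c b] u IH]; simpl; [ring|rewrite IH; ring].
Qed.

Definition comb_scal (a : C) (v : list (C * B)) : list (C * B) :=
  map (fun cb => ((a * fst cb)%C, snd cb)) v.

Lemma antilin_ext_scal (p : B -> C) a v :
  antilin_ext p (comb_scal a v) = (Cconj a * antilin_ext p v)%C.
Proof.
induction v as [|[c b] v IH]; simpl; [ring|].
rewrite IH, Cmult_conj; ring.
Qed.

Lemma lin_ext_scal (p : B -> C) a v :
  lin_ext p (comb_scal a v) = (a * lin_ext p v)%C.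
Proof.
induction v as [|[c b] v IH]; simpl; [ring|rewrite IH; ring].
Qed.

Lemma kernel_form_app_l u v w :
  kernel_form (u ++ v) w = (kernel_form u w + kernel_form v w)%C.
Proof. apply antilin_ext_app. Qed.

Lemma kernel_form_app_r u v w :
  kernel_form w (u ++ v) = (kernel_form w u + kernel_form w v)%C.
Proof.
unfold kernel_form; rewrite <- antilin_ext_plus.
apply antilin_ext_ext; intro b; apply lin_ext_app.
Qed.

Lemma kernel_form_scal_l a u v :
  kernel_form (comb_scal a u) v = (Cconj a * kernel_form u v)%C.
Proof. apply antilin_ext_scal. Qed.

Lemma kernel_form_scal_r a u v :
  kernel_form u (comb_scal a v) = (a * kernel_form u v)%C.
Proof.
unfold kernel_form; rewrite <- antilin_ext_mult.
apply antilin_ext_ext; intro b; apply lin_ext_scal.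
Qed.

Lemma seminorm_ge_0 v : 0 <= seminorm v.
Proof. apply sqrt_pos. Qed.

Lemma seminorm_sq v : seminorm v ^ 2 = Re (kernel_form v v).
Proof. apply pow2_sqrt, Kpos. Qed.

Lemma seminorm_scal a v : seminorm (comb_scal a v) = Cmod a * seminorm v.
Proof.
unfold seminorm; rewrite kernel_form_scal_l, kernel_form_scal_r.
replace (Cconj a * (a * kernel_form v v))%C
  with (RtoC (Cmod a ^ 2) * kernel_form v v)%C.
2:{ pose proof (Cmod2_conj a) as H; rewrite H; ring. }
rewrite re_scal_l, sqrt_mult; [|apply pow2_ge_0|apply Kpos].
rewrite sqrt_pow2; [reflexivity|apply Cmod_ge_0].
Qed.

Lemma seminorm_parallelogram u v :
  seminorm (u ++ v) ^ 2 + seminorm (u ++ comb_scal (RtoC (-1)) v) ^ 2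
  = 2 * seminorm u ^ 2 + 2 * seminorm v ^ 2.
Proof.
rewrite !seminorm_sq, !kernel_form_app_l, !kernel_form_app_r.
rewrite !kernel_form_scal_l, !kernel_form_scal_r.
destruct (kernel_form u u), (kernel_form u v), (kernel_form v u),
  (kernel_form v v); simpl; ring.
Qed.

Definition op_norm (p : functional) : R :=
  real (Lub_Rbar (fun r =>
    exists v, seminorm v <= 1 /\ r = Cmod (antilin_ext p v))).

Lemma op_norm_lub (p : functional) :
  is_lub (fun r => exists v, seminorm v <= 1 /\ r = Cmod (antilin_ext p v))
    (op_norm p).
Proof.
unfold op_norm.
set (P := fun r => exists v, seminorm v <= 1 /\ r = Cmod (antilin_ext p v)).
pose proof (Lub_Rbar_correct P) as H.
destruct (value_bounded p) as [M HM].
assert (HM' : Rbar_le (Lub_Rbar P) (Rabs M)).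
{ apply (proj2 H); intros r [v [Hv ->]]; simpl.
  eapply Rle_trans; [apply HM|].
  pose proof (Rle_abs M); pose proof (Rabs_pos M).
  pose proof (seminorm_ge_0 v); nra. }
assert (H0 : Rbar_le 0 (Lub_Rbar P)).
{ apply (proj1 H); exists nil; split.
  - unfold seminorm, kernel_form; simpl; rewrite sqrt_0; lra.
  - simpl; rewrite Cmod_0; reflexivity. }
destruct (Lub_Rbar P) as [r| |]; simpl in *; try contradiction.
destruct H as [H1 H2]; split.
- intros x Hx; exact (H1 x Hx).
- intros b Hb; exact (H2 (Finite b) Hb).
Qed.

Lemma op_norm_ge_0 p : 0 <= op_norm p.
Proof.
destruct (op_norm_lub p) as [H _]; apply H; exists nil; split.
- unfold seminorm, kernel_form; simpl; rewrite sqrt_0; lra.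
- simpl; rewrite Cmod_0; reflexivity.
Qed.

Lemma op_norm_bound (p : functional) v :
  Cmod (antilin_ext p v) <= op_norm p * seminorm v.
Proof.
destruct (Rle_lt_or_eq_dec 0 (seminorm v) (seminorm_ge_0 v)) as [H|H].
- destruct (op_norm_lub p) as [H1 _].
  assert (H2 : Cmod (antilin_ext p (comb_scal (RtoC (/ seminorm v)) v))
               <= op_norm p).
  { apply H1; eexists; split; [|reflexivity].
    rewrite seminorm_scal, Cmod_R, Rabs_pos_eq.
    - rewrite Rinv_l; lra.
    - left; now apply Rinv_0_lt_compat. }
  rewrite antilin_ext_scal, Cmod_mult, Cmod_conj, Cmod_R, Rabs_pos_eq in H2
    by (left; now apply Rinv_0_lt_compat).
  apply (Rmult_le_compat_l (seminorm v)) in H2; [|lra].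
  rewrite <- Rmult_assoc, Rinv_r in H2; lra.
- rewrite <- H; destruct (value_bounded p) as [M HM].
  pose proof (HM v) as H1; rewrite <- H in H1; lra.
Qed.

Lemma op_norm_least (p : functional) M : 0 <= M ->
  (forall v, Cmod (antilin_ext p v) <= M * seminorm v) -> op_norm p <= M.
Proof.
intros HM H; apply (proj2 (op_norm_lub p)); intros r [v [Hv ->]].
eapply Rle_trans; [apply H|]; nra.
Qed.

Lemma antilin_ext_single (p : B -> C) b :
  antilin_ext p ((RtoC 1, b) :: nil) = p b.
Proof. simpl; apply injective_projections; simpl; ring. Qed.

Lemma value_bound (p : functional) b :
  Cmod (p b) <= op_norm p * seminorm ((RtoC 1, b) :: nil).
Proof.
rewrite <- (antilin_ext_single p b) at 1; apply op_norm_bound.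
Qed.

Program Definition functional_zero : functional :=
  {| value := fun _ => 0 |}.
Next Obligation.
exists 0; intro v; replace (antilin_ext (fun _ => RtoC 0) v) with (RtoC 0).
- rewrite Cmod_0; lra.
- induction v as [|[c b] v IH]; simpl; [easy|rewrite <- IH; ring].
Qed.

Program Definition functional_plus (p q : functional) : functional :=
  {| value := fun b => (p b + q b)%C |}.
Next Obligation. now rewrite (value_compat p H), (value_compat q H). Qed.
Next Obligation.
exists (op_norm p + op_norm q); intro v; rewrite antilin_ext_plus.
eapply Rle_trans; [apply Cmod_triangle|].
pose proof (op_norm_bound p v); pose proof (op_norm_bound q v); lra.
Qed.

Program Definition functional_scal (a : C) (p : functional) : functional :=
  {| value := fun b => (a * p b)%C |}.
Next Obligation. now rewrite (value_compat p H). Qed.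
Next Obligation.
exists (Cmod a * op_norm p); intro v; rewrite antilin_ext_mult, Cmod_mult.
pose proof (op_norm_bound p v); pose proof (Cmod_ge_0 a); nra.
Qed.

Lemma op_norm_triangle p q :
  op_norm (functional_plus p q) <= op_norm p + op_norm q.
Proof.
apply op_norm_least.
- pose proof (op_norm_ge_0 p); pose proof (op_norm_ge_0 q); lra.
- intro v; simpl; rewrite antilin_ext_plus.
  eapply Rle_trans; [apply Cmod_triangle|].
  pose proof (op_norm_bound p v); pose proof (op_norm_bound q v); lra.
Qed.

Lemma op_norm_scal_le a p : op_norm (functional_scal a p) <= Cmod a * op_norm p.
Proof.
apply op_norm_least.
- apply Rmult_le_pos; [apply Cmod_ge_0|apply op_norm_ge_0].
- intro v; simpl; rewrite antilin_ext_mult, Cmod_mult.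
  pose proof (op_norm_bound p v); pose proof (Cmod_ge_0 a); nra.
Qed.

Lemma op_norm_scal_unit a p :
  Cmod a = 1 -> op_norm (functional_scal a p) = op_norm p.
Proof.
intro Ha; apply Rle_antisym.
- pose proof (op_norm_scal_le a p); rewrite Ha in *; lra.
- pose proof (op_norm_scal_le (/ a)%C (functional_scal a p)) as H.
  assert (Hn : a <> 0)
    by (intro H0; rewrite H0, Cmod_0 in Ha; lra).
  replace (functional_scal (/ a)%C (functional_scal a p)) with p in H.
  + rewrite Cmod_inv, Ha in H by exact Hn; lra.
  + apply functional_eq; intro b; simpl; field; exact Hn.
Qed.

Lemma op_norm_parallelogram_le p q :
  op_norm (functional_plus p q) ^ 2
  + op_norm (functional_plus p (functional_scal (RtoC (-1)) q)) ^ 2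
  <= 2 * op_norm p ^ 2 + 2 * op_norm q ^ 2.
Proof.
set (r := functional_plus p q).
set (s := functional_plus p (functional_scal (RtoC (-1)) q)).
set (a := op_norm r); set (b := op_norm s).
assert (Ha : 0 <= a) by apply op_norm_ge_0.
assert (Hb : 0 <= b) by apply op_norm_ge_0.
assert (approx : forall (x : functional) e, 0 < e ->
  exists v, seminorm v <= 1 /\ op_norm x - e <= Re (antilin_ext x v)).
{ intros x e He.
  assert (Hx : exists v, seminorm v <= 1 /\
                 op_norm x - e <= Cmod (antilin_ext x v)).
  { destruct (Classical_Prop.classic (exists v, seminorm v <= 1 /\
                 op_norm x - e <= Cmod (antilin_ext x v))) as [H|H]; [easy|].
    exfalso.
    assert (op_norm x <= op_norm x - e); [|lra].
    apply (proj2 (op_norm_lub x)); intros y [v [Hv ->]].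
    destruct (Rle_lt_dec (op_norm x - e) (Cmod (antilin_ext x v)));
      [exfalso; eauto|lra]. }
  destruct Hx as [v [Hv Hx]].
  set (z := antilin_ext x v) in *.
  destruct (Ceq_dec z 0) as [Hz|Hz].
  - exists v; fold z; split; [exact Hv|].
    rewrite Hz in *; rewrite Cmod_0 in Hx; exact Hx.
  - exists (comb_scal (z / Cmod z)%C v).
    assert (Hm : 0 < Cmod z) by (apply Cmod_gt_0; exact Hz).
    assert (Hm' : RtoC (Cmod z) <> 0)
      by (intro H; apply RtoC_inj in H; lra).
    split.
    + rewrite seminorm_scal, Cmod_div, Cmod_R, Rabs_pos_eq by (lra || exact Hm').
      unfold Rdiv; rewrite Rinv_r; lra.
    + rewrite antilin_ext_scal; fold z.
      replace (Cconj (z / Cmod z) * z)%C with (RtoC (Cmod z)); [exact Hx|].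
      rewrite Cdiv_conj by exact Hm'.
      replace (Cconj (RtoC (Cmod z))) with (RtoC (Cmod z))
        by (apply injective_projections; simpl; ring).
      replace (Cconj z / Cmod z * z)%C with (z * Cconj z / Cmod z)%C
        by (field; exact Hm').
      rewrite <- Cmod2_conj; simpl Nat.add; rewrite RtoC_pow; field; exact Hm'. }
assert (main : forall e, 0 < e ->
  a ^ 2 + b ^ 2 - e * (a + b) <=
  sqrt (op_norm p ^ 2 + op_norm q ^ 2) * sqrt (2 * (a ^ 2 + b ^ 2))).
{ intros e He.
  destruct (approx r e He) as [u [Hu Ru]], (approx s e He) as [v [Hv Rv]].
  fold a in Ru; fold b in Rv.
  set (u' := comb_scal (RtoC a) u); set (v' := comb_scal (RtoC b) v).
  assert (Hu' : seminorm u' <= a).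
  { unfold u'; rewrite seminorm_scal, Cmod_R, Rabs_pos_eq by exact Ha; nra. }
  assert (Hv' : seminorm v' <= b).
  { unfold v'; rewrite seminorm_scal, Cmod_R, Rabs_pos_eq by exact Hb; nra. }
  pose proof (seminorm_parallelogram u' v') as HP.
  set (w1 := u' ++ v') in *.
  set (w2 := u' ++ comb_scal (RtoC (-1)) v') in *.
  pose proof (op_norm_bound p w1) as B1; pose proof (op_norm_bound q w2) as B2.
  pose proof (re_le_Cmod (antilin_ext p w1)) as R1.
  pose proof (re_le_Cmod (antilin_ext q w2)) as R2.
  pose proof (Rle_abs (Re (antilin_ext p w1))) as S1.
  pose proof (Rle_abs (Re (antilin_ext q w2))) as S2.
  assert (EQ : Re (antilin_ext p w1) + Re (antilin_ext q w2)
               = a * Re (antilin_ext r u) + b * Re (antilin_ext s v)).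
  { unfold w1, w2, u', v', r, s; simpl.
    rewrite !antilin_ext_app, !antilin_ext_scal, !antilin_ext_plus.
    rewrite antilin_ext_mult.
    destruct (antilin_ext p u), (antilin_ext p v),
      (antilin_ext q u), (antilin_ext q v); simpl; ring. }
  assert (CS : op_norm p * seminorm w1 + op_norm q * seminorm w2
    <= sqrt (op_norm p ^ 2 + op_norm q ^ 2) * sqrt (2 * (a ^ 2 + b ^ 2))).
  { pose proof (op_norm_ge_0 p); pose proof (op_norm_ge_0 q).
    pose proof (seminorm_ge_0 w1); pose proof (seminorm_ge_0 w2).
    pose proof (seminorm_ge_0 u'); pose proof (seminorm_ge_0 v').
    set (P := op_norm p) in *; set (Q := op_norm q) in *.
    set (x := seminorm w1) in *; set (y := seminorm w2) in *.
    rewrite <- sqrt_mult by nra.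
    apply Rsqr_incr_0_var; [|apply sqrt_pos].
    rewrite Rsqr_sqrt by (apply Rmult_le_pos; nra).
    assert (x ^ 2 + y ^ 2 <= 2 * (a ^ 2 + b ^ 2)) by nra.
    assert ((P * x + Q * y) ^ 2 <= (P ^ 2 + Q ^ 2) * (x ^ 2 + y ^ 2)).
    { pose proof (pow2_ge_0 (P * y - Q * x)); nra. }
    assert (0 <= P ^ 2 + Q ^ 2) by nra.
    unfold Rsqr; nra. }
  nra. }
set (c := op_norm p ^ 2 + op_norm q ^ 2) in *.
assert (Hc : 0 <= c).
{ unfold c; pose proof (pow2_ge_0 (op_norm p));
  pose proof (pow2_ge_0 (op_norm q)); lra. }
set (d := a ^ 2 + b ^ 2) in *.
assert (Hd : 0 <= d) by (unfold d; nra).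
assert (Hle : d <= sqrt c * sqrt (2 * d)).
{ apply le_epsilon; intros e He.
  assert (H0 : 0 < a + b + 1) by lra.
  assert (H1 : 0 < e / (a + b + 1))
    by (apply Rdiv_lt_0_compat; assumption).
  pose proof (main _ H1) as H2.
  assert (e / (a + b + 1) * (a + b) <= e); [|lra].
  replace e with (e / (a + b + 1) * (a + b + 1)) at 2 by (field; lra).
  nra. }
rewrite <- sqrt_mult in Hle by lra.
assert (Hsq : d * d <= c * (2 * d)).
{ rewrite <- (sqrt_sqrt (c * (2 * d))) by nra.
  apply Rmult_le_compat; assumption. }
assert (d <= 2 * c); [|unfold c in *; lra].
destruct (Req_dec d 0) as [Hz|Hz]; [lra|].
apply (Rmult_le_reg_l d); lra.
Qed.

Lemma op_norm_parallelogram p q :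
  op_norm (functional_plus p q) ^ 2
  + op_norm (functional_plus p (functional_scal (RtoC (-1)) q)) ^ 2
  = 2 * op_norm p ^ 2 + 2 * op_norm q ^ 2.
Proof.
apply Rle_antisym; [apply op_norm_parallelogram_le|].
set (q' := functional_scal (RtoC (-1)) q).
pose proof (op_norm_parallelogram_le (functional_plus p q)
  (functional_plus p q')) as H.
replace (functional_plus (functional_plus p q) (functional_plus p q'))
  with (functional_scal (RtoC 2) p) in H.
2:{ apply functional_eq; intro b; simpl.
    apply injective_projections; simpl; ring. }
replace (functional_plus (functional_plus p q)
  (functional_scal (RtoC (-1)) (functional_plus p q')))
  with (functional_scal (RtoC 2) q) in H.
2:{ apply functional_eq; intro b; simpl.
    apply injective_projections; simpl; ring. }
assert (two : forall x, op_norm (functional_scal (RtoC 2) x) = 2 * op_norm x).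
{ intro x; apply Rle_antisym.
  - pose proof (op_norm_scal_le (RtoC 2) x) as H1.
    rewrite Cmod_R, Rabs_pos_eq in H1; lra.
  - pose proof (op_norm_scal_le (RtoC (/ 2)) (functional_scal (RtoC 2) x)) as H1.
    rewrite Cmod_R, Rabs_pos_eq in H1 by lra.
    replace (functional_scal (RtoC (/ 2)) (functional_scal (RtoC 2) x))
      with x in H1; [lra|].
    apply functional_eq; intro b; simpl.
    apply injective_projections; simpl; field. }
rewrite !two in H; lra.
Qed.

Definition functional_AbelianMonoid_mixin : AbelianMonoid.mixin_of functional.
Proof.
apply (@AbelianMonoid.Mixin functional functional_plus functional_zero);
  intros; apply functional_eq; intro; simpl; ring.
Defined.

Definition functional_AbelianMonoid :=
  AbelianMonoid.Pack functional functional_AbelianMonoid_mixin functional.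

Definition functional_AbelianGroup_mixin :
  AbelianGroup.mixin_of functional_AbelianMonoid.
Proof.
apply (@AbelianGroup.Mixin functional_AbelianMonoid
  (functional_scal (RtoC (-1)))).
intro p; apply functional_eq; intro b; simpl.
apply injective_projections; simpl; ring.
Defined.

Definition functional_AbelianGroup :=
  AbelianGroup.Pack functional
    (AbelianGroup.Class functional _ functional_AbelianGroup_mixin) functional.

Definition functional_ModuleSpace_mixin :
  ModuleSpace.mixin_of R_Ring functional_AbelianGroup.
Proof.
apply (@ModuleSpace.Mixin R_Ring functional_AbelianGroup
  (fun r : R => functional_scal (RtoC r)));
  intros; apply functional_eq; intro; simpl;
  apply injective_projections; unfold mult, plus, one; simpl; ring.
Defined.

Definition functional_ModuleSpace :=
  ModuleSpace.Pack R_Ring functional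
    (ModuleSpace.Class R_Ring functional _ functional_ModuleSpace_mixin)
    functional.

Definition functional_ball (p : functional) (e : R) (q : functional) : Prop :=
  op_norm (functional_plus q (functional_scal (RtoC (-1)) p)) < e.

Definition functional_UniformSpace_mixin : UniformSpace.mixin_of functional.
Proof.
apply (@UniformSpace.Mixin functional functional_zero functional_ball);
  unfold functional_ball.
- intros p e.
  replace (functional_plus p (functional_scal (RtoC (-1)) p))
    with (functional_scal (RtoC 0) p).
  + pose proof (op_norm_scal_le (RtoC 0) p) as H; rewrite Cmod_0 in H.
    pose proof (cond_pos e); lra.
  + apply functional_eq; intro b; simpl.
    apply injective_projections; simpl; ring.
- intros p q e H.
  replace (functional_plus p (functional_scal (RtoC (-1)) q)) with
    (functional_scal (RtoC (-1))
      (functional_plus q (functional_scal (RtoC (-1)) p))).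
  + rewrite op_norm_scal_unit; [exact H|].
    rewrite Cmod_R, Rabs_left; lra.
  + apply functional_eq; intro b; simpl.
    apply injective_projections; simpl; ring.
- intros p q r e1 e2 H1 H2.
  replace (functional_plus r (functional_scal (RtoC (-1)) p)) with
    (functional_plus (functional_plus q (functional_scal (RtoC (-1)) p))
      (functional_plus r (functional_scal (RtoC (-1)) q))).
  + eapply Rle_lt_trans; [apply op_norm_triangle|lra].
  + apply functional_eq; intro b; simpl.
    apply injective_projections; simpl; ring.
Defined.

Definition functional_UniformSpace :=
  UniformSpace.Pack functional functional_UniformSpace_mixin functional.

Definition functional_NormedModuleAux :=
  NormedModuleAux.Pack R_AbsRing functional
    (NormedModuleAux.Class R_AbsRing functional
      (ModuleSpace.class R_Ring functional_ModuleSpace)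
      functional_UniformSpace_mixin) functional.

Definition functional_NormedModule_mixin :
  NormedModule.mixin_of R_AbsRing functional_NormedModuleAux.
Proof.
apply (@NormedModule.Mixin R_AbsRing functional_NormedModuleAux op_norm 1).
- exact op_norm_triangle.
- intros r p; eapply Rle_trans; [apply op_norm_scal_le|].
  rewrite Cmod_R; apply Rle_refl.
- intros p q e H; exact H.
- intros p q e H; rewrite Rmult_1_l; exact H.
- intros p H; apply functional_eq; intro b.
  pose proof (value_bound p b) as H1; rewrite H, Rmult_0_l in H1.
  apply Cmod_eq_0, Rle_antisym; [exact H1|apply Cmod_ge_0].
Defined.

Definition functional_NormedModule :=
  NormedModule.Pack R_AbsRing functional
    (NormedModule.Class R_AbsRing functional _ functional_NormedModule_mixin)
    functional.

Lemma C_cauchy_lim (F : (functional -> Prop) -> Prop) (FF : ProperFilter F)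
  (g : functional -> C) :
  (forall e, 0 < e -> exists c : C, F (fun p => Cmod (g p - c) < e)) ->
  exists l : C, forall e, 0 < e -> F (fun p => Cmod (g p - l) < e).
Proof.
intro H.
assert (part : forall k : C -> R,
  (forall c d, Rabs (k c - k d) <= Cmod (c - d)) ->
  exists l : R, forall e, 0 < e -> F (fun p => Rabs (k (g p) - l) < e)).
{ intros k Hk.
  pose (G := filtermap (fun p => k (g p)) F).
  assert (FG : ProperFilter G) by (apply filtermap_proper_filter; exact FF).
  exists (R_complete_lim G); intros e He.
  apply (@R_complete G FG) with (eps := mkposreal e He).
  intro eps; destruct (H eps (cond_pos eps)) as [c Hc].
  exists (k c); unfold G, filtermap.
  revert Hc; apply filter_imp; intros p Hp.
  unfold ball; simpl; unfold AbsRing_ball, abs, minus, plus, opp; simpl.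
  eapply Rle_lt_trans; [|exact Hp]; apply Hk. }
destruct (part Re) as [x Hx].
{ intros c d.
  replace (Re c - Re d) with (Re (c - d)) by (destruct c, d; simpl; ring).
  apply re_le_Cmod. }
destruct (part Im) as [y Hy].
{ intros c d.
  replace (Im c - Im d) with (Im (c - d)) by (destruct c, d; simpl; ring).
  eapply Rle_trans; [|apply Rmax_Cmod]; apply Rmax_r. }
exists (x, y); intros e He.
assert (He' : 0 < e / 2) by lra.
generalize (filter_and _ _ (Hx _ He') (Hy _ He')); apply filter_imp.
intros p [H1 H2].
replace (g p - (x, y))%C
  with (RtoC (Re (g p) - x) + Ci * RtoC (Im (g p) - y))%C
  by (destruct (g p); apply injective_projections; simpl; ring).
eapply Rle_lt_trans; [apply Cmod_triangle|].
rewrite Cmod_mult, Cmod_Ci, !Cmod_R; lra.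
Qed.

Lemma functional_complete (F : (functional -> Prop) -> Prop) :
  ProperFilter F ->
  (forall e : posreal, exists p, F (functional_ball p e)) ->
  exists l, forall e : posreal, F (functional_ball l e).
Proof.
intros FF HF.
assert (close : forall (p q : functional) v,
  Cmod (antilin_ext q v - antilin_ext p v) <=
  op_norm (functional_plus q (functional_scal (RtoC (-1)) p)) * seminorm v).
{ intros p q v.
  pose proof (op_norm_bound
    (functional_plus q (functional_scal (RtoC (-1)) p)) v) as H.
  simpl in H; rewrite antilin_ext_plus, antilin_ext_mult in H.
  replace (antilin_ext q v - antilin_ext p v)%C with
    (antilin_ext q v + RtoC (-1) * antilin_ext p v)%C; [exact H|].
  apply injective_projections; simpl; ring. }
assert (Hpt : forall v : list (C * B), exists l : C, forall e, 0 < e ->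
  F (fun p => Cmod (antilin_ext p v - l) < e)).
{ intro v; apply C_cauchy_lim; [exact FF|].
  intros e He.
  assert (Hs : 0 < seminorm v + 1)
    by (pose proof (seminorm_ge_0 v); lra).
  assert (He' : 0 < e / (seminorm v + 1))
    by (apply Rdiv_lt_0_compat; assumption).
  destruct (HF (mkposreal _ He')) as [p Hp].
  exists (antilin_ext p v); revert Hp; apply filter_imp; intros q Hq.
  unfold functional_ball in Hq; simpl in Hq.
  eapply Rle_lt_trans; [apply close|].
  replace e with (e / (seminorm v + 1) * (seminorm v + 1)) by (field; lra).
  pose proof (seminorm_ge_0 v); nra. }
pose (L := fun b => proj1_sig (constructive_indefinite_description _
  (Hpt ((RtoC 1, b) :: nil)))).
assert (HL : forall b e, 0 < e -> F (fun p => Cmod (value p b - L b) < e)).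
{ intros b e He; unfold L.
  destruct (constructive_indefinite_description _ _) as [l Hl]; simpl.
  generalize (Hl e He); apply filter_imp; intros p Hp.
  rewrite antilin_ext_single in Hp; exact Hp. }
assert (HLv : forall v e, 0 < e ->
  F (fun p => Cmod (antilin_ext p v - antilin_ext L v) < e)).
{ induction v as [|[c b] v IH]; intros e He.
  - apply filter_forall; intro p; simpl.
    replace (0 - 0)%C with (RtoC 0) by ring; rewrite Cmod_0; exact He.
  - assert (Hc : 0 < Cmod c + 1) by (pose proof (Cmod_ge_0 c); lra).
    assert (H1 : 0 < e / 2 / (Cmod c + 1))
      by (apply Rdiv_lt_0_compat; lra).
    assert (H2 : 0 < e / 2) by lra.
    generalize (filter_and _ _ (HL b _ H1) (IH _ H2)); apply filter_imp.
    intros p [P1 P2]; simpl.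
    replace (Cconj c * value p b + antilin_ext p v -
      (Cconj c * L b + antilin_ext L v))%C with
      (Cconj c * (value p b - L b) + (antilin_ext p v - antilin_ext L v))%C
      by ring.
    eapply Rle_lt_trans; [apply Cmod_triangle|].
    rewrite Cmod_mult, Cmod_conj.
    assert (Cmod c * Cmod (value p b - L b) <= e / 2); [|lra].
    replace (e / 2) with ((Cmod c + 1) * (e / 2 / (Cmod c + 1)))
      by (field; lra).
    pose proof (Cmod_ge_0 c); pose proof (Cmod_ge_0 (value p b - L b)).
    apply Rmult_le_compat; lra. }
assert (Hlim : forall (p : functional) e,
  F (functional_ball p e) -> forall v,
  Cmod (antilin_ext L v - antilin_ext p v) <= e * seminorm v).
{ intros p e Hp v; apply le_epsilon; intros d Hd.
  destruct (filter_ex _ (filter_and _ _ Hp (HLv v d Hd))) as [q [Q1 Q2]].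
  unfold functional_ball in Q1.
  replace (antilin_ext L v - antilin_ext p v)%C with
    (- (antilin_ext q v - antilin_ext L v) +
      (antilin_ext q v - antilin_ext p v))%C by ring.
  eapply Rle_trans; [apply Cmod_triangle|]; rewrite Cmod_opp.
  pose proof (close p q v); pose proof (seminorm_ge_0 v); nra. }
assert (Hbd : exists M, forall v, Cmod (antilin_ext L v) <= M * seminorm v).
{ destruct (HF (mkposreal 1 Rlt_0_1)) as [p Hp].
  exists (1 + op_norm p); intro v.
  pose proof (Hlim p 1 Hp v) as H1; pose proof (op_norm_bound p v) as H2.
  replace (antilin_ext L v) with
    ((antilin_ext L v - antilin_ext p v) + antilin_ext p v)%C by ring.
  eapply Rle_trans; [apply Cmod_triangle|]; lra. }
assert (Hcompat : forall b b', E b b' -> L b = L b').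
{ intros b b' Hb.
  assert (H0 : Cmod (L b - L b') <= 0).
  { apply le_epsilon; intros e He; assert (He' : 0 < e / 2) by lra.
    destruct (filter_ex _ (filter_and _ _ (HL b _ He') (HL b' _ He')))
      as [p [P1 P2]].
    rewrite (value_compat p Hb) in P1.
    replace (L b - L b')%C with
      ((value p b' - L b') + - (value p b' - L b))%C by ring.
    eapply Rle_trans; [apply Cmod_triangle|]; rewrite Cmod_opp; lra. }
  assert (H1 : (L b - L b')%C = 0)
    by (apply Cmod_eq_0, Rle_antisym; [exact H0|apply Cmod_ge_0]).
  replace (L b) with ((L b - L b') + L b')%C by ring; rewrite H1; ring. }
exists (Build_functional Hcompat Hbd); intro e.
assert (He : 0 < e / 3) by (pose proof (cond_pos e); lra).
destruct (HF (mkposreal _ He)) as [p Hp]; simpl in Hp.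
pose proof (Hlim p _ Hp) as H1.
generalize Hp; apply filter_imp; intros q Hq; unfold functional_ball in *.
set (l := Build_functional Hcompat Hbd).
replace (functional_plus q (functional_scal (RtoC (-1)) l)) with
  (functional_plus (functional_plus q (functional_scal (RtoC (-1)) p))
     (functional_scal (RtoC (-1))
        (functional_plus l (functional_scal (RtoC (-1)) p)))).
2:{ apply functional_eq; intro b; simpl.
    apply injective_projections; simpl; ring. }
eapply Rle_lt_trans; [apply op_norm_triangle|].
rewrite (@op_norm_scal_unit (RtoC (-1))) by (rewrite Cmod_R, Rabs_left; lra).
assert (op_norm (functional_plus l (functional_scal (RtoC (-1)) p)) <= e / 3);
  [|lra].
apply op_norm_least; [lra|].
intro v; simpl; rewrite antilin_ext_plus, antilin_ext_mult.
replace (antilin_ext L v + RtoC (-1) * antilin_ext p v)%C with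
  (antilin_ext L v - antilin_ext p v)%C; [apply H1|].
apply injective_projections; simpl; ring.
Qed.

Definition functional_lim (F : (functional -> Prop) -> Prop) : functional :=
  epsilon (inhabits functional_zero)
    (fun l => forall e : posreal, F (functional_ball l e)).

Definition functional_CompleteSpace_mixin :
  CompleteSpace.mixin_of functional_UniformSpace.
Proof.
apply (@CompleteSpace.Mixin functional_UniformSpace functional_lim).
- intros F FF HF; unfold functional_lim.
  apply (epsilon_spec (inhabits functional_zero)
    (fun l => forall e : posreal, F (functional_ball l e))).
  apply functional_complete; assumption.
- intros F1 F2 H12 H21; unfold functional_lim.
  replace (fun l => forall e : posreal, F2 (functional_ball l e))
    with (fun l => forall e : posreal, F1 (functional_ball l e)).
  + intro e; apply (@ball_center functional_UniformSpace).
  + apply functional_extensionality; intro l.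
    apply propositional_extensionality.
    split; intros H e; [apply H21|apply H12]; apply H.
Defined.

Definition functional_CompleteNormedModule : CompleteNormedModule R_AbsRing :=
  CompleteNormedModule.Pack R_AbsRing functional
    (CompleteNormedModule.Class R_AbsRing functional
      (NormedModule.class R_AbsRing functional_NormedModule)
      functional_CompleteSpace_mixin) functional.

Let polarf : functional -> functional -> R := @polar functional_NormedModule.

(* [polar p q] is [Re <p, q>] and [Im <p, q> = Re <i p, q>]. *)
Definition functional_inner (p q : functional) : C :=
  (polarf p q, polarf (functional_scal Ci p) q).

Lemma functional_parallelogram (x y : functional_NormedModule) :
  norm (plus x y) ^ 2 + norm (minus x y) ^ 2 = 2 * norm x ^ 2 + 2 * norm y ^ 2.
Proof. exact (op_norm_parallelogram x y). Qed.

Lemma polarf_scal_unit (a : C) p q : Cmod a = 1 ->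
  polarf (functional_scal a p) (functional_scal a q) = polarf p q.
Proof.
intro Ha; unfold polarf, polar.
replace (@plus functional_NormedModule (functional_scal a p)
  (functional_scal a q)) with (functional_scal a (functional_plus p q))
  by (apply functional_eq; intro b; simpl; ring).
change (@norm R_AbsRing functional_NormedModule) with op_norm.
rewrite !op_norm_scal_unit by exact Ha; reflexivity.
Qed.

Lemma polarf_plus p q r :
  polarf p (functional_plus q r) = polarf p q + polarf p r.
Proof. exact (polar_plus_r functional_parallelogram p q r). Qed.

Lemma polarf_scal (t : R) p q :
  polarf p (functional_scal (RtoC t) q) = t * polarf p q.
Proof. exact (polar_scal_r functional_parallelogram p q t). Qed.

Lemma polarf_sym p q : polarf p q = polarf q p.
Proof. exact (@polar_sym functional_NormedModule p q). Qed.

Lemma polarf_Ci p q :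
  polarf (functional_scal Ci p) q = - polarf p (functional_scal Ci q).
Proof.
rewrite <- (polarf_scal_unit (a := Ci) p (functional_scal Ci q)) by apply Cmod_Ci.
replace (functional_scal Ci (functional_scal Ci q))
  with (functional_scal (RtoC (-1)) q).
- rewrite polarf_scal; ring.
- apply functional_eq; intro b; simpl.
  apply injective_projections; simpl; ring.
Qed.

Definition kernel_space : HilbertSpace.
Proof.
apply (@Build_HilbertSpace functional_CompleteNormedModule functional_scal
  functional_inner).
- reflexivity.
- intros; apply functional_eq; intro; simpl; ring.
- intros; apply functional_eq; intro; simpl; ring.
- intros; apply functional_eq; intro; simpl; ring.
- intros p q r; unfold functional_inner.
  change (@plus functional_CompleteNormedModule q r) with (functional_plus q r).
  rewrite !polarf_plus; reflexivity.
- intros a p q; unfold functional_inner.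
  replace (functional_scal a q) with
    (functional_plus (functional_scal (RtoC (Re a)) q)
       (functional_scal (RtoC (Im a)) (functional_scal Ci q))).
  + rewrite !polarf_plus, !polarf_scal, polarf_scal_unit by apply Cmod_Ci.
    rewrite polarf_Ci.
    generalize (polarf p q), (polarf p (functional_scal Ci q)); intros x y.
    destruct a; apply injective_projections; simpl; ring.
  + apply functional_eq; intro b; simpl.
    destruct a; apply injective_projections; simpl; ring.
- intros p q; unfold functional_inner, Cconj; simpl.
  f_equal; [apply polarf_sym|].
  rewrite polarf_Ci, polarf_sym; reflexivity.
- intros p; unfold functional_inner, RtoC; f_equal.
  + exact (polar_diag functional_parallelogram p).
  + pose proof (polarf_Ci p p) as H; rewrite (polarf_sym p) in H.
    lra.
Defined.

End KernelSpace.

(** * Symmetric Fock space *)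

Section TensorKernel.

Variable h : HilbertSpace.

(* [<f_1 (x) ... (x) f_m, g_1 (x) ... (x) g_n>]: product vectors of different
   lengths are orthogonal, and the empty product is the vacuum. *)
Fixpoint tensor_inner (l m : list h) : C :=
  match l, m with
  | nil, nil => 1
  | f :: l', g :: m' => (inner f g * tensor_inner l' m')%C
  | _, _ => 0
  end.

Lemma inner_plus_l (x y z : h) : inner (plus x y) z = (inner x z + inner y z)%C.
Proof.
rewrite (inner_conj z), inner_plus_r, Cplus_conj, <- !inner_conj; reflexivity.
Qed.

Lemma inner_cscal_l (a : C) (x y : h) :
  inner (cscal a x) y = (Cconj a * inner x y)%C.
Proof.
rewrite (inner_conj y), inner_cscal_r, Cmult_conj, <- inner_conj; reflexivity.
Qed.

Lemma inner_zero_r (x : h) : inner x zero = 0.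
Proof.
pose proof (inner_plus_r x (zero : h) zero) as H.
replace (plus (zero : h) zero) with (zero : h) in H
  by (symmetry; apply plus_zero_r).
replace (inner x zero) with (inner x zero + inner x zero - inner x zero)%C
  by ring.
rewrite <- H; ring.
Qed.

Lemma inner_zero_l (x : h) : inner zero x = 0.
Proof.
rewrite inner_conj, inner_zero_r; apply injective_projections; simpl; ring.
Qed.

Section SchurProduct.

Variables (B : Type) (G : B -> B -> C).
Hypothesis Gpos : positive_kernel G.

Definition schur_kernel (x y : h * B) : C :=
  (inner (fst x) (fst y) * G (snd x) (snd y))%C.

Lemma schur_kernel_zero c (b : B) d :
  kernel_form schur_kernel ((c, (zero, b)) :: d) ((c, (zero, b)) :: d)
  = kernel_form schur_kernel d d.
Proof.
assert (H1 : forall l, lin_ext (schur_kernel (zero, b)) l = 0).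
{ induction l as [|[c' x] l IH]; cbn [lin_ext]; [reflexivity|].
  rewrite IH; unfold schur_kernel; cbn [fst snd]; rewrite inner_zero_l; ring. }
unfold kernel_form at 1; cbn [antilin_ext]; rewrite H1.
unfold kernel_form.
rewrite (antilin_ext_ext (q := fun x => lin_ext (schur_kernel x) d)).
- ring.
- intro x; cbn [lin_ext]; unfold schur_kernel at 1; cbn [fst snd].
  rewrite inner_zero_r; ring.
Qed.

Definition proj_away (e g : h) : h :=
  plus g (cscal (- (inner e g / RtoC (norm e ^ 2)))%C e).

Lemma proj_away_inner (e f g : h) : norm e <> 0 ->
  inner f g = (inner (proj_away e f) (proj_away e g)
    + inner f e * / RtoC (norm e ^ 2) * inner e g)%C.
Proof.
intro He; unfold proj_away.
rewrite !inner_plus_l, !inner_plus_r, !inner_cscal_l, !inner_cscal_r.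
rewrite inner_norm, Copp_conj.
assert (Hn : RtoC (norm e ^ 2) <> 0).
{ intro H; apply RtoC_inj in H; apply (pow_nonzero _ 2) in He; auto. }
rewrite Cdiv_conj by exact Hn; rewrite <- inner_conj.
replace (Cconj (RtoC (norm e ^ 2))) with (RtoC (norm e ^ 2))
  by (apply injective_projections; simpl; ring).
field; exact Hn.
Qed.

Lemma proj_away_self (e : h) : norm e <> 0 -> proj_away e e = zero.
Proof.
intro He; unfold proj_away; rewrite inner_norm.
assert (Hn : RtoC (norm e ^ 2) <> 0).
{ intro H; apply RtoC_inj in H; apply (pow_nonzero _ 2) in He; auto. }
replace (- (RtoC (norm e ^ 2) / RtoC (norm e ^ 2)))%C with (RtoC (-1)).
2:{ transitivity (- RtoC 1)%C; [|f_equal; field; exact Hn].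
    apply injective_projections; simpl; ring. }
rewrite cscal_RtoC.
transitivity (plus e (opp e)); [f_equal; exact (scal_opp_one e)|].
exact (plus_opp_r (G := CompleteNormedModule.AbelianGroup R_AbsRing h) e).
Qed.

Definition map_vec (P : h -> h) (v : list (C * (h * B))) :=
  map (fun x => (fst x, (P (fst (snd x)), snd (snd x)))) v.

Definition coeff_comb (e : h) (v : list (C * (h * B))) : list (C * B) :=
  map (fun x => ((fst x * inner e (fst (snd x)))%C, snd (snd x))) v.

Lemma schur_lin_ext (e f : h) b v : norm e <> 0 ->
  lin_ext (schur_kernel (f, b)) v =
  (lin_ext (schur_kernel (proj_away e f, b)) (map_vec (proj_away e) v)
   + inner f e * / RtoC (norm e ^ 2) * lin_ext (G b) (coeff_comb e v))%C.
Proof.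
intro He; induction v as [|[c [g b']] v IH]; simpl; [ring|].
rewrite IH; unfold schur_kernel; cbn [fst snd].
rewrite (proj_away_inner f g He); simpl; ring.
Qed.

Lemma schur_form (e : h) v : norm e <> 0 ->
  kernel_form schur_kernel v v =
  (kernel_form schur_kernel (map_vec (proj_away e) v) (map_vec (proj_away e) v)
   + RtoC (/ norm e ^ 2) * kernel_form G (coeff_comb e v) (coeff_comb e v))%C.
Proof.
intro He; unfold kernel_form.
assert (Hgen : forall w,
  antilin_ext (fun x => lin_ext (schur_kernel x) v) w =
  (antilin_ext (fun x => lin_ext (schur_kernel x) (map_vec (proj_away e) v))
     (map_vec (proj_away e) w)
   + RtoC (/ norm e ^ 2) *
     antilin_ext (fun b => lin_ext (G b) (coeff_comb e v)) (coeff_comb e w))%C).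
{ induction w as [|[c [f b]] w IH]; cbn [antilin_ext map_vec coeff_comb map fst snd];
    [ring|].
  rewrite IH, (schur_lin_ext f b v He), Cmult_conj, <- inner_conj.
  rewrite RtoC_inv by (apply pow_nonzero; exact He).
  unfold map_vec, coeff_comb; ring. }
apply Hgen.
Qed.

Lemma schur_positive : positive_kernel schur_kernel.
Proof.
intro v; remember (length v) as n eqn:Hn; revert v Hn.
induction n as [|n IH]; intros [|[c [e b]] d] Hn; simpl in Hn; try discriminate.
- unfold kernel_form; simpl; lra.
- injection Hn as Hn.
  destruct (Req_dec (norm e) 0) as [He|He].
  + apply (norm_eq_zero e) in He.
    assert (E0 : e = (zero : h)) by exact He.
    rewrite E0, schur_kernel_zero; apply IH; exact Hn.
  + rewrite (schur_form _ He).
    set (w := coeff_comb e _).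
    cbn [map_vec map fst snd]; rewrite (proj_away_self He), schur_kernel_zero.
    rewrite re_plus, re_scal_l.
    apply Rplus_le_le_0_compat.
    * apply IH; rewrite length_map; exact Hn.
    * apply Rmult_le_pos; [|apply Gpos].
      left; apply Rinv_0_lt_compat, pow_lt.
      pose proof (norm_ge_0 e); lra.
Qed.

End SchurProduct.

Fixpoint tensor_trunc (n : nat) (l m : list h) : C :=
  match l, m with
  | nil, nil => 1
  | f :: l', g :: m' =>
      match n with
      | O => 0
      | S n' => (inner f g * tensor_trunc n' l' m')%C
      end
  | _, _ => 0
  end.

Fixpoint nil_coeff (v : list (C * list h)) : C :=
  match v with
  | nil => 0
  | (c, nil) :: v' => (c + nil_coeff v')%C
  | (c, _ :: _) :: v' => nil_coeff v'
  end.

Fixpoint cons_part (v : list (C * list h)) : list (C * (h * list h)) :=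
  match v with
  | nil => nil
  | (c, nil) :: v' => cons_part v'
  | (c, f :: l) :: v' => (c, (f, l)) :: cons_part v'
  end.

Lemma lin_ext_split (p : list h -> C) v :
  lin_ext p v = (nil_coeff v * p nil +
    lin_ext (fun x => p (fst x :: snd x)) (cons_part v))%C.
Proof.
induction v as [|[c [|f l]] v IH]; simpl; [ring| |]; rewrite IH; ring.
Qed.

Lemma antilin_ext_split (p : list h -> C) v :
  antilin_ext p v = (Cconj (nil_coeff v) * p nil +
    antilin_ext (fun x => p (fst x :: snd x)) (cons_part v))%C.
Proof.
induction v as [|[c [|f l]] v IH]; simpl;
  [|rewrite IH, Cplus_conj; ring|rewrite IH; ring].
replace (Cconj 0) with (RtoC 0)
  by (apply injective_projections; simpl; ring).
ring.
Qed.

Lemma lin_ext_ext (B : Type) (p q : B -> C) v :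
  (forall b, p b = q b) -> lin_ext p v = lin_ext q v.
Proof.
intro H; induction v as [|[c b] v IH]; simpl; [easy|now rewrite IH, H].
Qed.

Lemma lin_ext_0 (B : Type) v : lin_ext (fun _ : B => RtoC 0) v = 0.
Proof. induction v as [|[c b] v IH]; simpl; [easy|rewrite IH; ring]. Qed.

Lemma nil_cons_form (K : list h -> list h -> C) (K' : h * list h -> h * list h -> C)
  v : K nil nil = 1 -> (forall f l, K nil (f :: l) = 0) ->
  (forall f l, K (f :: l) nil = 0) ->
  (forall x y, K (fst x :: snd x) (fst y :: snd y) = K' x y) ->
  kernel_form K v v =
  (RtoC (Cmod (nil_coeff v) ^ 2) + kernel_form K' (cons_part v) (cons_part v))%C.
Proof.
intros H1 H2 H3 H4; unfold kernel_form; rewrite antilin_ext_split; f_equal.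
- rewrite lin_ext_split, H1.
  rewrite (lin_ext_ext (q := fun _ => RtoC 0)), lin_ext_0
    by (intro x; apply H2).
  rewrite Cmod2_conj; ring.
- apply antilin_ext_ext; intro x; rewrite lin_ext_split, H3.
  rewrite (lin_ext_ext (q := K' x)) by (intro y; apply H4); ring.
Qed.

Lemma tensor_trunc_positive n : positive_kernel (tensor_trunc n).
Proof.
induction n as [|n IH]; intro v.
- rewrite (nil_cons_form (K' := fun _ _ => RtoC 0)); try reflexivity.
  replace (kernel_form (fun _ _ : h * list h => RtoC 0) (cons_part v)
    (cons_part v)) with (RtoC 0).
  + rewrite re_plus, !re_RtoC.
    pose proof (pow2_ge_0 (Cmod (nil_coeff v))); lra.
  + unfold kernel_form.
    generalize (cons_part v) at 2; intro w.
    induction w as [|[c b] w IH]; simpl; [easy|].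
    rewrite <- IH, lin_ext_0; ring.
- rewrite (nil_cons_form (K' := schur_kernel (tensor_trunc n)));
    try reflexivity.
  rewrite re_plus, re_RtoC.
  pose proof (pow2_ge_0 (Cmod (nil_coeff v))).
  pose proof (schur_positive IH (cons_part v)); lra.
Qed.

Lemma tensor_trunc_eq n l m : (length l <= n)%nat ->
  tensor_trunc n l m = tensor_inner l m.
Proof.
revert l m; induction n as [|n IH]; intros [|f l] [|g m] Hl;
  simpl in *; try reflexivity; try lia.
rewrite IH by lia; reflexivity.
Qed.

Lemma tensor_inner_positive : positive_kernel tensor_inner.
Proof.
intro v.
assert (Hn : exists n, forall w, List.incl w v ->
  antilin_ext (fun l => lin_ext (tensor_inner l) v) w =
  antilin_ext (fun l => lin_ext (tensor_trunc n l) v) w).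
{ exists (list_max (map (fun x => length (snd x)) v)).
  induction w as [|[c l] w IH]; intro Hw; [reflexivity|]; simpl.
  rewrite IH by (intros x Hx; apply Hw; right; exact Hx).
  f_equal; f_equal; apply lin_ext_ext; intro m; symmetry.
  apply tensor_trunc_eq.
  pose proof (proj1 (list_max_le _ _) (Nat.le_refl
    (list_max (map (fun x => length (snd x)) v)))) as Hm.
  rewrite Forall_forall in Hm; apply Hm.
  apply (in_map (fun x : C * list h => length (snd x)) v (c, l)).
  apply Hw; left; reflexivity. }
destruct Hn as [n Hn]; unfold kernel_form.
rewrite Hn by apply incl_refl; apply (tensor_trunc_positive n v).
Qed.

End TensorKernel.

(* The full Fock space is the completion of the algebraic tensor algebra of [h]
   for [tensor_inner], and its elements [phi] are identified with the bounded
   antilinear functionals [l |-> <f_1 (x) ... (x) f_n, phi>], [l = [f_1;...;f_n]].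
   Invariance under permutations of [l] means that [phi] is in the range of the
   symmetrization projection. Antilinearity in each [f_k] needs no clause, for
   it follows from boundedness. *)
Definition fock (h : HilbertSpace) : HilbertSpace :=
  kernel_space (@Permutation h) (@tensor_inner_positive h).

Section FieldOperators.

Variable h : HilbertSpace.

(* [amplitude phi [f_1;...;f_n]] is [<f_1 (x) ... (x) f_n, phi>]. *)
Definition amplitude (phi : fock h) : list h -> C := value phi.

Definition finite_particle (phi : fock h) : Prop :=
  exists n, forall l, (n < length l)%nat -> amplitude phi l = 0.

(* [contract f p [g_1;...;g_n]] is the sum over [k] of [<g_k, f>] times [p] at the
   list with [g_k] removed. *)
Fixpoint contract (f : h) (p : list h -> C) (l : list h) : C :=
  match l with
  | nil => 0
  | g :: l' => (inner g f * p l' + contract f (fun m => p (g :: m)) l')%C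
  end.

End FieldOperators.

(** * Unbounded operators, given by their graphs *)

Definition operator (X : HilbertSpace) := X -> X -> Prop.

Definition op_closure (X : HilbertSpace) (T : operator X) : operator X :=
  fun x y => forall e, 0 < e -> exists x' y',
    T x' y' /\ norm (minus x' x) < e /\ norm (minus y' y) < e.

Definition closable (X : HilbertSpace) (T : operator X) : Prop :=
  forall x y y', op_closure T x y -> op_closure T x y' -> y = y'.

Definition op_cscal (X : HilbertSpace) (a : C) (T : operator X) : operator X :=
  fun x y => exists z, T x z /\ y = cscal a z.

Definition bounded_operator (X : HilbertSpace) (T : X -> X) : Prop :=
  is_linear T /\ forall (a : C) x, T (cscal a x) = cscal a (T x).

(** * Annihilation, creation and Segal field operators *)

(* Both are taken on the finite particle subspace, where
   [a(f) (g_1 (x) ... (x) g_n) = sqrt n <f, g_1> g_2 (x) ... (x) g_n] and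
   [a*(f) phi] is [sqrt (n+1)] times the symmetrization of [f (x) phi] for an
   [n]-particle vector [phi]; both are tested against product vectors. *)
Definition annihilation (h : HilbertSpace) (f : h) : operator (fock h) :=
  fun phi psi => finite_particle phi /\
    forall l, amplitude psi l =
      (RtoC (sqrt (INR (S (length l)))) * amplitude phi (f :: l))%C.

Definition creation (h : HilbertSpace) (f : h) : operator (fock h) :=
  fun phi psi => finite_particle phi /\
    forall l, amplitude psi l =
      (RtoC (/ sqrt (INR (length l))) * contract f (amplitude phi) l)%C.

Definition segal (h : HilbertSpace) (f : h) : operator (fock h) :=
  op_closure (fun phi psi => exists psi1 psi2,
    annihilation f phi psi1 /\ creation f phi psi2 /\
    psi = cscal (RtoC (/ sqrt 2)) (plus psi1 psi2)).

(** * Semigroups *)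

Definition c0_semigroup (X : HilbertSpace) (T : R -> X -> X) : Prop :=
  (forall t, 0 <= t -> bounded_operator (T t)) /\
  (forall x, T 0 x = x) /\
  (forall s t, 0 <= s -> 0 <= t -> forall x, T (s + t) x = T s (T t x)) /\
  (forall x, continuous_on (fun t => 0 <= t) (fun t => T t x)).

Definition generator (X : HilbertSpace) (T : R -> X -> X) : operator X :=
  fun x y =>
    filterlim (fun t => scal (/ t) (minus (T t x) x)) (at_right 0) (locally y).

(* [e^G = S], where [e^(t G)] denotes the semigroup generated by [G]. *)
Definition is_exp (X : HilbertSpace) (G : operator X) (S : X -> X) : Prop :=
  exists T, c0_semigroup T /\ (forall x y, G x y <-> generator T x y) /\
    forall x, S x = T 1 x.

Definition is_weyl (h : HilbertSpace) (f : h) : (fock h -> fock h) -> Prop :=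
  is_exp (op_cscal Ci (segal f)).

(** * Evolution systems on the unit interval *)

Definition unit_interval (t : R) : Prop := 0 <= t <= 1.

Definition dense_subspace (X : HilbertSpace) (Y : X -> Prop) : Prop :=
  (forall x y, Y x -> Y y -> Y (plus x y)) /\
  (forall (a : C) x, Y x -> Y (cscal a x)) /\
  (forall x e, 0 < e -> exists y, Y y /\ norm (minus y x) < e).

(* [x' = A x] on [[s, 1]] with [x s = y]: [x] is continuously differentiable
   on [[s, 1]] (one-sidedly at the end points) with values in [Y]. *)
Definition ivp_solution (X : HilbertSpace) (A : R -> operator X)
    (Y : X -> Prop) (s : R) (y : X) (x : R -> X) : Prop :=
  x s = y /\
  exists dx : R -> X,
    continuous_on (fun t => s <= t <= 1) dx /\
    forall t, s <= t <= 1 ->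
      Y (x t) /\ A t (x t) (dx t) /\
      filterdiff x (within (fun u => s <= u <= 1) (locally t))
        (fun u : R => scal u (dx t)).

Definition evolution_system (X : HilbertSpace) (A : R -> operator X)
    (Y : X -> Prop) (U : R -> R -> X -> X) : Prop :=
  dense_subspace Y /\
  (forall y, Y y -> forall t, unit_interval t -> exists z, A t y z) /\
  (forall s t, 0 <= s <= t -> t <= 1 -> bounded_operator (U t s)) /\
  (forall y s, Y y -> 0 <= s < 1 -> ivp_solution A Y s y (fun t => U t s y)) /\
  (forall r s t, 0 <= r -> r <= s -> s <= t -> t <= 1 ->
     forall x, U t s (U s r x) = U t r x) /\
  (forall x, continuous_on
     (fun p : R * R => 0 <= fst p /\ fst p <= snd p /\ snd p <= 1)
     (fun p => U (snd p) (fst p) x)).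

Definition maximal_continuity_subspace (X : HilbertSpace)
    (A : R -> operator X) : X -> Prop :=
  fun y => exists g : R -> X,
    (forall t, unit_interval t -> A t y (g t)) /\ continuous_on unit_interval g.

(* The operator [y |-> int_s^t A(tau) y dtau] with domain the maximal
   continuity subspace. *)
Definition integral_operator (X : HilbertSpace) (A : R -> operator X)
    (s t : R) : operator X :=
  fun y z => maximal_continuity_subspace A y /\
    exists g : R -> X,
      (forall u, unit_interval u -> A u y (g u)) /\ is_RInt g s t z.

Definition phase (h : HilbertSpace) (f : R -> h) (s t : R) : C :=
  let theta := - (1 / 2) *
    RInt (fun u => RInt (fun v => Im (inner (f u) (f v))) s u) s t in
  (cos theta, sin theta).

(* Main.v *)
Require Import Defs.
From Stdlib Require Import Reals Factorial Lra Lia List Permutation ClassicalEpsilon.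
From Coquelicot Require Import Coquelicot.

(** The commutator of two field operators is a scalar, [i Im <f, g>], so that the
    time-ordered exponential of [i Phi(f_t)] is the ordinary exponential of its integral, up to
    a phase. Unbounded commutators are avoided: the facts about [Phi] are read off from
    the Weyl relations [W(F) W(G) = exp(- (i / 2) Im <F, G>) W(F + G)] and from the coherent
    vectors [W(P) vacuum]. These vectors span a dense subspace, which every Weyl operator
    maps to itself by an explicit formula.

    The argument works for any representation with these properties ([weyl_system]). The
    operator [i Phi(f)] is replaced by [weak_field f], minus the adjoint of its
    restriction to the coherent vectors. This relation is closed, and linear in [f] for a fixed
    argument, whence [Phi(int f) y = int Phi(f) y] on the maximal continuity subspace
    ([weak_field_RInt]); Weyl operators shift it by a scalar ([weak_field_weyl]). The key
    computation is [is_derive_weyl_curve]: if [G' = f] and [theta' = - (1/2) Im <f, G>], then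
    [exp(i theta) W(G) y] solves the differential equation. Its derivative is found by pairing
    with coherent vectors, where only the explicit side is differentiated, and continuity
    of the result makes it a norm derivative. With [G] linear and [theta] constant, it shows
    that [weak_field f] is contained in the generator of [r |-> W(r f)]; with [G] the
    integral of the path and [theta] the double integral, it yields the evolution system
    ([path_evolution_system]). Solutions are unique because a skew-symmetric equation preserves
    the norm of differences ([ivp_unique]). As the span of the coherent vectors is invariant, it is
    a core of each generator ([generator_core]), so that any closed operator lying between
    the restriction to coherent vectors and the weak relation is the generator. This
    identifies the closure of the integrated operator ([integral_operator_closure]).

    It remains to represent the Weyl relations on Fock space, with [i Phi(f)] as generators.
    The exponential vectors [exp g], with components [g (x) ... (x) g / sqrt n!], satisfy
    [<exp f, exp g> = exp <f, g>] ([inner_exp_exp]) and are total ([exp_total]): the values of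
    [<exp (r g), phi>] determine the diagonal amplitudes of [phi], and polarization the
    others. The normalized vectors of [i P / sqrt 2] have the inner products that the vectors
    [W(P) vacuum] must have, hence translations of [P] extend to isometries satisfying the Weyl
    relations ([fock_weyl_exists]). Pairing with exponential vectors turns annihilation into
    differentiation and creation into multiplication, which puts [i Phi(f)] inside the weak
    relation ([segal_core_weak]); truncating coherent vectors puts them in its domain
    ([segal_coh]). So [i Phi(f)] lies between the two and is the generator
    ([segal_generator]). *)

Set Implicit Arguments.
Unset Strict Implicit.
Unset Printing Implicit Defensive.

Open Scope R_scope.

(** * Algebra and geometry of a Hilbert space *)

Section HilbertAlgebra.

Variable X : HilbertSpace.
Implicit Types (x y z : X).

Lemma norm_zero_eq x : norm x = 0 -> x = zero.
Proof. exact (norm_eq_zero x). Qed.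

Lemma inner_scal_r (r : R) x y : inner x (scal r y) = (RtoC r * inner x y)%C.
Proof. rewrite <- cscal_RtoC; apply inner_cscal_r. Qed.

Lemma opp_cscal x : opp x = cscal (RtoC (-1)) x.
Proof. rewrite cscal_RtoC; symmetry; exact (scal_opp_one x). Qed.

Lemma inner_opp_r x y : inner x (opp y) = (- inner x y)%C.
Proof. rewrite opp_cscal, inner_cscal_r; apply injective_projections; simpl; ring. Qed.

Lemma inner_minus_r x y z : inner x (minus y z) = (inner x y - inner x z)%C.
Proof. unfold minus; rewrite inner_plus_r, inner_opp_r; reflexivity. Qed.

Lemma inner_scal_l (r : R) x y : inner (scal r x) y = (RtoC r * inner x y)%C.
Proof.
rewrite <- cscal_RtoC, inner_cscal_l.
f_equal; apply injective_projections; simpl; ring.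
Qed.

Lemma inner_opp_l x y : inner (opp x) y = (- inner x y)%C.
Proof.
rewrite opp_cscal, inner_cscal_l; apply injective_projections; simpl; ring.
Qed.

Lemma inner_minus_l x y z : inner (minus x y) z = (inner x z - inner y z)%C.
Proof. unfold minus; rewrite inner_plus_l, inner_opp_l; reflexivity. Qed.

Lemma inner_ext x y : (forall e, inner e x = inner e y) -> x = y.
Proof.
intro H.
assert (H0 : minus x y = zero).
{ apply norm_zero_eq.
  assert (E : inner (minus x y) (minus x y) = 0).
  { rewrite inner_minus_r, H; ring. }
  rewrite inner_norm in E; apply RtoC_inj in E.
  apply Rsqr_eq_0; unfold Rsqr; simpl in E; lra. }
transitivity (plus (minus x y) y).
- unfold minus; rewrite <- plus_assoc, plus_opp_l, plus_zero_r; reflexivity.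
- rewrite H0; apply plus_zero_l.
Qed.

End HilbertAlgebra.

Ltac inner_simpl := rewrite ?inner_plus_r, ?inner_minus_r, ?inner_opp_r,
  ?inner_cscal_r, ?inner_scal_r, ?inner_zero_r, ?inner_plus_l, ?inner_minus_l,
  ?inner_opp_l, ?inner_cscal_l, ?inner_scal_l, ?inner_zero_l.
(** Testing an identity of vectors against all inner products makes it a ring
    identity of complex numbers. *)
Ltac vec := apply inner_ext; intro; repeat progress inner_simpl;
  rewrite ?RtoC_plus, ?RtoC_minus, ?RtoC_mult, ?RtoC_opp; try ring.
Ltac Ceq := apply injective_projections; simpl; ring.


Lemma is_linear_intro (V1 V2 : NormedModule R_AbsRing) (l : V1 -> V2) M :
  (forall x y, l (plus x y) = plus (l x) (l y)) ->
  (forall (r : R) x, l (scal r x) = scal r (l x)) ->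
  (forall x, norm (l x) <= M * norm x) -> is_linear l.
Proof.
intros Hp Hs Hb; apply Build_is_linear; [exact Hp|exact Hs|].
exists (Rabs M + 1); split; [pose proof (Rabs_pos M); lra|].
intro x; eapply Rle_trans; [apply Hb|].
pose proof (Rle_abs M); pose proof (norm_ge_0 x); nra.
Qed.

Section HilbertGeometry.

Variable X : HilbertSpace.
Implicit Types (x y z : X).

Definition re x y : R := Re (inner x y).

Lemma inner_re_im x y : inner x y = (re x y, - re x (cscal Ci y)).
Proof.
unfold re; rewrite inner_cscal_r; destruct (inner x y) as [a b]; unfold Re; simpl.
f_equal; ring.
Qed.

Lemma inner_eq_of_re (x y x' y' : X) :
  (forall c : C, re x (cscal c y) = re x' (cscal c y')) -> inner x y = inner x' y'.
Proof.
intro H; rewrite (inner_re_im x y), (inner_re_im x' y'), (H Ci); f_equal.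
pose proof (H (RtoC 1)) as H1; unfold re in *; rewrite !inner_cscal_r in H1.
rewrite !Cmult_1_l in H1; exact H1.
Qed.

Lemma re_sym x y : re x y = re y x.
Proof. unfold re; rewrite (inner_conj x y); reflexivity. Qed.

Lemma re_plus_l x y z : re (plus x y) z = re x z + re y z.
Proof. unfold re; rewrite inner_plus_l; apply re_plus. Qed.

Lemma re_plus_r x y z : re z (plus x y) = re z x + re z y.
Proof. unfold re; rewrite inner_plus_r; apply re_plus. Qed.

Lemma re_scal_left (r : R) x y : re (scal r x) y = r * re x y.
Proof. unfold re; rewrite inner_scal_l; apply re_scal_l. Qed.

Lemma re_scal_right (r : R) x y : re x (scal r y) = r * re x y.
Proof. unfold re; rewrite inner_scal_r; apply re_scal_l. Qed.

Lemma re_minus_l x y z : re (minus x y) z = re x z - re y z.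
Proof. unfold re; rewrite inner_minus_l; destruct (inner x z), (inner y z); reflexivity. Qed.

Lemma re_minus_r x y z : re z (minus x y) = re z x - re z y.
Proof. rewrite re_sym, re_minus_l, !(re_sym z); reflexivity. Qed.

Lemma norm_sq x : norm x ^ 2 = re x x.
Proof. unfold re; rewrite inner_norm; reflexivity. Qed.

Lemma norm_sq_plus x y : norm (plus x y) ^ 2 = norm x ^ 2 + 2 * re x y + norm y ^ 2.
Proof. rewrite !norm_sq, re_plus_l, !re_plus_r, (re_sym y x); ring. Qed.

Lemma norm_sq_minus x y : norm (minus x y) ^ 2 = norm x ^ 2 - 2 * re x y + norm y ^ 2.
Proof. rewrite !norm_sq, re_minus_l, !re_minus_r, (re_sym y x); ring. Qed.

Lemma norm_plus_le x y : norm (plus x y) <= norm x + norm y.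
Proof. exact (norm_triangle x y). Qed.

Lemma norm_minus_le x y : norm (minus x y) <= norm x + norm y.
Proof.
rewrite <- (norm_opp y : norm (opp y) = norm y); exact (norm_triangle x (opp y)).
Qed.

Lemma norm_minus_sym x y : norm (minus x y) = norm (minus y x).
Proof. transitivity (norm (opp (minus x y))); [symmetry; exact (norm_opp _)|].
f_equal; vec. Qed.

Lemma norm_minus_triangle x y z : norm (minus x z) <= norm (minus x y) + norm (minus y z).
Proof.
replace (minus x z) with (plus (minus x y) (minus y z)) by vec.
apply norm_plus_le.
Qed.

Lemma norm_nonneg x : 0 <= norm x.
Proof. apply norm_ge_0. Qed.

Lemma norm_zero' : norm (zero : X) = 0.
Proof. exact (@norm_zero R_AbsRing X). Qed.

Lemma minus_self x : minus x x = zero.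
Proof. vec. Qed.

Lemma norm_minus_eq x y : norm (minus x y) <= 0 -> x = y.
Proof.
intro H; assert (E : minus x y = zero).
{ apply norm_zero_eq; pose proof (norm_nonneg (minus x y)); lra. }
replace x with (plus (minus x y) y) by vec; rewrite E; apply plus_zero_l.
Qed.

(** Nonnegativity of [|y - (z / |x|^2) x|^2] with [z = <x, y>]. *)
Lemma inner_bound x y : Cmod (inner x y) <= norm x * norm y.
Proof.
destruct (Req_dec (norm x) 0) as [E|E].
{ rewrite (norm_zero_eq E), inner_zero_l, Cmod_0.
  apply Rmult_le_pos; apply norm_nonneg. }
set (z := inner x y).
assert (H : 0 <= norm (minus y (cscal (z / RtoC (norm x ^ 2)) x)) ^ 2) by apply pow2_ge_0.
assert (Hx : 0 < norm x ^ 2).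
{ apply pow_lt; pose proof (norm_nonneg x); lra. }
assert (Hc : RtoC (norm x ^ 2) <> RtoC 0) by (intro H0; apply RtoC_inj in H0; lra).
rewrite norm_sq_minus in H.
assert (E1 : re y (cscal (z / RtoC (norm x ^ 2)) x) = Cmod z ^ 2 / norm x ^ 2).
{ unfold re; rewrite inner_cscal_r, (inner_conj x y); fold z.
  replace (z / RtoC (norm x ^ 2) * Cconj z)%C with (z * Cconj z / RtoC (norm x ^ 2))%C
    by (field; exact Hc).
  rewrite <- Cmod2_conj; unfold Cdiv; rewrite <- RtoC_inv by lra.
  rewrite <- RtoC_mult; reflexivity. }
assert (E2 : norm (cscal (z / RtoC (norm x ^ 2)) x) ^ 2 = Cmod z ^ 2 / norm x ^ 2).
{ rewrite norm_sq; unfold re; rewrite inner_cscal_r, inner_cscal_l, inner_norm.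
  rewrite Cdiv_conj by exact Hc.
  replace (Cconj (RtoC (norm x ^ 2))) with (RtoC (norm x ^ 2)) by Ceq.
  replace (z / RtoC (norm x ^ 2) * (Cconj z / RtoC (norm x ^ 2) * RtoC (norm x ^ 2)))%C
    with (z * Cconj z / RtoC (norm x ^ 2))%C by (field; exact Hc).
  rewrite <- Cmod2_conj; unfold Cdiv; rewrite <- RtoC_inv by lra.
  rewrite <- RtoC_mult; reflexivity. }
rewrite E1, E2 in H.
assert (H3 : Cmod z ^ 2 <= (norm x * norm y) ^ 2).
{ apply (Rmult_le_compat_r (norm x ^ 2)) in H; [|lra].
  replace ((norm y ^ 2 - 2 * (Cmod z ^ 2 / norm x ^ 2) + Cmod z ^ 2 / norm x ^ 2) *
     norm x ^ 2) with (norm y ^ 2 * norm x ^ 2 - Cmod z ^ 2) in H by (field; exact E).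
  rewrite Rpow_mult_distr; lra. }
apply Rsqr_incr_0_var; [unfold Rsqr; simpl in H3; lra|].
apply Rmult_le_pos; apply norm_nonneg.
Qed.

Lemma re_bound x y : Rabs (re x y) <= norm x * norm y.
Proof. eapply Rle_trans; [apply re_le_Cmod|apply inner_bound]. Qed.

Lemma norm_cscal (a : C) x : norm (cscal a x) = Cmod a * norm x.
Proof.
apply Rsqr_inj; [apply norm_nonneg| |].
{ apply Rmult_le_pos; [apply Cmod_ge_0|apply norm_nonneg]. }
rewrite !Rsqr_pow2, norm_sq; unfold re.
rewrite inner_cscal_r, inner_cscal_l, inner_norm, Cmult_assoc, <- Cmod2_conj.
rewrite <- RtoC_mult; simpl; ring.
Qed.

Lemma norm_rscal (r : R) x : norm (scal r x) = Rabs r * norm x.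
Proof. rewrite <- cscal_RtoC, norm_cscal, Cmod_R; reflexivity. Qed.

Lemma is_linear_re y : is_linear (fun x => re x y).
Proof.
apply is_linear_intro with (norm y).
- intros; apply re_plus_l.
- intros; apply re_scal_left.
- intro x; rewrite Rmult_comm; exact (re_bound x y).
Qed.

Lemma is_linear_re_r y : is_linear (fun x => re y x).
Proof. exact (is_linear_ext _ _ (fun x => re_sym x y) (is_linear_re y)). Qed.

Lemma filterlim_norm_elim (T : Type) (F : (T -> Prop) -> Prop) {FF : Filter F}
  (u : T -> X) x : filterlim u F (locally x) ->
  forall e, 0 < e -> F (fun t => norm (minus (u t) x) < e).
Proof.
intros H e He.
exact (proj1 (@filterlim_locally_ball_norm _ _ X _ FF u x) H (mkposreal e He)).
Qed.

Lemma filterlim_norm_intro (T : Type) (F : (T -> Prop) -> Prop) {FF : Filter F}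
  (u : T -> X) x : (forall e, 0 < e -> F (fun t => norm (minus (u t) x) < e)) ->
  filterlim u F (locally x).
Proof.
intro H; apply (@filterlim_locally_ball_norm _ _ X _ FF u x).
intros [e He]; exact (H e He).
Qed.

End HilbertGeometry.

Lemma filterlim_R_intro (T : Type) (F : (T -> Prop) -> Prop) {FF : Filter F}
  (u : T -> R) x : (forall e, 0 < e -> F (fun t => Rabs (u t - x) < e)) ->
  filterlim u F (locally x).
Proof.
intro H; apply (@filterlim_locally T R_UniformSpace F FF u x).
intros [e He]; exact (H e He).
Qed.

(** * Integrals and closed relations *)

Section ClosedRelation.

Variables (V1 V2 : NormedModule R_AbsRing) (T : V1 -> V2 -> Prop).

Definition real_linear_relation : Prop :=
  T zero zero /\
  (forall x y x' y', T x y -> T x' y' -> T (plus x x') (plus y y')) /\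
  (forall (r : R) x y, T x y -> T (scal r x) (scal r y)).

Definition closed_relation : Prop := forall x y,
  (forall e, 0 < e -> exists x' y',
    T x' y' /\ norm (minus x' x) < e /\ norm (minus y' y) < e) -> T x y.

Hypotheses (Tlin : real_linear_relation) (Tclosed : closed_relation).

Lemma Riemann_sum_relation (u : R -> V1) (v : R -> V2) ptd :
  (forall r, T (u r) (v r)) -> T (Riemann_sum u ptd) (Riemann_sum v ptd).
Proof.
intro H; destruct Tlin as [T0 [Tp Ts]]; unfold Riemann_sum.
match goal with |- context [seq.pairmap _ ?p _] => generalize p end; generalize (SF_t ptd); intro l.
induction l as [|a l IH]; intro p; [exact T0|].
simpl; apply Tp; [apply Ts, H|apply IH].
Qed.

(** Riemann sums of pairs in the relation stay in it, hence so does their limit. *)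
Lemma is_RInt_relation (u : R -> V1) (v : R -> V2) a b x y :
  (forall r, T (u r) (v r)) -> is_RInt u a b x -> is_RInt v a b y -> T x y.
Proof.
intros H Hu Hv; apply Tclosed; intros e He.
pose proof (proj1 (filterlim_locally_ball_norm _ _) Hu (mkposreal e He)) as H1.
pose proof (proj1 (filterlim_locally_ball_norm _ _) Hv (mkposreal e He)) as H2.
destruct (filter_ex _ (filter_and _ _ H1 H2)) as [ptd [P1 P2]].
eexists; eexists; split; [|split; [exact P1|exact P2]].
apply Tlin, Riemann_sum_relation, H.
Qed.

End ClosedRelation.


Lemma is_RInt_linear (V1 V2 : NormedModule R_AbsRing) (l : V1 -> V2) (u : R -> V1) a b x :
  is_linear l -> is_RInt u a b x -> is_RInt (fun r => l (u r)) a b (l x).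
Proof.
intros Hl Hu; unfold is_RInt.
apply filterlim_ext with (fun ptd => l (scal (sign (b - a)) (Riemann_sum u ptd))).
- intro ptd; rewrite (linear_scal _ Hl); f_equal.
  unfold Riemann_sum; match goal with |- context [seq.pairmap _ ?p _] => generalize p end; generalize (SF_t ptd).
  intro q; induction q as [|p q IH]; intro c; simpl; [apply (linear_zero _ Hl)|].
  rewrite (linear_plus _ Hl), (linear_scal _ Hl), IH; reflexivity.
- eapply filterlim_comp; [exact Hu|apply (linear_cont l x Hl)].
Qed.

(** * Calculus in a Hilbert space *)

Section Calculus.

Variable X : HilbertSpace.
Implicit Types (x y z : X).

Lemma continuous_ex_RInt (u : R -> X) a b :
  (forall r, continuous u r) -> is_RInt u a b (RInt u a b).
Proof. intro H; apply RInt_correct, ex_RInt_continuous; intros; apply H. Qed.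

Lemma is_derive_RInt_continuous (u : R -> X) a t :
  (forall r, continuous u r) -> is_derive (fun t => RInt u a t) t (u t).
Proof.
intro H; apply (@is_derive_RInt X u (fun t => RInt u a t) a t); [|apply H].
apply filter_forall; intro r; apply continuous_ex_RInt, H.
Qed.

Lemma is_derive_linear (V : NormedModule R_AbsRing) (l : X -> V) (u : R -> X) t du :
  is_linear l -> is_derive u t du -> is_derive (fun r => l (u r)) t (l du).
Proof.
intros Hl Hu; unfold is_derive.
refine (filterdiff_ext_lin _ _ _ (filterdiff_comp' u l t _ l Hu _) _).
- apply filterdiff_linear, Hl.
- intro r; simpl; apply (linear_scal _ Hl).
Qed.

Lemma is_derive_re (u : R -> X) t du y :
  is_derive u t du -> is_derive (fun r => re (u r) y) t (re du y).
Proof. apply (is_derive_linear (is_linear_re y)). Qed.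

Lemma is_derive_norm_sq (u : R -> X) t du :
  is_derive u t du -> is_derive (fun r => norm (u r) ^ 2) t (2 * re (u t) du).
Proof.
intro Hu; unfold is_derive.
refine (filterdiff_ext_lin _ (fun r : R => 2 * re (scal r du : X) (u t)) _ _ _).
- refine (filterdiff_comp' u (fun x : X => norm x ^ 2) t _ (fun x => 2 * re x (u t)) Hu _).
  split.
  + apply (is_linear_comp (fun x : X => re x (u t)) (fun r : R => 2 * r)).
    * apply is_linear_re.
    * apply (is_linear_scal_r (V := R_NormedModule) 2); intros; apply Rmult_comm.
  + intros x0 Hx0 [e He].
    apply (@is_filter_lim_locally_unique R_AbsRing X) in Hx0; subst x0.
    apply locally_le_locally_norm.
    exists (mkposreal e He); intros z Hz; unfold ball_norm in Hz; simpl in Hz.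
    change (Rabs (norm z ^ 2 - norm (u t) ^ 2
      - 2 * re (minus z (u t)) (u t)) <= e * norm (minus z (u t))).
    replace z with (plus (u t) (minus z (u t))) at 1 by vec.
    rewrite norm_sq_plus, (re_sym (minus z (u t))).
    replace (_ - _ - _) with (norm (minus z (u t)) ^ 2) by ring.
    rewrite Rabs_pos_eq by apply pow2_ge_0.
    pose proof (norm_nonneg (minus z (u t))); simpl.
    change (norm (minus z (u t)) < e) in Hz; nra.
- intro r; rewrite re_scal_left, re_sym; change (2 * (r * re (u t) du) = r * (2 * re (u t) du)); ring.
Qed.

End Calculus.

(** * Closures of operators *)

Section OperatorClosure.

Variables (X : HilbertSpace) (T : operator X).

Lemma op_closure_closed : closed_relation (V1 := X) (V2 := X) (op_closure T).
Proof.
intros x y H; assert (Hcl : op_closure (op_closure T) x y) by exact H.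
clear H; intros e He; assert (He2 : 0 < e / 2) by lra.
destruct (Hcl _ He2) as [x1 [y1 [H1 [Hx Hy]]]].
destruct (H1 _ He2) as [x2 [y2 [H2 [Hx' Hy']]]].
exists x2, y2; split; [exact H2|].
pose proof (norm_minus_triangle x2 x1 x); pose proof (norm_minus_triangle y2 y1 y).
split; lra.
Qed.

Lemma op_closure_plus :
  (forall x y x' y', T x y -> T x' y' -> T (plus x x') (plus y y')) ->
  forall x y x' y', op_closure T x y -> op_closure T x' y' ->
    op_closure T (plus x x') (plus y y').
Proof.
intros HT x y x' y' H H' e He; assert (He2 : 0 < e / 2) by lra.
destruct (H _ He2) as [x1 [y1 [H1 [Hx Hy]]]].
destruct (H' _ He2) as [x2 [y2 [H2 [Hx' Hy']]]].
exists (plus x1 x2), (plus y1 y2); split; [apply HT; assumption|].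
split.
- match goal with |- norm ?v < _ => replace v with (plus (minus x1 x) (minus x2 x')) by vec end.
  eapply Rle_lt_trans; [apply norm_plus_le|lra].
- match goal with |- norm ?v < _ => replace v with (plus (minus y1 y) (minus y2 y')) by vec end.
  eapply Rle_lt_trans; [apply norm_plus_le|lra].
Qed.

Lemma op_closure_cscal :
  (forall (c : C) x y, T x y -> T (cscal c x) (cscal c y)) ->
  forall (c : C) x y, op_closure T x y -> op_closure T (cscal c x) (cscal c y).
Proof.
intros HT c x y H e He.
assert (Hc : 0 < Cmod c + 1) by (pose proof (Cmod_ge_0 c); lra).
assert (He' : 0 < e / (Cmod c + 1)) by (apply Rdiv_lt_0_compat; lra).
destruct (H _ He') as [x1 [y1 [H1 [Hx Hy]]]].
exists (cscal c x1), (cscal c y1); split; [apply HT; assumption|].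
assert (E : e = (Cmod c + 1) * (e / (Cmod c + 1))) by (field; lra).
pose proof (Cmod_ge_0 c); pose proof (norm_nonneg (minus x1 x)).
pose proof (norm_nonneg (minus y1 y)).
split.
- match goal with |- norm ?v < _ => replace v with (cscal c (minus x1 x)) by vec end.
  rewrite norm_cscal, E; nra.
- match goal with |- norm ?v < _ => replace v with (cscal c (minus y1 y)) by vec end.
  rewrite norm_cscal, E; nra.
Qed.

Lemma op_closure_incl x y : T x y -> op_closure T x y.
Proof.
intros H e He; exists x, y; rewrite !minus_self, norm_zero'; auto.
Qed.

End OperatorClosure.

(** The images of the nonempty sets [Q a] form a Cauchy filter base. *)
Lemma shrinking_limit (X : HilbertSpace) (I : Type) (q : I -> X) (Q : R -> I -> Prop) :
  (forall a b i, a <= b -> Q a i -> Q b i) ->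
  (forall a, 0 < a -> exists i, Q a i) ->
  (forall e, 0 < e -> exists a, 0 < a /\
    forall i j, Q a i -> Q a j -> norm (minus (q i) (q j)) < e) ->
  exists p, forall a, 0 < a -> exists i, Q a i /\ norm (minus (q i) p) < a.
Proof.
intros Qmono Qex Qcauchy.
set (F := fun P : X -> Prop => exists a, 0 < a /\ forall i, Q a i -> P (q i)).
assert (FF : ProperFilter F).
{ split; [|split].
  - intros P [a [Ha H]]; destruct (Qex a Ha) as [i Hi]; eauto.
  - exists 1; split; [lra|auto].
  - intros P P' [a [Ha H]] [b [Hb H']]; exists (Rmin a b); split; [apply Rmin_pos; auto|].
    intros i Hi; split; [apply H|apply H']; revert Hi; apply Qmono;
      [apply Rmin_l|apply Rmin_r].
  - intros P P' HP [a [Ha H]]; exists a; auto. }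
assert (HF : cauchy F).
{ intros [e He]; destruct (Qcauchy e He) as [a [Ha H]]; destruct (Qex a Ha) as [i Hi].
  exists (q i), a; split; [exact Ha|]; intros j Hj.
  apply (@norm_compat1 R_AbsRing X); exact (H j i Hj Hi). }
exists (lim F); intros a Ha.
assert (L : filterlim (fun y : X => y) F (locally (lim F))).
{ apply (proj2 (@filterlim_locally X X F _ (fun y => y) (lim F))).
  intro e; exact (complete_cauchy F FF HF e). }
destruct (filterlim_norm_elim L Ha) as [b [Hb H]].
destruct (Qex (Rmin a b) (Rmin_pos _ _ Ha Hb)) as [i Hi]; exists i; split.
- revert Hi; apply Qmono, Rmin_l.
- apply H; revert Hi; apply Qmono, Rmin_r.
Qed.

(** * Phases and the symplectic form *)

Definition cis (t : R) : C := (cos t, sin t).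

Lemma cis_0 : cis 0 = 1.
Proof. unfold cis; rewrite cos_0, sin_0; reflexivity. Qed.

Lemma cis_plus a b : cis (a + b) = (cis a * cis b)%C.
Proof.
unfold cis; rewrite cos_plus, sin_plus; apply injective_projections; simpl; ring.
Qed.

Lemma cis_conj a : Cconj (cis a) = cis (- a).
Proof. unfold cis, Cconj; rewrite cos_neg, sin_neg; reflexivity. Qed.

Lemma Cmod_cis a : Cmod (cis a) = 1.
Proof.
unfold Cmod, cis; simpl; rewrite <- sqrt_1 at 3; f_equal.
pose proof (sin2_cos2 a) as H; unfold Rsqr in H; lra.
Qed.

Lemma Rabs_sin_le t : Rabs (sin t) <= Rabs t.
Proof.
destruct (MVT_gen sin 0 t cos) as [c [_ Hc]].
- intros x _; auto_derive; [easy|ring].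
- intros x _; apply continuity_sin.
- rewrite sin_0, !Rminus_0_r in Hc; rewrite Hc, Rabs_mult.
  pose proof (COS_bound c) as B; assert (Rabs (cos c) <= 1) by (apply Rabs_le; lra).
  pose proof (Rabs_pos t); nra.
Qed.

Lemma cos_minus_1_bound t : Rabs (cos t - 1) <= t ^ 2.
Proof.
replace (cos t - 1) with (- (2 * Rsqr (sin (t / 2)))).
- rewrite Rabs_Ropp, Rabs_pos_eq by (pose proof (Rle_0_sqr (sin (t / 2))); lra).
  pose proof (Rsqr_le_abs_1 _ _ (Rabs_sin_le (t / 2))) as H; unfold Rsqr in *; nra.
- pose proof (cos_2a_sin (t / 2)) as H; replace (2 * (t / 2)) with t in H by field.
  rewrite H; unfold Rsqr; ring.
Qed.

Lemma sin_minus_id_bound t : Rabs t <= 1 -> Rabs (sin t - t) <= t ^ 2.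
Proof.
intro Ht.
destruct (MVT_gen (fun t => sin t - t) 0 t (fun t => cos t - 1)) as [c [Hc1 Hc]].
- intros x _; auto_derive; [easy|ring].
- intros x _; apply derivable_continuous_pt; reg.
- rewrite sin_0, !Rminus_0_r in Hc; rewrite Hc, Rabs_mult.
  assert (Hct : Rabs c <= Rabs t).
  { unfold Rmin, Rmax in Hc1; destruct (Rle_dec 0 t);
      unfold Rabs; destruct (Rcase_abs c), (Rcase_abs t); lra. }
  pose proof (cos_minus_1_bound c) as B; rewrite <- (pow2_abs c) in B.
  rewrite <- (pow2_abs t).
  pose proof (Rabs_pos t); pose proof (Rabs_pos c); pose proof (Rabs_pos (cos c - 1)).
  assert (Rabs (cos c - 1) <= Rabs t) by nra; nra.
Qed.

Lemma Cmod_le_parts (z : C) : Cmod z <= Rabs (Re z) + Rabs (Im z).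
Proof.
replace z with (RtoC (Re z) + Ci * RtoC (Im z))%C at 1
  by (destruct z; apply injective_projections; simpl; ring).
eapply Rle_trans; [apply Cmod_triangle|].
rewrite Cmod_mult, Cmod_Ci, !Cmod_R; lra.
Qed.

Lemma cis_first_order t : Rabs t <= 1 -> Cmod (cis t - 1) <= 2 * Rabs t.
Proof.
intro Ht; eapply Rle_trans; [apply Cmod_le_parts|]; simpl.
replace (cos t + - (1)) with (cos t - 1) by ring.
replace (sin t + - 0) with (sin t) by ring.
pose proof (cos_minus_1_bound t) as H1; rewrite <- (pow2_abs t) in H1.
pose proof (Rabs_sin_le t); pose proof (Rabs_pos t); nra.
Qed.

Lemma cis_second_order t : Rabs t <= 1 -> Cmod (cis t - 1 - (0, t)) <= 2 * t ^ 2.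
Proof.
intro Ht; eapply Rle_trans; [apply Cmod_le_parts|]; simpl.
replace (cos t + - (1) + - 0) with (cos t - 1) by ring.
replace (sin t + - 0 + - t) with (sin t - t) by ring.
pose proof (cos_minus_1_bound t); pose proof (sin_minus_id_bound Ht).
simpl in *; lra.
Qed.

Section Symplectic.

Variable h : HilbertSpace.
Implicit Types (x y z : h).

Definition symp x y : R := Im (inner x y).

Lemma symp_re x y : symp x y = re (cscal Ci x) y.
Proof.
unfold symp, re; rewrite inner_cscal_l; destruct (inner x y); unfold Im, Re; simpl; ring.
Qed.

Lemma symp_anti x y : symp x y = - symp y x.
Proof. unfold symp; rewrite (inner_conj y x); reflexivity. Qed.

Lemma symp_plus_l x y z : symp (plus x y) z = symp x z + symp y z.
Proof. unfold symp; rewrite inner_plus_l; apply im_plus. Qed.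

Lemma symp_plus_r x y z : symp x (plus y z) = symp x y + symp x z.
Proof. unfold symp; rewrite inner_plus_r; apply im_plus. Qed.

Lemma symp_minus_l x y z : symp (minus x y) z = symp x z - symp y z.
Proof. unfold symp; rewrite inner_minus_l; destruct (inner x z), (inner y z); reflexivity. Qed.

Lemma symp_minus_r x y z : symp x (minus y z) = symp x y - symp x z.
Proof. unfold symp; rewrite inner_minus_r; destruct (inner x y), (inner x z); reflexivity. Qed.

Lemma symp_scal_l (r : R) x y : symp (scal r x) y = r * symp x y.
Proof. unfold symp; rewrite inner_scal_l; apply im_scal_l. Qed.

Lemma symp_scal_r (r : R) x y : symp x (scal r y) = r * symp x y.
Proof. unfold symp; rewrite inner_scal_r; apply im_scal_l. Qed.

Lemma symp_opp_l x y : symp (opp x) y = - symp x y.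
Proof. unfold symp; rewrite inner_opp_l; destruct (inner x y); reflexivity. Qed.

Lemma symp_opp_r x y : symp x (opp y) = - symp x y.
Proof. unfold symp; rewrite inner_opp_r; destruct (inner x y); reflexivity. Qed.

Lemma symp_self x : symp x x = 0.
Proof. pose proof (symp_anti x x); lra. Qed.

Lemma symp_bound x y : Rabs (symp x y) <= norm x * norm y.
Proof.
rewrite symp_re; eapply Rle_trans; [apply re_bound|].
rewrite norm_cscal, Cmod_Ci; lra.
Qed.

Lemma is_linear_symp_r x : is_linear (fun y => symp x y).
Proof.
exact (is_linear_ext _ _ (fun y => eq_sym (symp_re x y)) (is_linear_re_r (cscal Ci x))).
Qed.

Lemma is_linear_symp_l x : is_linear (fun y => symp y x).
Proof.
apply (is_linear_ext (fun y => opp (symp x y))).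
- intro y; symmetry; exact (symp_anti y x).
- apply (is_linear_comp (fun y => symp x y) opp);
    [apply is_linear_symp_r|apply is_linear_opp].
Qed.

Lemma is_linear_symp_mult (c : R) x : is_linear (fun y => c * symp y x).
Proof.
apply (is_linear_comp (fun y => symp y x) (fun r : R => c * r) (is_linear_symp_l x)).
apply (is_linear_scal_r (V := R_NormedModule) c); intros; apply Rmult_comm.
Qed.

Lemma filterlim_symp (T : Type) (F : (T -> Prop) -> Prop) {FF : Filter F}
  (u v : T -> h) x y : filterlim u F (locally x) -> filterlim v F (locally y) ->
  filterlim (fun t => symp (u t) (v t)) F (locally (symp x y)).
Proof.
intros Hu Hv; refine (filterlim_R_intro _); intros e He.
set (K := norm x + norm y + 1).
assert (HK : 0 < K) by (pose proof (norm_nonneg x); pose proof (norm_nonneg y); unfold K; lra).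
set (d := Rmin 1 (e / K)).
assert (Hd : 0 < d) by (apply Rmin_pos; [lra|apply Rdiv_lt_0_compat; lra]).
generalize (filter_and _ _ (filterlim_norm_elim Hu Hd) (filterlim_norm_elim Hv Hd)); apply filter_imp; intros t [H1 H2].
replace (symp (u t) (v t) - symp x y)
  with (symp (minus (u t) x) (minus (v t) y) + symp x (minus (v t) y)
        + symp (minus (u t) x) y)
  by (rewrite !symp_minus_l, !symp_minus_r; ring).
eapply Rle_lt_trans; [apply Rabs_triang|].
eapply Rle_lt_trans; [apply Rplus_le_compat_r, Rabs_triang|].
pose proof (symp_bound (minus (u t) x) (minus (v t) y)).
pose proof (symp_bound x (minus (v t) y)).
pose proof (symp_bound (minus (u t) x) y).
pose proof (norm_nonneg x); pose proof (norm_nonneg y).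
set (a := norm (minus (u t) x)) in *; set (b := norm (minus (v t) y)) in *.
assert (0 <= a) by apply norm_nonneg; assert (0 <= b) by apply norm_nonneg.
assert (d <= 1) by apply Rmin_l; assert (d <= e / K) by apply Rmin_r.
assert (Hde : d * K <= e).
{ replace e with (e / K * K) by (field; lra); apply Rmult_le_compat_r; lra. }
unfold K in Hde.
assert (a * b <= d) by nra.
assert (a * b < d) by nra.
assert (norm x * b <= norm x * d) by (apply Rmult_le_compat_l; lra).
assert (a * norm y <= norm y * d) by (rewrite Rmult_comm; apply Rmult_le_compat_l; lra).
lra.
Qed.

End Symplectic.

(** * Weyl systems *)

Fixpoint comb (X : HilbertSpace) (B : Type) (e : B -> X) (v : list (C * B)) : X :=
  match v with
  | nil => zero
  | (c, b) :: v' => plus (cscal c (e b)) (comb e v')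
  end.

(** A cyclic representation of the Weyl relations, differentiable at the vacuum:
    [vac_field f] plays the role of [i Phi(f) vac], the derivative at zero of
    [r |-> W (r f) vac]. *)
Record weyl_system (h X : HilbertSpace) := {
  weyl :> h -> X -> X;
  vac : X;
  vac_field : h -> X;
  weyl_plus : forall F x y, weyl F (plus x y) = plus (weyl F x) (weyl F y);
  weyl_cscal : forall F (a : C) x, weyl F (cscal a x) = cscal a (weyl F x);
  weyl_norm : forall F x, norm (weyl F x) = norm x;
  weyl_zero : forall x, weyl zero x = x;
  weyl_comp : forall F G x,
    weyl F (weyl G x) = cscal (cis (- (1 / 2) * symp F G)) (weyl (plus F G) x);
  vac_cyclic : forall x e, 0 < e ->
    exists v, norm (minus (comb (fun F => weyl F vac) v) x) < e;
  vac_field_linear : is_linear vac_field;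
  vac_field_approx : forall d,
    norm (minus (minus (weyl d vac) vac) (vac_field d)) <= norm d ^ 2
}.

Section WeylSystem.

Variables (h X : HilbertSpace) (W : weyl_system h X).
Implicit Types (F G P f : h) (x y z : X).

Lemma weyl_scal F (r : R) x : W F (scal r x) = scal r (W F x).
Proof. rewrite <- !cscal_RtoC; apply weyl_cscal. Qed.

Lemma weyl_opp F x : W F (opp x) = opp (W F x).
Proof. rewrite !opp_cscal; apply weyl_cscal. Qed.

Lemma weyl_minus F x y : W F (minus x y) = minus (W F x) (W F y).
Proof. unfold minus; rewrite weyl_plus, weyl_opp; reflexivity. Qed.

Lemma weyl_bounded F : bounded_operator (W F).
Proof.
split; [|apply weyl_cscal]; apply is_linear_intro with 1.
- apply weyl_plus.
- apply weyl_scal.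
- intro x; rewrite Rmult_1_l; right; exact (weyl_norm W F x).
Qed.

Lemma cscal_one x : cscal 1 x = x.
Proof. vec. Qed.

Lemma weyl_sum F G x : W (plus F G) x = cscal (cis (1 / 2 * symp F G)) (W F (W G x)).
Proof.
rewrite weyl_comp, cscal_assoc, <- cis_plus.
replace (_ + _) with 0 by ring; rewrite cis_0, cscal_one; reflexivity.
Qed.

Lemma weyl_opp_r F x : W F (W (opp F) x) = x.
Proof.
rewrite weyl_comp, symp_opp_r, symp_self.
replace (plus F (opp F)) with (zero : h) by vec.
replace (_ * _) with 0 by ring; rewrite cis_0, weyl_zero; apply cscal_one.
Qed.

Lemma weyl_inner F x y : inner (W F x) (W F y) = inner x y.
Proof.
apply inner_eq_of_re; intro c; rewrite <- weyl_cscal; generalize (cscal c y); clear y; intro y.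
pose proof (norm_sq_plus (W F x) (W F y)) as H1.
rewrite <- weyl_plus, !weyl_norm, norm_sq_plus in H1; lra.
Qed.

Lemma weyl_adjoint F x y : inner x (W F y) = inner (W (opp F) x) y.
Proof. rewrite <- (weyl_inner F (W (opp F) x)), weyl_opp_r; reflexivity. Qed.

Definition coh P : X := W P (vac W).

(** For [a = 1] this is [i Phi(f) (coh P)], with [i Phi(f)] the generator of
    [r |-> W (r f)]; for [a = 1 / 2] it is the real derivative of [coh] at [P]. *)
Definition displaced (a : R) P d : X :=
  W P (plus (vac_field W d) (cscal (0, a * symp P d) (vac W))).

Definition field f P : X := displaced 1 P f.
Definition coh_diff P d : X := displaced (1 / 2) P d.

Lemma coh_diff_field f P :
  coh_diff P f = minus (field f P) (cscal (0, 1 / 2 * symp P f) (coh P)).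
Proof.
unfold field, coh_diff, displaced, coh; rewrite <- weyl_cscal, <- weyl_minus; f_equal.
vec; match goal with |- context [inner ?e (vac W)] => destruct (inner e (vac W)) end.
destruct (inner e (vac_field W f)); apply injective_projections; simpl; field.
Qed.

Lemma coh_translate P d : coh (plus P d) = cscal (cis (1 / 2 * symp P d)) (W P (coh d)).
Proof. apply weyl_sum. Qed.

Lemma weyl_coh F P : W F (coh P) = cscal (cis (- (1 / 2) * symp F P)) (coh (plus F P)).
Proof. apply weyl_comp. Qed.

Lemma coh_total x : (forall P, inner (coh P) x = 0) -> x = zero.
Proof.
intro H; apply norm_zero_eq.
assert (Hc : forall v, inner (comb coh v) x = 0).
{ induction v as [|[c b] v IH]; simpl; [apply inner_zero_l|].
  rewrite inner_plus_l, inner_cscal_l, H, IH; ring. }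
destruct (Req_dec (norm x) 0) as [E|E]; [exact E|exfalso].
assert (Hx : 0 < norm x) by (pose proof (norm_nonneg x); lra).
destruct (vac_cyclic W x Hx) as [v Hv]; fold coh in Hv.
pose proof (norm_sq_minus (comb coh v) x) as H1.
unfold re in H1; rewrite Hc in H1; simpl in H1.
pose proof (norm_nonneg (minus (comb coh v) x)); pose proof (norm_nonneg (comb coh v)).
change (fun F => W F (vac W)) with coh in Hv; nra.
Qed.

Lemma coh_total_eq x y : (forall P c, re (cscal c (coh P)) x = re (cscal c (coh P)) y) -> x = y.
Proof.
intro H; assert (E : minus x y = zero).
{ apply coh_total; intro P; rewrite inner_minus_r.
  rewrite (inner_conj x), (inner_conj y).
  rewrite (@inner_eq_of_re X x (coh P) y (coh P)); [ring|].
  intro c; rewrite !(re_sym _ (cscal c (coh P))); apply H. }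
apply norm_minus_eq; rewrite E, norm_zero'; lra.
Qed.

Lemma is_linear_weyl F : is_linear (W F).
Proof. apply weyl_bounded. Qed.

Lemma is_linear_displaced a P : is_linear (displaced a P).
Proof.
apply (is_linear_comp (fun d => plus (vac_field W d) (cscal (0, a * symp P d) (vac W))) (W P));
  [|apply is_linear_weyl].
destruct (linear_norm _ (vac_field_linear W)) as [M [HM Hb]].
apply is_linear_intro with (M + Rabs a * (norm P * norm (vac W))).
- intros x y; rewrite (linear_plus _ (vac_field_linear W)), symp_plus_r.
  vec; destruct (inner e (vac W)), (inner e (vac_field W x)), (inner e (vac_field W y)).
  apply injective_projections; simpl; ring.
- intros r x; rewrite (linear_scal _ (vac_field_linear W)), symp_scal_r.
  vec; destruct (inner e (vac W)), (inner e (vac_field W x)).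
  apply injective_projections; simpl; ring.
- intro x; eapply Rle_trans; [exact (norm_plus_le _ _)|].
  rewrite norm_cscal.
  assert (Hi : Cmod (0, a * symp P x) <= Rabs a * (norm P * norm x)).
  { eapply Rle_trans; [apply Cmod_le_parts|]; simpl.
    rewrite Rabs_R0, Rabs_mult, Rplus_0_l.
    apply Rmult_le_compat_l; [apply Rabs_pos|apply symp_bound]. }
  pose proof (Hb x) as Hbx; pose proof (norm_nonneg (vac W)).
  change (norm (vac_field W x) + Cmod (0, a * symp P x) * norm (vac W)
    <= (M + Rabs a * (norm P * norm (vac W))) * norm x).
  change (norm (vac_field W x) <= M * norm x) in Hbx.
  assert (Cmod (0, a * symp P x) * norm (vac W) <= Rabs a * (norm P * norm x) * norm (vac W))
    by (apply Rmult_le_compat_r; lra).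
  lra.
Qed.

(** Translating by [W P] reduces the increment of [coh] at [P] to the increment
    at zero, where [vac_field_approx] controls it. *)
Lemma coh_second_order P : exists K, 0 < K /\ forall d, norm d <= 1 -> norm P * norm d <= 1 ->
  norm (minus (minus (coh (plus P d)) (coh P)) (coh_diff P d)) <= K * norm d ^ 2.
Proof.
destruct (linear_norm _ (vac_field_linear W)) as [M [HM Hb]].
exists (1 + 2 * norm P ^ 2 * norm (vac W) + 2 * norm P * M); split.
{ pose proof (norm_nonneg P); pose proof (norm_nonneg (vac W)).
  pose proof (pow2_ge_0 (norm P)).
  assert (0 <= norm P ^ 2 * norm (vac W)) by (apply Rmult_le_pos; lra).
  assert (0 <= norm P * M) by (apply Rmult_le_pos; lra). lra. }
intros d Hd HPd.
set (b := 1 / 2 * symp P d).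
assert (Hbd : Rabs b <= norm P * norm d).
{ unfold b; rewrite Rabs_mult, (Rabs_pos_eq (1 / 2)) by lra.
  pose proof (symp_bound P d); pose proof (Rabs_pos (symp P d)); lra. }
assert (Hb1 : Rabs b <= 1) by lra.
assert (E : minus (minus (coh (plus P d)) (coh P)) (coh_diff P d) =
  W P (plus (cscal (cis b) (minus (minus (coh d) (vac W)) (vac_field W d)))
    (plus (cscal (cis b - 1 - (0, b))%C (vac W)) (cscal (cis b - 1)%C (vac_field W d))))).
{ rewrite coh_translate; fold b; unfold coh_diff, displaced; fold b; unfold coh at 2.
  rewrite <- weyl_cscal, <- !weyl_minus; f_equal.
  vec. }
rewrite E, weyl_norm.
eapply Rle_trans; [apply norm_plus_le|].
eapply Rle_trans; [apply Rplus_le_compat_l, norm_plus_le|].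
rewrite !norm_cscal, Cmod_cis.
pose proof (vac_field_approx W d) as H1.
pose proof (cis_second_order Hb1) as H2; pose proof (cis_first_order Hb1) as H3.
pose proof (Hb d) as H4; change (norm (vac_field W d) <= M * norm d) in H4.
pose proof (norm_nonneg (vac W)); pose proof (norm_nonneg d); pose proof (norm_nonneg P).
pose proof (Rabs_pos b).
change (W d (vac W)) with (coh d) in H1.
assert (b ^ 2 <= norm P ^ 2 * norm d ^ 2).
{ rewrite <- (pow2_abs b), <- Rpow_mult_distr; apply pow_incr; lra. }
assert (Cmod (cis b - 1 - (0, b)) * norm (vac W)
  <= 2 * (norm P ^ 2 * norm d ^ 2) * norm (vac W)) by (apply Rmult_le_compat_r; lra).
assert (Cmod (cis b - 1) * norm (vac_field W d) <= 2 * (norm P * norm d) * (M * norm d)).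
{ apply Rmult_le_compat; [apply Cmod_ge_0|apply norm_nonneg|lra|lra]. }
simpl in *; lra.
Qed.

Lemma filterdiff_coh P : filterdiff coh (locally P) (coh_diff P).
Proof.
split; [apply is_linear_displaced|].
intros P0 HP0 [e He].
apply (@is_filter_lim_locally_unique R_AbsRing h) in HP0; subst P0.
destruct (coh_second_order P) as [K [HK HB]].
set (d0 := Rmin (/ (norm P + 1)) (e / K)).
assert (HP : 0 < norm P + 1) by (pose proof (norm_nonneg P); lra).
assert (Hd0 : 0 < d0)
  by (apply Rmin_pos; [apply Rinv_0_lt_compat; lra|apply Rdiv_lt_0_compat; lra]).
apply (@locally_le_locally_norm R_AbsRing h P).
exists (mkposreal d0 Hd0); intros Q HQ; unfold ball_norm in HQ; simpl in HQ.
change (norm (minus Q P) < d0) in HQ.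
change (norm (minus (minus (coh Q) (coh P)) (coh_diff P (minus Q P)))
  <= e * norm (minus Q P)).
set (d := minus Q P) in *.
replace Q with (plus P d) by (unfold d; vec).
assert (d0 <= / (norm P + 1)) by apply Rmin_l.
assert (d0 <= e / K) by apply Rmin_r.
assert (H1 : norm d * (norm P + 1) <= 1).
{ replace 1 with (/ (norm P + 1) * (norm P + 1)) at 2 by (field; lra).
  apply Rmult_le_compat_r; lra. }
pose proof (norm_nonneg d); pose proof (norm_nonneg P).
eapply Rle_trans; [apply HB; nra|].
assert (K * norm d <= e).
{ replace e with (K * (e / K)) by (field; lra); apply Rmult_le_compat_l; lra. }
simpl; nra.
Qed.

Lemma is_derive_coh (P : R -> h) t dP :
  is_derive P t dP -> is_derive (fun r => coh (P r)) t (coh_diff (P t) dP).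
Proof.
intro HP; unfold is_derive.
refine (filterdiff_ext_lin _ _ _
  (filterdiff_comp' P coh t _ (coh_diff (P t)) HP (filterdiff_coh _)) _).
intro r; simpl; apply (linear_scal _ (is_linear_displaced (1 / 2) (P t))).
Qed.

Lemma filterlim_coh P : filterlim coh (locally P) (locally (coh P)).
Proof.
exact (@filterdiff_continuous R_AbsRing h X coh P (ex_intro _ _ (filterdiff_coh P))).
Qed.

End WeylSystem.

(** * Continuity and derivatives of phases times vectors *)

Section Phases.

Variable X : HilbertSpace.
Implicit Types (x y z : X).

Lemma is_linear_cscal (c : C) : is_linear (fun x : X => cscal c x).
Proof.
apply is_linear_intro with (Cmod c).
- apply cscal_plus_r.
- intros r x; vec.
- intro x; right; exact (norm_cscal c x).
Qed.

Lemma cis_cscal b x : cscal (cis b) x = plus (scal (cos b) x) (scal (sin b) (cscal Ci x)).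
Proof.
vec; unfold cis; destruct (inner e x); apply injective_projections; simpl; ring.
Qed.

Lemma filterlim_within (T U : Type) (F : (T -> Prop) -> Prop) (FF : Filter F)
  (D : T -> Prop) (u : T -> U) (G : (U -> Prop) -> Prop) :
  filterlim u F G -> filterlim u (within D F) G.
Proof.
intros H P HP; unfold filtermap, within; apply (filter_imp (fun t => P (u t))); [intros t Ht _; exact Ht|exact (H P HP)].
Qed.

Lemma is_derive_continuous (V : NormedModule R_AbsRing) (u : R -> V) t d :
  is_derive u t d -> continuous u t.
Proof.
intro H; apply (ex_derive_continuous (K := R_AbsRing) u t); exists d; exact H.
Qed.

Section FilterLimits.

Context {T : Type} {F : (T -> Prop) -> Prop} {FF : Filter F}.

Lemma filterlim_vplus (u v : T -> X) x y :
  filterlim u F (locally x) -> filterlim v F (locally y) ->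
  filterlim (fun t => plus (u t) (v t)) F (locally (plus x y)).
Proof.
intros Hu Hv; refine (filterlim_comp_2 u v (fun a b : X => plus a b) Hu Hv _).
exact (@filterlim_plus R_AbsRing X x y).
Qed.

Lemma filterlim_linear (V1 V2 : NormedModule R_AbsRing) (l : V1 -> V2) (u : T -> V1) (x : V1) :
  is_linear l -> filterlim u F (locally x) ->
  filterlim (fun t => l (u t)) F (locally (l x)).
Proof. intros Hl Hu; exact (filterlim_comp _ _ _ _ _ _ _ _ Hu (linear_cont l x Hl)). Qed.

Lemma filterlim_vscal (r : T -> R) (u : T -> X) r0 x :
  filterlim r F (locally r0) -> filterlim u F (locally x) ->
  filterlim (fun t => scal (r t) (u t)) F (locally (scal r0 x)).
Proof.
intros Hr Hu; refine (filterlim_comp_2 r u (fun (a : R) (b : X) => scal a b) Hr Hu _).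
exact (@filterlim_scal R_AbsRing X r0 x).
Qed.

Lemma filterlim_cis (b : T -> R) (u : T -> X) b0 x :
  filterlim b F (locally b0) -> filterlim u F (locally x) ->
  filterlim (fun t => cscal (cis (b t)) (u t)) F (locally (cscal (cis b0) x)).
Proof.
intros Hb Hu; rewrite cis_cscal.
apply filterlim_ext with (fun t => plus (scal (cos (b t)) (u t)) (scal (sin (b t)) (cscal Ci (u t)))).
{ intro t; symmetry; apply cis_cscal. }
apply filterlim_vplus; apply filterlim_vscal.
- exact (filterlim_comp _ _ _ _ _ _ _ _ Hb (continuous_cos b0)).
- exact Hu.
- exact (filterlim_comp _ _ _ _ _ _ _ _ Hb (continuous_sin b0)).
- apply (filterlim_linear (is_linear_cscal Ci) Hu).
Qed.

End FilterLimits.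

Lemma is_derive_cos_comp (b : R -> R) t db : is_derive b t db ->
  is_derive (fun r => cos (b r)) t (db * - sin (b t)).
Proof.
intro Hb; apply (@is_derive_comp R_AbsRing R_NormedModule cos b t); [|exact Hb].
auto_derive; [easy|ring].
Qed.

Lemma is_derive_sin_comp (b : R -> R) t db : is_derive b t db ->
  is_derive (fun r => sin (b r)) t (db * cos (b t)).
Proof.
intro Hb; apply (@is_derive_comp R_AbsRing R_NormedModule sin b t); [|exact Hb].
auto_derive; [easy|ring].
Qed.

Lemma is_derive_cis (b : R -> R) (v : R -> X) t db dv :
  is_derive b t db -> is_derive v t dv ->
  is_derive (fun r => cscal (cis (b r)) (v r)) t
    (cscal (cis (b t)) (plus dv (cscal (0, db) (v t)))).
Proof.
intros Hb Hv.
assert (Hprod : forall (c : R -> R) dc (w : R -> X) dw, is_derive c t dc -> is_derive w t dw ->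
  is_derive (fun r => scal (c r) (w r)) t (plus (scal dc (w t)) (scal (c t) dw))).
{ intros c dc w dw Hc Hw; unfold is_derive.
  refine (filterdiff_ext_lin _ _ _
    (@filterdiff_scal_fct R_AbsRing R_NormedModule X t c w _ _ Rmult_comm Hc Hw) _).
  intro r; simpl; change (scal r dc) with (r * dc); vec. }
pose proof (Hprod _ _ _ _ (is_derive_cos_comp Hb) Hv) as H1.
pose proof (Hprod _ _ _ _ (is_derive_sin_comp Hb) (is_derive_linear (is_linear_cscal Ci) Hv)) as H2.
pose proof (is_derive_plus _ _ _ _ _ H1 H2) as H3.
match type of H3 with is_derive _ _ ?d =>
  replace (cscal (cis (b t)) (plus dv (cscal (0, db) (v t)))) with d end.
- revert H3; apply is_derive_ext; intro r; symmetry; apply cis_cscal.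
- vec; unfold cis; destruct (inner e dv), (inner e (v t)).
  apply injective_projections; simpl; ring.
Qed.

(** Differentiable orbits in the form that [generator] asks for. *)
Lemma is_derive_right_quotient (u : R -> X) d x : u 0 = x -> is_derive u 0 d ->
  filterlim (fun t => scal (/ t) (minus (u t) x)) (at_right 0) (locally d).
Proof.
intros Hx [_ Hd]; subst x; refine (filterlim_norm_intro _); intros e He.
assert (He2 : 0 < e / 2) by lra.
pose proof (Hd 0 (fun P HP => HP) (mkposreal _ He2)) as [dl Hdl].
exists dl; intros t Ht Ht0; specialize (Hdl t Ht).
change (norm (minus (minus (u t) (u 0)) (scal (t - 0) d)) <= e / 2 * Rabs (t - 0)) in Hdl.
rewrite Rminus_0_r, Rabs_pos_eq in Hdl by lra.
match goal with |- norm ?v < _ =>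
  assert (E : v = scal (/ t) (minus (minus (u t) (u 0)) (scal t d))) end.
{ apply inner_ext; intro a; repeat progress inner_simpl.
  rewrite RtoC_inv by lra; field; intro H; apply RtoC_inj in H; lra. }
rewrite E, norm_rscal, Rabs_pos_eq by (left; apply Rinv_0_lt_compat; lra).
apply (Rmult_le_compat_l (/ t)) in Hdl; [|left; apply Rinv_0_lt_compat; lra].
replace (/ t * (e / 2 * t)) with (e / 2) in Hdl by (field; lra); lra.
Qed.

End Phases.

Arguments is_linear_cscal {X} c.

Section WeakField.

Variables (h X : HilbertSpace) (W : weyl_system h X).
Implicit Types (F G P f : h) (x y z : X).

(** * Strong continuity of Weyl operators *)

(** Isometries converge strongly as soon as they converge on the dense span of
    the coherent vectors, where [W] is explicit. *)
Lemma filterlim_weyl (T : Type) (L : (T -> Prop) -> Prop) {FL : Filter L}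
  (G : T -> h) (u : T -> X) G0 x :
  filterlim G L (locally G0) -> filterlim u L (locally x) ->
  filterlim (fun t => W (G t) (u t)) L (locally (W G0 x)).
Proof.
intros HG Hu.
assert (Hcomb : forall v, filterlim (fun t => W (G t) (comb (coh W) v)) L
  (locally (W G0 (comb (coh W) v)))).
{ induction v as [|[c P] v IH].
  - apply filterlim_ext with (fun _ => W G0 (comb (coh W) nil)); [|apply filterlim_const].
    intro t; simpl; rewrite !(linear_zero _ (is_linear_weyl W _)); reflexivity.
  - cbn [comb]; rewrite weyl_plus, weyl_cscal, weyl_coh.
    apply filterlim_ext with (fun t =>
      plus (cscal c (cscal (cis (- (1 / 2) * symp (G t) P)) (coh W (plus (G t) P))))
        (W (G t) (comb (coh W) v))).
    { intro t; rewrite weyl_plus, weyl_cscal, weyl_coh; reflexivity. }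
    refine (filterlim_vplus _ IH).
    refine (filterlim_linear (is_linear_cscal c) (filterlim_cis _ _)).
    + exact (filterlim_linear (is_linear_symp_mult (- (1 / 2)) P) HG).
    + apply (filterlim_comp _ _ _ _ _ _ _ _ (filterlim_vplus HG (filterlim_const P))).
      apply filterlim_coh. }
refine (filterlim_norm_intro _); intros e He.
assert (He4 : 0 < e / 4) by lra.
destruct (vac_cyclic W x He4) as [v Hv].
change (norm (minus (comb (coh W) v) x) < e / 4) in Hv.
generalize (filter_and _ _ (filterlim_norm_elim Hu He4) (filterlim_norm_elim (Hcomb v) He4)).
apply filter_imp; intros t [H1 H2].
set (c := comb (coh W) v) in *.
pose proof (norm_minus_triangle (W (G t) (u t)) (W (G t) x) (W G0 x)) as T1.
pose proof (norm_minus_triangle (W (G t) x) (W (G t) c) (W G0 x)) as T2.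
pose proof (norm_minus_triangle (W (G t) c) (W G0 c) (W G0 x)) as T3.
rewrite <- weyl_minus, weyl_norm in T1.
rewrite <- weyl_minus, weyl_norm, (norm_minus_sym x c) in T2.
rewrite <- (weyl_minus W G0), weyl_norm in T3.
lra.
Qed.

Lemma is_linear_field P : is_linear (fun f => field W f P).
Proof. apply is_linear_displaced. Qed.

(** * The field operators as a weak relation *)

(** The graph of minus the adjoint of [i Phi(f)] restricted to the coherent vectors. Being
    the adjoint of a skew-symmetric operator, it contains every skew-symmetric extension; it
    turns out to be the generator itself. *)
Definition weak_field f y z : Prop :=
  forall P, inner (field W f P) y = (- inner (coh W P) z)%C.

Lemma weak_field_unique f y z z' : weak_field f y z -> weak_field f y z' -> z = z'.
Proof.
intros H H'; assert (E : minus z z' = zero).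
{ apply (coh_total (W := W)); intro P.
  pose proof (H P) as E1; rewrite (H' P) in E1; rewrite inner_minus_r.
  replace (inner (coh W P) z) with (- - inner (coh W P) z)%C by ring.
  rewrite <- E1; ring. }
apply norm_minus_eq; rewrite E, norm_zero'; lra.
Qed.

Lemma weak_field_plus f y z y' z' : weak_field f y z -> weak_field f y' z' ->
  weak_field f (plus y y') (plus z z').
Proof. intros H H' P; rewrite !inner_plus_r, H, H'; ring. Qed.

Lemma weak_field_cscal f (c : C) y z : weak_field f y z ->
  weak_field f (cscal c y) (cscal c z).
Proof. intros H P; rewrite !inner_cscal_r, H; ring. Qed.

Lemma weak_field_minus f y z y' z' : weak_field f y z -> weak_field f y' z' ->
  weak_field f (minus y y') (minus z z').
Proof. intros H H' P; rewrite !inner_minus_r, H, H'; ring. Qed.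

Lemma nonpos_of_small (a K : R) : (forall e, 0 < e -> a <= K * e) -> a <= 0.
Proof.
intro H; apply le_epsilon; intros e He.
assert (HK : 0 < Rabs K + 1) by (pose proof (Rabs_pos K); lra).
assert (He' : 0 < e / (Rabs K + 1)) by (apply Rdiv_lt_0_compat; lra).
eapply Rle_trans; [apply (H _ He')|].
replace (0 + e) with ((Rabs K + 1) * (e / (Rabs K + 1))) by (field; lra).
apply Rmult_le_compat_r; [lra|]; pose proof (Rle_abs K); lra.
Qed.

Lemma Cmod_small (c : C) K : (forall e, 0 < e -> Cmod c <= K * e) -> c = 0.
Proof.
intro H; apply Cmod_eq_0, Rle_antisym; [|apply Cmod_ge_0].
exact (nonpos_of_small H).
Qed.

Lemma weak_field_of_small f y z :
  (forall P, exists K, forall e, 0 < e ->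
    Cmod (inner (field W f P) y + inner (coh W P) z)%C <= K * e) -> weak_field f y z.
Proof.
intros H P; destruct (H P) as [K HK]; apply Cmod_small in HK.
transitivity (inner (field W f P) y + inner (coh W P) z - inner (coh W P) z)%C; [ring|].
rewrite HK; ring.
Qed.

Lemma weak_field_closed f y z :
  (forall e, 0 < e -> exists y' z',
    weak_field f y' z' /\ norm (minus y' y) < e /\ norm (minus z' z) < e) ->
  weak_field f y z.
Proof.
intro H; apply weak_field_of_small; intro P.
exists (norm (field W f P) + norm (coh W P)); intros e He.
destruct (H e He) as [y' [z' [H1 [H2 H3]]]].
replace (inner (field W f P) y + inner (coh W P) z)%C with
  (- (inner (field W f P) (minus y' y) + inner (coh W P) (minus z' z)))%C
  by (rewrite !inner_minus_r, (H1 P); ring).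
rewrite Cmod_opp; eapply Rle_trans; [apply Cmod_triangle|].
pose proof (inner_bound (field W f P) (minus y' y)).
pose proof (inner_bound (coh W P) (minus z' z)).
pose proof (norm_nonneg (field W f P)); pose proof (norm_nonneg (coh W P)).
nra.
Qed.

(** For fixed [y] the relation is linear and closed in the pair [(f, z)], so that it
    passes to integrals: [Phi (int f) y = int Phi(f) y]. *)
Lemma weak_field_RInt (f : R -> h) y (z : R -> X) a b F Z :
  (forall t, weak_field (f t) y (z t)) -> is_RInt f a b F -> is_RInt z a b Z ->
  weak_field F y Z.
Proof.
intros H Hf Hz.
refine (@is_RInt_relation h X (fun f z => weak_field f y z) _ _ f z a b F Z H Hf Hz).
- split; [|split].
  + intro P; rewrite (linear_zero _ (is_linear_field P)), inner_zero_l, inner_zero_r; ring.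
  + intros f1 z1 f2 z2 H1 H2 P.
    rewrite (linear_plus _ (is_linear_field P)), inner_plus_l, inner_plus_r, H1, H2; ring.
  + intros r f1 z1 H1 P.
    rewrite (linear_scal _ (is_linear_field P)), inner_scal_l, inner_scal_r, H1; ring.
- clear; intros f z H; apply weak_field_of_small; intro P.
  destruct (linear_norm _ (is_linear_field P)) as [M [HM Hb]].
  exists (M * norm y + norm (coh W P)); intros e He.
  destruct (H e He) as [f' [z' [H1 [H2 H3]]]].
  replace (inner (field W f P) y + inner (coh W P) z)%C with
    (- (inner (field W (minus f' f) P) y + inner (coh W P) (minus z' z)))%C.
  2:{ rewrite (linear_minus _ _ _ (is_linear_field P)), inner_minus_l, inner_minus_r, (H1 P).
      ring. }
  rewrite Cmod_opp; eapply Rle_trans; [apply Cmod_triangle|].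
  pose proof (inner_bound (field W (minus f' f) P) y).
  pose proof (inner_bound (coh W P) (minus z' z)).
  pose proof (Hb (minus f' f)) as Hbf.
  change (norm (field W (minus f' f) P) <= M * norm (minus f' f)) in Hbf.
  change (norm (minus f' f) < e) in H2; change (norm (minus z' z) < e) in H3.
  pose proof (norm_nonneg y); pose proof (norm_nonneg (coh W P)).
  assert (norm (field W (minus f' f) P) <= M * e) by nra.
  nra.
Qed.

Lemma weyl_opp_coh F P :
  W (opp F) (coh W P) = cscal (cis (1 / 2 * symp F P)) (coh W (minus P F)).
Proof.
rewrite weyl_coh, symp_opp_l; f_equal; [f_equal; ring|f_equal; vec].
Qed.

Lemma weyl_displaced G a P f : W G (displaced W a P f) =
  cscal (cis (- (1 / 2) * symp G P))
    (minus (displaced W a (plus G P) f) (cscal (0, a * symp G f) (coh W (plus G P)))).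
Proof.
unfold displaced, coh; rewrite weyl_comp; f_equal.
rewrite <- weyl_cscal, <- weyl_minus; f_equal; rewrite symp_plus_l.
vec; destruct (inner e (vac W)), (inner e (vac_field W f)).
apply injective_projections; simpl; ring.
Qed.

Lemma weyl_field G f P : W G (field W f P) =
  cscal (cis (- (1 / 2) * symp G P))
    (minus (field W f (plus G P)) (cscal (0, symp G f) (coh W (plus G P)))).
Proof.
unfold field; rewrite weyl_displaced.
replace (1 * symp G f) with (symp G f) by ring; reflexivity.
Qed.

(** The Heisenberg shift [i Phi(f) W(G) = W(G) (i Phi(f) + i Im <G, f>)], read off from the
    displacement of coherent vectors. *)
Lemma weak_field_weyl f G y z : weak_field f y z ->
  weak_field f (W G y) (W G (plus z (cscal (0, symp G f) y))).
Proof.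
intros H P; rewrite !weyl_adjoint, weyl_field, weyl_coh.
rewrite !inner_cscal_l, inner_minus_l, inner_cscal_l, (H _).
rewrite inner_plus_r, inner_cscal_r, !symp_opp_l.
repeat match goal with |- context [inner ?a ?b] => destruct (inner a b) end.
apply injective_projections; simpl; ring.
Qed.

(** * Derivatives along curves of Weyl operators *)

Lemma filterlim_weyl_curve (T : Type) (L : (T -> Prop) -> Prop) {FL : Filter L}
  (theta : T -> R) (G f : T -> h) (z : T -> X) theta0 G0 f0 z0 y :
  filterlim theta L (locally theta0) -> filterlim G L (locally G0) ->
  filterlim f L (locally f0) -> filterlim z L (locally z0) ->
  filterlim (fun t => cscal (cis (theta t))
      (W (G t) (plus (z t) (cscal (0, symp (G t) (f t)) y)))) L
    (locally (cscal (cis theta0) (W G0 (plus z0 (cscal (0, symp G0 f0) y))))).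
Proof.
intros Htheta HG Hf Hz.
refine (filterlim_cis Htheta (filterlim_weyl HG (filterlim_vplus Hz _))).
apply filterlim_ext with (fun r => scal (symp (G r) (f r)) (cscal Ci y)).
{ intro r; vec; destruct (inner e y); apply injective_projections; simpl; ring. }
replace (cscal (0, symp G0 f0) y) with (scal (symp G0 f0) (cscal Ci y)).
2:{ vec; destruct (inner e y); apply injective_projections; simpl; ring. }
exact (filterlim_vscal (filterlim_symp HG Hf) (filterlim_const _)).
Qed.

(** If [G' = f] and [theta' = - (1/2) Im <f, G>], the Weyl relations turn the derivative of
    [cis theta W(G) y] into a field operator. The derivative is first computed
    weakly, on coherent vectors, where it falls on the explicit side; continuity
    of the candidate upgrades it to a norm derivative. *)
Lemma is_derive_weyl_curve (G f : R -> h) (theta : R -> R) y (z : R -> X) :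
  (forall t, is_derive G t (f t)) ->
  (forall t, continuous f t) ->
  (forall t, is_derive theta t (- (1 / 2) * symp (f t) (G t))) ->
  (forall t, weak_field (f t) y (z t)) ->
  (forall t, continuous z t) ->
  forall t, is_derive (fun r => cscal (cis (theta r)) (W (G r) y)) t
    (cscal (cis (theta t)) (W (G t) (plus (z t) (cscal (0, symp (G t) (f t)) y)))).
Proof.
intros HG Hf Htheta Hyz Hz.
set (u := fun r => cscal (cis (theta r)) (W (G r) y)).
set (q := fun t => cscal (cis (theta t)) (W (G t) (plus (z t) (cscal (0, symp (G t) (f t)) y)))).
assert (HGc : forall t, continuous G t).
{ intro t; exact (@is_derive_continuous h G t _ (HG t)). }
assert (Hq : forall t, continuous q t).
{ intro t; refine (filterlim_weyl_curve _ (HGc t) (Hf t) (Hz t)).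
  exact (@is_derive_continuous R_NormedModule theta t _ (Htheta t)). }
assert (Hweak : forall P c t,
  is_derive (fun r => re (cscal c (coh W P)) (u r)) t (re (cscal c (coh W P)) (q t))).
{ intros P c t.
  (* the adjoint of [cis theta W(G)] applied to [c coh P] *)
  set (v := fun r => cscal c (cscal (cis (- theta r + 1 / 2 * symp (G r) P))
    (coh W (minus P (G r))))).
  assert (Hadj : forall r x, inner (cscal c (coh W P)) (cscal (cis (theta r)) (W (G r) x))
    = inner (v r) x).
  { intros r x; unfold v.
    rewrite inner_cscal_r, !inner_cscal_l, weyl_adjoint, weyl_opp_coh, inner_cscal_l.
    rewrite !cis_conj.
    replace (- (- theta r + 1 / 2 * symp (G r) P)) with
      (theta r + - (1 / 2 * symp (G r) P)) by ring.
    rewrite cis_plus; ring. }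
  set (Q := minus P (G t)).
  assert (Hv : is_derive v t (cscal c (cscal (cis (- theta t + 1 / 2 * symp (G t) P))
    (plus (coh_diff W Q (opp (f t)))
      (cscal (0, - (- (1 / 2) * symp (f t) (G t)) + 1 / 2 * symp (f t) P) (coh W Q)))))).
  { apply (is_derive_linear (is_linear_cscal c)).
    refine (is_derive_cis (b := fun r => - theta r + 1 / 2 * symp (G r) P)
      (v := fun r => coh W (minus P (G r))) _ _).
    - refine (@is_derive_plus R_AbsRing R_NormedModule (fun r => - theta r)
        (fun r => 1 / 2 * symp (G r) P) t _ _ _ _).
      + exact (@is_derive_opp R_AbsRing R_NormedModule theta t _ (Htheta t)).
      + exact (is_derive_linear (is_linear_symp_mult (1 / 2) P) (HG t)).
    - refine (is_derive_coh W (P := fun r => minus P (G r)) _).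
      replace (opp (f t)) with (minus zero (f t)) by vec.
      exact (@is_derive_minus R_AbsRing h _ _ t _ _ (@is_derive_const R_AbsRing h P t) (HG t)). }
  apply is_derive_ext with (fun r => re (v r) y).
  { intro r; unfold re; rewrite <- Hadj; reflexivity. }
  pose proof (is_derive_re y Hv) as Hd.
  match type of Hd with is_derive _ _ ?d => replace (re (cscal c (coh W P)) (q t)) with d end.
  { exact Hd. }
  unfold q, re; rewrite Hadj; f_equal; unfold v; fold Q.
  assert (Eopp : coh_diff W Q (opp (f t)) = opp (coh_diff W Q (f t)))
    by exact (linear_opp _ _ (is_linear_displaced W (1 / 2) Q)).
  rewrite Eopp, coh_diff_field.
  rewrite !(inner_cscal_l c), !(inner_cscal_l (cis _)); do 2 f_equal.
  rewrite inner_plus_l, inner_opp_l, inner_minus_l, !inner_cscal_l, (Hyz t Q).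
  rewrite inner_plus_r, inner_cscal_r.
  replace (symp Q (f t)) with (- symp (f t) P - symp (G t) (f t)).
  2:{ unfold Q; rewrite symp_minus_l, (symp_anti P (f t)); ring. }
  rewrite (symp_anti (f t) (G t)).
  destruct (inner (coh W Q) (z t)), (inner (coh W Q) y).
  apply injective_projections; simpl; field. }
assert (Hint : forall t, u t = plus (u 0) (RInt q 0 t)).
{ intro t; apply (coh_total_eq (W := W)); intros P c; rewrite re_plus_r.
  pose proof (is_linear_re_r (cscal c (coh W P))) as Hlin.
  pose proof (is_RInt_linear Hlin (continuous_ex_RInt (a := 0) (b := t) Hq)) as H1.
  assert (H2 : is_RInt (fun r => re (cscal c (coh W P)) (q r)) 0 t
    (minus (re (cscal c (coh W P)) (u t)) (re (cscal c (coh W P)) (u 0)))).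
  { apply (is_RInt_derive (V := R_CompleteNormedModule) (fun r => re (cscal c (coh W P)) (u r))).
    - intros r _; apply Hweak.
    - intros r _; exact (filterlim_linear Hlin (Hq r)). }
  pose proof (eq_trans (eq_sym (@is_RInt_unique R_CompleteNormedModule _ _ _ _ H2))
    (@is_RInt_unique R_CompleteNormedModule _ _ _ _ H1)) as E1.
  change (re (cscal c (coh W P)) (u t) - re (cscal c (coh W P)) (u 0)
    = re (cscal c (coh W P)) (RInt q 0 t)) in E1; lra. }
intro t; apply is_derive_ext with (fun t => plus (u 0) (RInt q 0 t)).
{ intro r; symmetry; apply Hint. }
replace (cscal (cis (theta t)) _) with (plus zero (q t)) by (rewrite plus_zero_l; reflexivity).
exact (@is_derive_plus R_AbsRing X _ _ t _ _ (@is_derive_const R_AbsRing X (u 0) t)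
  (is_derive_RInt_continuous 0 t Hq)).
Qed.

End WeakField.

(** * The unitary groups of a Weyl system and their generators *)

Section WeylGroup.

Variables (h X : HilbertSpace) (W : weyl_system h X).
Implicit Types (F G P f : h) (x y z : X).

Lemma vscal_0 f : scal 0 f = zero.
Proof. exact (scal_zero_l (f : h)). Qed.

Lemma vscal_1 f : scal 1 f = f.
Proof. exact (scal_one (f : h)). Qed.

Lemma is_derive_scal_id f t : is_derive (fun r : R => scal r f) t f.
Proof.
unfold is_derive; apply filterdiff_linear.
apply (is_linear_scal_l (f : h)).
Qed.

Lemma weyl_group_derive f y z : weak_field W f y z ->
  forall r, is_derive (fun r => W (scal r f) y) r (W (scal r f) z).
Proof.
intros H r.
pose proof (@is_derive_weyl_curve h X W (fun r => scal r f) (fun _ => f) (fun _ => 0) y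
  (fun _ => z)) as D.
assert (E : forall r x, cscal (cis 0) (W (scal r f) x) = W (scal r f) x)
  by (intros; rewrite cis_0; apply cscal_one).
apply is_derive_ext with (fun r => cscal (cis 0) (W (scal r f) y)); [intro; apply E|].
replace (W (scal r f) z) with
  (cscal (cis 0) (W (scal r f) (plus z (cscal (0, symp (scal r f) f) y)))).
- apply D; [apply is_derive_scal_id|intro; apply continuous_const| |intro; exact H
    |intro; apply continuous_const].
  intro t; rewrite symp_scal_r, symp_self, !Rmult_0_r.
  apply (@is_derive_const R_AbsRing R_NormedModule).
- rewrite E, symp_scal_l, symp_self, Rmult_0_r; f_equal.
  vec; apply injective_projections; simpl; ring.
Qed.

Lemma weyl_group_zero f x : W (scal 0 f) x = x.
Proof. rewrite vscal_0; apply weyl_zero. Qed.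

Lemma weyl_semigroup f : c0_semigroup (fun r => W (scal r f)).
Proof.
split; [|split; [|split]].
- intros; apply weyl_bounded.
- apply weyl_group_zero.
- intros s t _ _ x; rewrite weyl_comp, symp_scal_l, symp_scal_r, symp_self.
  replace (_ * _) with 0 by ring; rewrite cis_0, cscal_one; f_equal.
  vec.
- intros x t _; refine (filterlim_weyl _ (filterlim_const _)).
  apply filterlim_within; [apply locally_filter|].
  exact (@is_derive_continuous h _ t f (is_derive_scal_id f t)).
Qed.

Lemma weak_field_generator f y z : weak_field W f y z ->
  generator (fun r => W (scal r f)) y z.
Proof.
intro H; apply (is_derive_right_quotient (u := fun r => W (scal r f) y)).
- apply weyl_group_zero.
- pose proof (weyl_group_derive H 0) as D; rewrite weyl_group_zero in D; exact D.
Qed.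

Lemma weak_field_skew f y z : weak_field W f y z -> re y z = 0.
Proof.
intro H; pose proof (is_derive_norm_sq (weyl_group_derive H 0)) as D.
rewrite !weyl_group_zero in D.
assert (D0 : is_derive (fun r => norm (W (scal r f) y) ^ 2) 0 0).
{ apply is_derive_ext with (fun _ : R => norm y ^ 2).
  - intro r; rewrite weyl_norm; reflexivity.
  - apply (@is_derive_const R_AbsRing R_NormedModule). }
apply is_derive_unique in D; apply is_derive_unique in D0.
rewrite D0 in D; lra.
Qed.

Lemma coh_group_derive f P : is_derive (fun r => W (scal r f) (coh W P)) 0 (field W f P).
Proof.
apply is_derive_ext with (fun r => cscal (cis (- (1 / 2) * symp f P * r))
  (coh W (plus (scal r f) P))).
{ intro r; rewrite weyl_coh, symp_scal_l; f_equal; f_equal; ring. }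
replace (field W f P) with (cscal (cis (- (1 / 2) * symp f P * 0))
  (plus (coh_diff W (plus (scal 0 f) P) (plus f zero))
     (cscal (0, - (1 / 2) * symp f P) (coh W (plus (scal 0 f) P))))).
- refine (is_derive_cis (b := fun r => - (1 / 2) * symp f P * r)
    (v := fun r => coh W (plus (scal r f) P)) _ _).
  + auto_derive; [easy|ring].
  + refine (is_derive_coh W (P := fun r => plus (scal r f) P) _).
    exact (@is_derive_plus R_AbsRing h _ _ 0 _ _ (is_derive_scal_id f 0)
      (@is_derive_const R_AbsRing h P 0)).
- rewrite vscal_0, plus_zero_l, plus_zero_r, Rmult_0_r, cis_0, cscal_one.
  rewrite coh_diff_field, (symp_anti P f).
  vec; destruct (inner e (coh W P)); apply injective_projections; simpl; field.
Qed.

(** Differentiating [<W(r f) coh Q, coh P> = <coh Q, W(- r f) coh P>] at [r = 0] gives the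
    skew-symmetry of the field operators on coherent vectors. *)
Lemma coh_weak_field f P : weak_field W f (coh W P) (field W f P).
Proof.
intro Q.
replace (- inner (coh W Q) (field W f P))%C with (inner (coh W Q) (opp (field W f P)))
  by apply inner_opp_r.
apply inner_eq_of_re; intro c.
assert (Ef : opp (field W f P) = field W (opp f) P).
{ symmetry; exact (linear_opp _ _ (is_linear_field W P)). }
rewrite Ef, (re_sym (coh W Q)).
pose proof (is_derive_re (cscal c (coh W P)) (coh_group_derive f Q)) as D1.
pose proof (is_derive_linear (is_linear_cscal c) (coh_group_derive (opp f) P)) as D2.
apply (is_derive_re (coh W Q)) in D2.
apply is_derive_unique in D1; apply is_derive_unique in D2.
rewrite <- D1, <- D2; apply Derive_ext; intro r.
rewrite (re_sym (cscal c _)); unfold re.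
rewrite <- (weyl_cscal W), weyl_adjoint; do 4 f_equal.
vec.
Qed.

Lemma comb_weak_field f v :
  weak_field W f (comb (coh W) v) (comb (field W f) v).
Proof.
induction v as [|[c P] v IH]; simpl.
- intro P; rewrite !inner_zero_r; ring.
- apply weak_field_plus; [apply weak_field_cscal, coh_weak_field|exact IH].
Qed.

(** The span of the coherent vectors is invariant under the group, hence a core:
    for [x] in the span, [int_0^t W(r f) x dr] stays in the domain of any closed [T]
    that extends the field on coherent vectors. By density this holds for all [x], and
    for [x] in the domain of the generator the integrals divided by [t] converge to [x] in
    the graph norm as [t] tends to zero. *)
Lemma generator_core f (T : operator X) :
  T zero zero ->
  (forall x y x' y', T x y -> T x' y' -> T (plus x x') (plus y y')) ->
  (forall (c : C) x y, T x y -> T (cscal c x) (cscal c y)) ->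
  closed_relation (V1 := X) (V2 := X) T ->
  (forall P, T (coh W P) (field W f P)) ->
  forall y z, generator (fun r => W (scal r f)) y z -> T y z.
Proof.
intros T0 Tp Ts Tc Tcoh.
assert (Tlin : real_linear_relation (V1 := X) (V2 := X) T).
{ split; [exact T0|split; [exact Tp|]].
  intros r x y H; pose proof (Ts (RtoC r) x y H) as H1.
  rewrite !cscal_RtoC in H1; exact H1. }
assert (Hgroup : forall r v, T (W (scal r f) (comb (coh W) v)) (W (scal r f) (comb (field W f) v))).
{ intros r v; induction v as [|[c P] v IH].
  - simpl; rewrite !(linear_zero _ (is_linear_weyl W _)); exact T0.
  - cbn [comb]; rewrite !weyl_plus, !weyl_cscal; apply Tp; [|exact IH]; apply Ts.
    rewrite weyl_coh, weyl_field, symp_scal_l, symp_scal_l, symp_self, Rmult_0_r; apply Ts.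
    match goal with |- T (coh W ?Q) ?m => replace m with (field W f Q) end.
    { apply Tcoh. }
    vec; repeat match goal with |- context [inner ?a ?b] => destruct (inner a b) end.
    apply injective_projections; simpl; ring. }
assert (Hc : forall x (t : R), continuous (fun r : R => W (scal r f) x) t).
{ intros x r; refine (filterlim_weyl _ (filterlim_const _)).
  exact (@is_derive_continuous h _ r f (is_derive_scal_id f r)). }
assert (Hint : forall t x, 0 <= t ->
  T (RInt (fun r => W (scal r f) x) 0 t) (minus (W (scal t f) x) x)).
{ intros t x Ht; apply Tc; intros e He.
  set (K := t + 2).
  assert (He' : 0 < e / K) by (apply Rdiv_lt_0_compat; unfold K; lra).
  destruct (vac_cyclic W x He') as [v Hv].
  change (norm (minus (comb (coh W) v) x) < e / K) in Hv.
  set (c := comb (coh W) v) in *; set (n := norm (minus c x)) in *.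
  assert (Hn : n * K < e).
  { replace e with (e / K * K) by (field; unfold K; lra).
    apply Rmult_lt_compat_r; [unfold K; lra|exact Hv]. }
  assert (Hn0 : 0 <= n) by apply norm_nonneg.
  unfold K in Hn.
  exists (RInt (fun r => W (scal r f) c) 0 t), (minus (W (scal t f) c) c).
  split; [|split].
  - refine (@is_RInt_relation X X T Tlin Tc _ _ 0 t _ _ (fun r => Hgroup r v) _ _).
    + apply continuous_ex_RInt, Hc.
    + replace (minus (W (scal t f) c) c) with (minus (W (scal t f) c) (W (scal 0 f) c))
        by (rewrite weyl_group_zero; reflexivity).
      apply (is_RInt_derive (fun r => W (scal r f) c)).
      * intros r _; apply weyl_group_derive, comb_weak_field.
      * intros r _; apply Hc.
  - pose proof (is_RInt_minus _ _ _ _ _ _ (continuous_ex_RInt (a := 0) (b := t) (Hc c))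
      (continuous_ex_RInt (a := 0) (b := t) (Hc x))) as H1.
    eapply Rle_lt_trans; [refine (@norm_RInt_le_const X _ 0 t _ n Ht _ H1)|].
    + intros r _; right.
      change (norm (minus (W (scal r f) c) (W (scal r f) x)) = n).
      rewrite <- weyl_minus, weyl_norm; reflexivity.
    + nra.
  - match goal with |- norm ?v < _ =>
      assert (E : v = minus (W (scal t f) (minus c x)) (minus c x))
        by (rewrite weyl_minus; vec) end.
    rewrite E.
    eapply Rle_lt_trans; [apply norm_minus_le|].
    rewrite weyl_norm; fold n; nra. }
intros y z Hyz; apply Tc; intros e He.
pose proof (filterlim_norm_elim Hyz He) as [d1 H1].
assert (Hder : is_derive (fun t => RInt (fun r => W (scal r f) y) 0 t) 0 y).
{ pose proof (is_derive_RInt_continuous 0 0 (Hc y)) as D.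
  cbv beta in D; rewrite weyl_group_zero in D; exact D. }
assert (Hpt : RInt (fun r => W (scal r f) y) 0 0 = zero) by (apply (@RInt_point X)).
pose proof (filterlim_norm_elim (is_derive_right_quotient Hpt Hder) He) as [d2 H2].
set (t := Rmin d1 d2 / 2).
assert (Ht : 0 < t /\ t < d1 /\ t < d2).
{ pose proof (cond_pos d1); pose proof (cond_pos d2).
  pose proof (Rmin_l d1 d2); pose proof (Rmin_r d1 d2).
  assert (0 < Rmin d1 d2) by (apply Rmin_pos; assumption); unfold t; lra. }
destruct Ht as [Ht [Ht1 Ht2]].
assert (Hball : forall d : posreal, t < d -> ball 0 d t).
{ intros d Hd; change (Rabs (t - 0) < d); rewrite Rabs_pos_eq; lra. }
exists (scal (/ t) (RInt (fun r => W (scal r f) y) 0 t)), (scal (/ t) (minus (W (scal t f) y) y)).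
split; [|split].
- apply Tlin, Hint; lra.
- specialize (H2 t (Hball d2 Ht2) Ht).
  replace (RInt (fun r => W (scal r f) y) 0 t)
    with (minus (RInt (fun r => W (scal r f) y) 0 t) zero); [exact H2|vec].
- exact (H1 t (Hball d1 Ht1) Ht).
Qed.

End WeylGroup.

(** * Curves on a compact interval *)

Definition clamp (a b t : R) : R := Rmax a (Rmin b t).

Lemma clamp_range a b t : a <= b -> a <= clamp a b t <= b.
Proof.
intro H; unfold clamp, Rmax, Rmin.
destruct (Rle_dec b t); destruct (Rle_dec a _); lra.
Qed.

Lemma clamp_id a b t : a <= t <= b -> clamp a b t = t.
Proof.
intro H; unfold clamp, Rmax, Rmin.
destruct (Rle_dec b t); destruct (Rle_dec a _); lra.
Qed.

Lemma clamp_contraction a b t u : Rabs (clamp a b t - clamp a b u) <= Rabs (t - u).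
Proof.
unfold clamp, Rmax, Rmin.
destruct (Rle_dec b t), (Rle_dec b u);
  repeat match goal with |- context [Rle_dec ?x ?y] => destruct (Rle_dec x y) end;
  unfold Rabs; repeat destruct (Rcase_abs _); lra.
Qed.

Lemma continuous_clamp (V : UniformSpace) a b (g : R -> V) : a <= b ->
  continuous_on (fun t => a <= t <= b) g ->
  forall t, continuous (fun r => g (clamp a b r)) t.
Proof.
intros Hab H t P HP.
destruct (H (clamp a b t) (clamp_range t Hab) P HP) as [d Hd].
exists d; intros u Hu; apply Hd; [|apply clamp_range, Hab].
eapply Rle_lt_trans; [apply clamp_contraction|exact Hu].
Qed.

Lemma is_filter_lim_within (D : R -> Prop) t : is_filter_lim (within D (locally t)) t.
Proof. intros P HP; revert HP; unfold within; apply filter_imp; auto. Qed.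

Lemma is_filter_lim_within_unique (D : R -> Prop) t u : D t ->
  is_filter_lim (within D (locally t)) u -> u = t.
Proof.
intros Ht Hu; destruct (Req_dec u t) as [E|E]; [exact E|exfalso].
assert (He : 0 < Rabs (t - u)) by (apply Rabs_pos_lt; lra).
destruct (Hu _ (locally_ball u (mkposreal _ He))) as [d Hd].
specialize (Hd t (ball_center t d) Ht).
change (Rabs (t - u) < Rabs (t - u)) in Hd; lra.
Qed.

Lemma is_derive_within (V : NormedModule R_AbsRing) (x : R -> V) (D : R -> Prop) t d : D t ->
  is_derive x t d -> filterdiff x (within D (locally t)) (fun u : R => scal u d).
Proof.
intros Ht [Hl Hd]; split; [exact Hl|].
intros u Hu e; assert (E : u = t) by exact (is_filter_lim_within_unique Ht Hu); subst u.
generalize (Hd t (fun P HP => HP) e); unfold within; apply filter_imp; auto.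
Qed.

Lemma filterlim_of_within (V : NormedModule R_AbsRing) (x : R -> V) (D : R -> Prop) t d :
  filterdiff x (within D (locally t)) (fun u : R => scal u d) ->
  filterlim x (within D (locally t)) (locally (x t)).
Proof.
intro H.
exact (@filterdiff_continuous_aux R_AbsRing R_NormedModule V (within D (locally t))
  (@within_filter _ D _ _) x (ex_intro _ _ H) t (@is_filter_lim_within D t)).
Qed.

Lemma is_derive_of_within (V : NormedModule R_AbsRing) (x : R -> V) (D : R -> Prop) t d :
  locally t D -> filterdiff x (within D (locally t)) (fun u : R => scal u d) ->
  is_derive x t d.
Proof.
intros HD [Hl Hd]; split; [exact Hl|].
intros u Hu e.
assert (E : t = u) by exact (@is_filter_lim_locally_unique R_AbsRing R_NormedModule t u Hu).
subst u.
generalize (filter_and _ _ HD (Hd t (@is_filter_lim_within D t) e)).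
apply filter_imp; intros r [H1 H2]; exact (H2 H1).
Qed.

(** As [A(t)] is skew-symmetric, the difference of two solutions has constant norm. *)
Lemma ivp_unique (X : HilbertSpace) (A : R -> operator X) Y s y x1 x2 :
  (forall t u v u' v', A t u v -> A t u' v' -> re (minus u u') (minus v v') = 0) ->
  s <= 1 -> ivp_solution A Y s y x1 -> ivp_solution A Y s y x2 ->
  forall t, s <= t <= 1 -> x1 t = x2 t.
Proof.
intros Hskew Hs [E1 [dx1 [_ H1]]] [E2 [dx2 [_ H2]]].
set (D := fun r => s <= r <= 1).
set (n := fun r : R => norm (minus (x1 (clamp s 1 r)) (x2 (clamp s 1 r))) ^ 2).
assert (Hc : forall r, continuity_pt n r).
{ intro r; apply continuity_pt_filterlim.
  assert (Hd : continuous (fun r => minus (x1 (clamp s 1 r)) (x2 (clamp s 1 r))) r).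
  { apply (continuous_clamp (g := fun r => minus (x1 r) (x2 r)) Hs).
    intros t Ht; destruct (H1 t Ht) as [_ [_ D1]]; destruct (H2 t Ht) as [_ [_ D2]].
    refine (filterlim_vplus (filterlim_of_within D1)
      (filterlim_linear _ (filterlim_of_within D2))).
    exact (@is_linear_opp R_AbsRing X). }
  apply (filterlim_comp _ _ _ (fun r => norm (minus (x1 (clamp s 1 r)) (x2 (clamp s 1 r))))
    (fun r => r ^ 2) (locally r) (locally (norm (minus (x1 (clamp s 1 r)) (x2 (clamp s 1 r)))))).
  - exact (filterlim_comp _ _ _ _ _ _ _ _ Hd (filterlim_norm _)).
  - apply (ex_derive_continuous (K := R_AbsRing) (V := R_NormedModule) (fun r : R => r ^ 2)).
    auto_derive; easy. }
assert (Hder : forall r, s < r < 1 -> is_derive n r 0).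
{ intros r Hr.
  assert (Hloc : locally r D).
  { assert (He : 0 < Rmin (r - s) (1 - r)) by (apply Rmin_pos; lra).
    exists (mkposreal _ He); intros u Hu; change (Rabs (u - r) < Rmin (r - s) (1 - r)) in Hu.
    pose proof (Rmin_l (r - s) (1 - r)); pose proof (Rmin_r (r - s) (1 - r)).
    apply Rabs_def2 in Hu; unfold D; lra. }
  assert (Hr' : s <= r <= 1) by lra.
  destruct (H1 r Hr') as [_ [A1 D1]]; destruct (H2 r Hr') as [_ [A2 D2]].
  assert (Hn : is_derive (fun u => norm (minus (x1 u) (x2 u)) ^ 2) r
    (2 * re (minus (x1 r) (x2 r)) (minus (dx1 r) (dx2 r)))).
  { exact (is_derive_norm_sq (X := X) (@is_derive_minus R_AbsRing X _ _ _ _ _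
      (is_derive_of_within Hloc D1) (is_derive_of_within Hloc D2))). }
  rewrite (Hskew _ _ _ _ _ A1 A2), Rmult_0_r in Hn.
  revert Hn; apply is_derive_ext_loc.
  revert Hloc; apply filter_imp; intros u Hu; unfold n; rewrite clamp_id by exact Hu.
  reflexivity. }
intros t Ht.
destruct (Req_dec s t) as [E|E]; [subst t; rewrite E1, E2; reflexivity|].
destruct (MVT_gen n s t (fun _ => 0)) as [c [_ Hcn]].
- intros r Hr; rewrite Rmin_left, Rmax_right in Hr by lra; apply Hder; lra.
- intros r _; apply Hc.
- unfold n in Hcn; rewrite !clamp_id in Hcn by lra.
  rewrite E1, E2, minus_self, norm_zero' in Hcn.
  apply norm_minus_eq.
  pose proof (norm_nonneg (minus (x1 t) (x2 t))); nra.
Qed.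

(** * The evolution system of a continuous path *)

Section PathDefinitions.

Variables (h X : HilbertSpace) (W : weyl_system h X) (f : R -> h).

(** Extending the path to all times makes derivatives at the end points of the unit
    interval two-sided. *)
Definition clamped (t : R) : h := f (clamp 0 1 t).

Definition path_integral (t : R) : h := RInt clamped 0 t.

Definition path_area (t : R) : R :=
  RInt (fun u => symp (clamped u) (path_integral u)) 0 t.

(** The double integral of [Im <f u, f v>] over [s <= v <= u <= t], times [- 1 / 2], with its
    dependence on [s] and [t] separated. *)
Definition path_phase (s t : R) : R :=
  - (1 / 2) * (path_area t - path_area s - symp (path_integral t) (path_integral s)).

Definition path_evolution (t s : R) (x : X) : X :=
  W (minus (path_integral t) (path_integral s)) (cscal (cis (path_phase s t)) x).

End PathDefinitions.

Section PathEvolution.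

Variables (h X : HilbertSpace) (W : weyl_system h X) (f : R -> h) (A : R -> operator X).
Hypothesis hf : continuous_on unit_interval f.
Hypothesis HA : forall t y z, A t y z <-> weak_field W (f t) y z.

Notation Y := (maximal_continuity_subspace A).
Notation fc := (clamped f).
Notation F0 := (path_integral f).
Notation U := (path_evolution W f).

Lemma continuous_clamped t : continuous fc t.
Proof. apply (continuous_clamp (g := f)); [lra|exact hf]. Qed.
Arguments continuous_clamped : clear implicits.

Lemma is_derive_path_integral t : is_derive F0 t (fc t).
Proof. apply is_derive_RInt_continuous, continuous_clamped. Qed.

Lemma continuous_path_integral t : continuous F0 t.
Proof. exact (@is_derive_continuous h F0 t _ (is_derive_path_integral t)). Qed.
Arguments continuous_path_integral : clear implicits.

Lemma continuous_area_density t : continuous (fun u => symp (fc u) (F0 u)) t.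
Proof. exact (filterlim_symp (continuous_clamped t) (continuous_path_integral t)). Qed.
Arguments continuous_area_density : clear implicits.

Lemma is_derive_path_area t : is_derive (path_area f) t (symp (fc t) (F0 t)).
Proof.
apply (@is_derive_RInt R_CompleteNormedModule (fun u => symp (fc u) (F0 u)) (path_area f) 0 t);
  [|apply continuous_area_density].
apply filter_forall; intro r; apply (@RInt_correct R_CompleteNormedModule).
apply (@ex_RInt_continuous R_CompleteNormedModule); intros u _; apply continuous_area_density.
Qed.

Lemma is_derive_path_phase s t :
  is_derive (path_phase f s) t (- (1 / 2) * symp (fc t) (minus (F0 t) (F0 s))).
Proof.
rewrite symp_minus_r; unfold path_phase.
apply (is_derive_scal (fun t => path_area f t - path_area f s - symp (F0 t) (F0 s))).
apply (@is_derive_minus R_AbsRing R_NormedModule (fun t => path_area f t - path_area f s)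
  (fun t => symp (F0 t) (F0 s))).
- replace (symp (fc t) (F0 t)) with (symp (fc t) (F0 t) - 0) by ring.
  apply (@is_derive_minus R_AbsRing R_NormedModule (path_area f) (fun _ => path_area f s));
    [apply is_derive_path_area|apply (@is_derive_const R_AbsRing R_NormedModule)].
- exact (is_derive_linear (is_linear_symp_l (F0 s)) (is_derive_path_integral t)).
Qed.

(** The defect of additivity is the phase of the Weyl relations, so that [U] is multiplicative. *)
Lemma path_phase_chasles r s t :
  path_phase f r t = path_phase f s t + path_phase f r s
    - 1 / 2 * symp (minus (F0 t) (F0 s)) (minus (F0 s) (F0 r)).
Proof.
unfold path_phase; rewrite symp_minus_l, !symp_minus_r, symp_self; field.
Qed.

Lemma path_evolution_bounded t s : bounded_operator (U t s).
Proof.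
split.
- apply (is_linear_comp (fun x => cscal (cis (path_phase f s t)) x)
    (W (minus (F0 t) (F0 s)))); [apply is_linear_cscal|apply is_linear_weyl].
- intros c x; unfold path_evolution; rewrite <- weyl_cscal; f_equal; vec.
Qed.

Lemma path_evolution_comp r s t x : U t s (U s r x) = U t r x.
Proof.
unfold path_evolution; rewrite <- weyl_cscal, weyl_comp, <- weyl_cscal.
f_equal.
- vec.
- rewrite !cscal_assoc, <- !cis_plus, (path_phase_chasles r s t); do 2 f_equal; ring.
Qed.

Lemma path_evolution_id s x : U s s x = x.
Proof.
unfold path_evolution, path_phase; rewrite minus_self, weyl_zero, symp_self.
replace (_ * _) with 0 by ring; rewrite cis_0; apply cscal_one.
Qed.

Lemma path_evolution_continuous x :
  continuous_on (fun p : R * R => 0 <= fst p /\ fst p <= snd p /\ snd p <= 1)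
    (fun p => U (snd p) (fst p) x).
Proof.
intros [a b] _; apply filterlim_within; [apply locally_filter|].
assert (H1 : forall (V : UniformSpace) (g : R -> V), (forall t, continuous g t) ->
  filterlim (fun q : R * R => g (fst q)) (locally (a, b)) (locally (g a))).
{ intros V g Hg; exact (filterlim_comp _ _ _ fst g _ _ _ (continuous_fst a b) (Hg a)). }
assert (H2 : forall (V : UniformSpace) (g : R -> V), (forall t, continuous g t) ->
  filterlim (fun q : R * R => g (snd q)) (locally (a, b)) (locally (g b))).
{ intros V g Hg; exact (filterlim_comp _ _ _ snd g _ _ _ (continuous_snd a b) (Hg b)). }
pose proof (H1 _ _ continuous_path_integral) as F1.
pose proof (H2 _ _ continuous_path_integral) as F2.
assert (HK : forall t, continuous (path_area f) t).
{ intro t; exact (@is_derive_continuous R_NormedModule _ t _ (is_derive_path_area t)). }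
pose proof (H1 R_UniformSpace _ HK) as K1; pose proof (H2 R_UniformSpace _ HK) as K2.
refine (filterlim_weyl (G := fun q => minus (F0 (snd q)) (F0 (fst q)))
  (u := fun q => cscal (cis (path_phase f (fst q) (snd q))) x) _ 
  (filterlim_cis (b := fun q => path_phase f (fst q) (snd q)) _ (filterlim_const x))).
- refine (filterlim_vplus F2 (filterlim_linear _ F1)); exact (@is_linear_opp R_AbsRing h).
- pose proof (filterlim_symp F2 F1) as S.
  apply (continuous_scal_r (K := R_AbsRing) (V := R_NormedModule) (- (1 / 2))
    (fun q : R * R => path_area f (snd q) - path_area f (fst q) - symp (F0 (snd q)) (F0 (fst q)))).
  apply (continuous_minus (V := R_NormedModule)); [|exact S].
  apply (continuous_minus (V := R_NormedModule)); [exact K2|exact K1].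
Qed.

(** * The maximal continuity subspace *)

Lemma subspace_elim y : Y y -> exists z : R -> X,
  (forall t, continuous z t) /\ forall t, weak_field W (fc t) y (z t).
Proof.
intros [g [H1 H2]]; exists (fun t => g (clamp 0 1 t)); split.
- apply (continuous_clamp (g := g)); [lra|exact H2].
- intro t; apply HA, H1, clamp_range; lra.
Qed.

Lemma subspace_intro y (z : R -> X) : (forall t, continuous z t) ->
  (forall t, weak_field W (fc t) y (z t)) -> Y y.
Proof.
intros Hz H; exists z; split.
- intros t Ht; apply HA; pose proof (H t) as H0; unfold clamped in H0.
  rewrite clamp_id in H0 by exact Ht; exact H0.
- intros t _; apply filterlim_within; [apply locally_filter|apply Hz].
Qed.

Lemma subspace_plus y y' : Y y -> Y y' -> Y (plus y y').
Proof.
intros Hy Hy'; destruct (subspace_elim Hy) as [z [H1 H2]].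
destruct (subspace_elim Hy') as [z' [H1' H2']].
apply subspace_intro with (fun t => plus (z t) (z' t)).
- intro t; exact (filterlim_vplus (H1 t) (H1' t)).
- intro t; apply weak_field_plus; auto.
Qed.

Lemma subspace_cscal c y : Y y -> Y (cscal c y).
Proof.
intro Hy; destruct (subspace_elim Hy) as [z [H1 H2]].
apply subspace_intro with (fun t => cscal c (z t)).
- intro t; exact (filterlim_linear (is_linear_cscal c) (H1 t)).
- intro t; apply weak_field_cscal; auto.
Qed.

Lemma subspace_coh P : Y (coh W P).
Proof.
apply subspace_intro with (fun t => field W (fc t) P).
- intro t; exact (filterlim_linear (is_linear_field W P) (continuous_clamped t)).
- intro t; apply coh_weak_field.
Qed.

Lemma subspace_dense : dense_subspace Y.
Proof.
split; [exact subspace_plus|split; [exact subspace_cscal|]].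
intros x e He; destruct (vac_cyclic W x He) as [v Hv].
exists (comb (coh W) v); split; [|exact Hv]; clear Hv.
induction v as [|[c P] v IH]; simpl.
- replace (zero : X) with (cscal 0 (coh W zero)); [apply subspace_cscal, subspace_coh|].
  vec.
- apply subspace_plus; [apply subspace_cscal, subspace_coh|exact IH].
Qed.

Lemma subspace_weyl G y : Y y -> Y (W G y).
Proof.
intro Hy; destruct (subspace_elim Hy) as [z [H1 H2]].
apply subspace_intro with (fun t => cscal (cis 0)
  (W G (plus (z t) (cscal (0, symp G (fc t)) y)))).
- intro t; exact (filterlim_weyl_curve (y := y) (filterlim_const _) (filterlim_const _)
    (continuous_clamped t) (H1 t)).
- intro t; rewrite cis_0, cscal_one; apply weak_field_weyl, H2.
Qed.

Lemma path_evolution_ivp y s : Y y -> 0 <= s <= 1 ->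
  ivp_solution A Y s y (fun t => U t s y).
Proof.
intros Hy Hs; split; [apply path_evolution_id|].
destruct (subspace_elim Hy) as [z [H1 H2]].
set (G := fun t => minus (F0 t) (F0 s)).
assert (HG : forall t, is_derive G t (fc t)).
{ intro t; replace (fc t) with (minus (fc t) zero) by vec.
  exact (@is_derive_minus R_AbsRing h _ _ t _ _ (is_derive_path_integral t)
    (@is_derive_const R_AbsRing h (F0 s) t)). }
assert (Hphase := is_derive_path_phase s).
exists (fun t => cscal (cis (path_phase f s t))
  (W (G t) (plus (z t) (cscal (0, symp (G t) (fc t)) y)))); split.
- intros t _; apply filterlim_within; [apply locally_filter|].
  refine (filterlim_weyl_curve (y := y) _ _ (continuous_clamped t) (H1 t)).
  + exact (@is_derive_continuous R_NormedModule _ t _ (Hphase t)).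
  + exact (@is_derive_continuous h _ t _ (HG t)).
- intros t Ht; split; [|split].
  + apply subspace_weyl, subspace_cscal, Hy.
  + unfold path_evolution; rewrite weyl_cscal; apply HA, weak_field_cscal.
    replace (f t) with (fc t) by (unfold clamped; rewrite clamp_id; [reflexivity|lra]).
    apply weak_field_weyl, H2.
  + apply is_derive_within; [exact Ht|].
    apply is_derive_ext with (fun t => cscal (cis (path_phase f s t)) (W (G t) y)).
    { intro r; unfold path_evolution; rewrite weyl_cscal; reflexivity. }
    exact (is_derive_weyl_curve HG continuous_clamped Hphase H2 H1 t).
Qed.

Lemma path_evolution_system : evolution_system A Y U.
Proof.
split; [exact subspace_dense|split; [|split; [|split; [|split]]]].
- intros y [g [Hg _]] t Ht; exists (g t); auto.
- intros; apply path_evolution_bounded.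
- intros y s Hy Hs; apply path_evolution_ivp; [exact Hy|lra].
- intros; apply path_evolution_comp.
- exact path_evolution_continuous.
Qed.

Lemma field_skew t u v u' v' : A t u v -> A t u' v' -> re (minus u u') (minus v v') = 0.
Proof.
intros H H'; apply HA in H; apply HA in H'.
exact (weak_field_skew (weak_field_minus H H')).
Qed.

Lemma evolution_unique V : evolution_system A Y V ->
  forall s t, 0 <= s -> s <= t -> t <= 1 -> forall x, V t s x = U t s x.
Proof.
intros [_ [_ [Vb [Vivp [_ Vc]]]]].
assert (Hlt : forall s t, 0 <= s -> s < 1 -> s <= t -> t <= 1 -> forall x, V t s x = U t s x).
{ intros s t Hs Hs1 Hst Ht x.
  destruct (Vb s t (conj Hs Hst) Ht) as [Vl _].
  destruct (path_evolution_bounded t s) as [Ul _].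
  destruct (linear_norm _ Vl) as [M1 [HM1 B1]]; destruct (linear_norm _ Ul) as [M2 [HM2 B2]].
  apply norm_minus_eq, nonpos_of_small with (M1 + M2); intros e He.
  destruct subspace_dense as [_ [_ Hd]]; destruct (Hd x e He) as [y [Hy Hxy]].
  assert (E : V t s y = U t s y).
  { apply (ivp_unique field_skew (Rlt_le _ _ Hs1) (Vivp y s Hy (conj Hs Hs1))
      (path_evolution_ivp Hy (conj Hs (Rlt_le _ _ Hs1)))); lra. }
  replace (minus (V t s x) (U t s x)) with
    (minus (minus (V t s x) (V t s y)) (minus (U t s x) (U t s y)))
    by (rewrite E; vec).
  rewrite <- (linear_minus _ _ _ Vl), <- (linear_minus _ _ _ Ul).
  eapply Rle_trans; [apply norm_minus_le|].
  change (norm (V t s (minus x y)) + norm (U t s (minus x y)) <= (M1 + M2) * e).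
  pose proof (B1 (minus x y)) as C1; pose proof (B2 (minus x y)) as C2.
  rewrite norm_minus_sym in Hxy.
  change (norm (V t s (minus x y)) <= M1 * norm (minus x y)) in C1.
  change (norm (U t s (minus x y)) <= M2 * norm (minus x y)) in C2.
  assert (M1 * norm (minus x y) <= M1 * e) by (apply Rmult_le_compat_l; lra).
  assert (M2 * norm (minus x y) <= M2 * e) by (apply Rmult_le_compat_l; lra).
  lra. }
intros s t Hs Hst Ht x.
destruct (Rlt_dec s 1) as [Hs1|Hs1]; [apply Hlt; assumption|].
assert (Es : s = 1) by lra; assert (Et : t = 1) by lra; subst s t.
(* the initial value problem says nothing about [(1, 1)]; strong continuity does *)
apply norm_minus_eq, nonpos_of_small with 2; intros e He.
assert (H11 : 0 <= fst (1, 1) /\ fst (1, 1) <= snd (1, 1) /\ snd (1, 1) <= 1) by (simpl; lra).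
destruct (filterlim_norm_elim (Vc x (1, 1) H11) He) as [d1 D1].
destruct (filterlim_norm_elim (@path_evolution_continuous x (1, 1) H11) He) as [d2 D2].
set (r := Rmax 0 (1 - Rmin d1 d2 / 2)).
assert (Hm : 0 < Rmin d1 d2) by (apply Rmin_pos; apply cond_pos).
assert (Hr : 0 <= r /\ r < 1 /\ 1 - r <= Rmin d1 d2 / 2).
{ unfold r, Rmax; destruct (Rle_dec _ _); lra. }
assert (Hball : forall d : posreal, Rmin d1 d2 <= d -> ball (1, 1) d (r, 1)).
{ intros d Hd; split; [|apply ball_center].
  change (Rabs (r - 1) < d); rewrite Rabs_left; lra. }
assert (Hr1 : 0 <= fst (r, 1) /\ fst (r, 1) <= snd (r, 1) /\ snd (r, 1) <= 1) by (simpl; lra).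
specialize (D1 (r, 1) (Hball d1 (Rmin_l _ _)) Hr1).
specialize (D2 (r, 1) (Hball d2 (Rmin_r _ _)) Hr1).
simpl in D1, D2; rewrite (Hlt r 1) in D1 by lra.
pose proof (norm_minus_triangle (V 1 1 x) (U 1 r x) (U 1 1 x)) as T.
rewrite (norm_minus_sym (V 1 1 x) (U 1 r x)) in T.
change (norm (minus (U 1 r x) (V 1 1 x)) < e) in D1.
change (norm (minus (U 1 r x) (U 1 1 x)) < e) in D2; lra.
Qed.

(** * The explicit formulas *)

Lemma path_RInt s t : 0 <= s -> s <= t -> t <= 1 -> is_RInt f s t (minus (F0 t) (F0 s)).
Proof.
intros Hs Hst Ht; apply is_RInt_ext with fc.
{ rewrite Rmin_left, Rmax_right by lra; intros u Hu.
  unfold clamped; rewrite clamp_id; [reflexivity|lra]. }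
replace (minus (F0 t) (F0 s)) with (RInt fc s t).
- apply continuous_ex_RInt, continuous_clamped.
- assert (E : plus (F0 s) (RInt fc s t) = F0 t).
  { apply (@RInt_Chasles h); eexists; apply continuous_ex_RInt, continuous_clamped. }
  rewrite <- E; vec.
Qed.

Lemma phase_path_phase s t : 0 <= s -> s <= t -> t <= 1 ->
  phase f s t = cis (path_phase f s t).
Proof.
intros Hs Hst Ht; unfold phase; cbv zeta.
match goal with |- (cos ?a, sin ?a) = _ => replace a with (path_phase f s t) end;
  [reflexivity|].
unfold path_phase; f_equal.
set (g := fun u => symp (fc u) (F0 u) - symp (fc u) (F0 s)).
assert (Hg : is_RInt g s t (path_area f t - path_area f s - symp (F0 t) (F0 s))).
{ replace (path_area f t - path_area f s - symp (F0 t) (F0 s)) with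
    (minus (path_area f t - symp (F0 t) (F0 s)) (path_area f s - symp (F0 s) (F0 s))).
  2:{ change (path_area f t - symp (F0 t) (F0 s) - (path_area f s - symp (F0 s) (F0 s))
      = path_area f t - path_area f s - symp (F0 t) (F0 s)); rewrite symp_self; ring. }
  apply (is_RInt_derive (V := R_CompleteNormedModule)
    (fun u => path_area f u - symp (F0 u) (F0 s)) g).
  - intros u _; apply (@is_derive_minus R_AbsRing R_NormedModule (path_area f)
      (fun u => symp (F0 u) (F0 s))); [apply is_derive_path_area|].
    exact (is_derive_linear (is_linear_symp_l (F0 s)) (is_derive_path_integral u)).
  - intros u _; apply (continuous_minus (V := R_NormedModule) (fun u => symp (fc u) (F0 u)));
      [apply continuous_area_density|].
    exact (filterlim_linear (is_linear_symp_l (F0 s)) (continuous_clamped u)). }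
rewrite <- (@is_RInt_unique R_CompleteNormedModule _ _ _ _ Hg).
apply (@RInt_ext R_CompleteNormedModule).
rewrite Rmin_left, Rmax_right by lra; intros u Hu.
assert (H1 : is_RInt (fun v => symp (f u) (f v)) s u (symp (f u) (minus (F0 u) (F0 s)))).
{ assert (Hp : is_RInt f s u (minus (F0 u) (F0 s))) by (apply path_RInt; lra).
  exact (is_RInt_linear (is_linear_symp_r (f u)) Hp). }
rewrite symp_minus_r in H1; unfold g, clamped; rewrite clamp_id by lra.
symmetry; exact (@is_RInt_unique R_CompleteNormedModule _ _ _ _ H1).
Qed.

Lemma integral_operator_weak s t y z : 0 <= s -> s <= t -> t <= 1 ->
  integral_operator A s t y z -> weak_field W (minus (F0 t) (F0 s)) y z.
Proof.
intros Hs Hst Ht [Hy [g [Hg Hz]]].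
destruct (subspace_elim Hy) as [z' [H1 H2]].
assert (Hz' : is_RInt z' s t z).
{ revert Hz; apply is_RInt_ext; rewrite Rmin_left, Rmax_right by lra; intros u Hu.
  assert (Hu' : 0 <= u <= 1) by lra.
  pose proof (proj1 (HA _ _ _) (Hg u Hu')) as G1; pose proof (H2 u) as G2.
  unfold clamped in G2; rewrite clamp_id in G2 by exact Hu'.
  exact (weak_field_unique G1 G2). }
refine (weak_field_RInt (a := s) (b := t) H2 _ Hz').
apply is_RInt_ext with f; [|apply path_RInt; assumption].
rewrite Rmin_left, Rmax_right by lra; intros u Hu.
unfold clamped; rewrite clamp_id; [reflexivity|lra].
Qed.

Lemma op_closure_weak f0 (T : operator X) y z :
  (forall y z, T y z -> weak_field W f0 y z) -> op_closure T y z -> weak_field W f0 y z.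
Proof.
intros HT H; apply weak_field_closed; intros e He.
destruct (H e He) as [y' [z' [H1 H2]]]; exists y', z'; auto.
Qed.

Lemma integral_operator_plus s t x y x' y' :
  integral_operator A s t x y -> integral_operator A s t x' y' ->
  integral_operator A s t (plus x x') (plus y y').
Proof.
intros [Hx [g [Hg Hy]]] [Hx' [g' [Hg' Hy']]].
split; [apply subspace_plus; assumption|].
exists (fun u => plus (g u) (g' u)); split.
- intros u Hu; apply HA, weak_field_plus; apply HA; auto.
- exact (is_RInt_plus _ _ _ _ _ _ Hy Hy').
Qed.

Lemma integral_operator_cscal s t (c : C) x y :
  integral_operator A s t x y -> integral_operator A s t (cscal c x) (cscal c y).
Proof.
intros [Hx [g [Hg Hy]]]; split; [apply subspace_cscal; assumption|].
exists (fun u => cscal c (g u)); split.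
- intros u Hu; apply HA, weak_field_cscal, HA; auto.
- exact (is_RInt_linear (is_linear_cscal c) Hy).
Qed.

Lemma integral_operator_coh s t P : 0 <= s -> s <= t -> t <= 1 ->
  integral_operator A s t (coh W P) (field W (minus (F0 t) (F0 s)) P).
Proof.
intros Hs Hst Ht; split; [apply subspace_coh|].
exists (fun u => field W (f u) P); split.
- intros u _; apply HA, coh_weak_field.
- exact (is_RInt_linear (is_linear_field W P) (path_RInt Hs Hst Ht)).
Qed.

(** The closure lies between the restriction to coherent vectors, a core, and the weak
    relation, which is the generator. *)
Lemma integral_operator_closure s t : 0 <= s -> s <= t -> t <= 1 ->
  forall y z, op_closure (integral_operator A s t) y z <->
    generator (fun r => W (scal r (minus (F0 t) (F0 s)))) y z.
Proof.
intros Hs Hst Ht y z; split.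
- intro H; apply weak_field_generator; revert H; apply op_closure_weak.
  intros; apply integral_operator_weak; assumption.
- apply generator_core.
  + replace (zero : X) with (cscal 0 (coh W zero)) at 1 by vec.
    replace (zero : X) with (cscal 0 (field W (minus (F0 t) (F0 s)) zero)) by vec.
    apply op_closure_cscal; [intros; apply integral_operator_cscal; assumption|].
    apply op_closure_incl, integral_operator_coh; assumption.
  + apply op_closure_plus; intros; apply integral_operator_plus; assumption.
  + apply op_closure_cscal; intros; apply integral_operator_cscal; assumption.
  + apply op_closure_closed.
  + intro P; apply op_closure_incl, integral_operator_coh; assumption.
Qed.

Lemma weyl_is_exp F (G : operator X) :
  (forall y z, G y z <-> generator (fun r => W (scal r F)) y z) -> is_exp G (W F).
Proof.
intro HG; exists (fun r => W (scal r F)); split; [apply weyl_semigroup|].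
split; [exact HG|]; intro x; rewrite vscal_1; reflexivity.
Qed.

Lemma path_evolution_formulas s t : 0 <= s -> s <= t -> t <= 1 ->
  closable (integral_operator A s t) /\
  is_exp (op_closure (integral_operator A s t)) (W (RInt f s t)) /\
  forall x, U t s x = W (RInt f s t) (cscal (phase f s t) x).
Proof.
intros Hs Hst Ht.
assert (E : RInt f s t = minus (F0 t) (F0 s))
  by exact (@is_RInt_unique h _ _ _ _ (path_RInt Hs Hst Ht)).
rewrite E; split; [|split].
- assert (H0 : forall y z, op_closure (integral_operator A s t) y z ->
    weak_field W (minus (F0 t) (F0 s)) y z).
  { intros y z; apply op_closure_weak; intros; apply integral_operator_weak; assumption. }
  intros x y y' H H'; exact (weak_field_unique (H0 _ _ H) (H0 _ _ H')).
- apply weyl_is_exp, integral_operator_closure; assumption.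
- intro x; rewrite phase_path_phase by assumption; reflexivity.
Qed.

End PathEvolution.

(** * Fock space as a space of functionals on product vectors *)

Section FockBasics.

Variable h : HilbertSpace.
Notation X := (fock h).
Notation comb_of := (list (C * list h)).
Notation snorm := (seminorm (@tensor_inner h)).

(** The inner product [<v, phi>] with a formal combination [v] of product vectors. *)
Definition pairing (v : comb_of) (phi : X) : C := antilin_ext (amplitude phi) v.

Lemma fock_eq (phi psi : X) : (forall l, amplitude phi l = amplitude psi l) -> phi = psi.
Proof. exact (@functional_eq _ _ _ phi psi). Qed.

Lemma amplitude_plus (phi psi : X) l :
  amplitude (plus phi psi) l = (amplitude phi l + amplitude psi l)%C.
Proof. reflexivity. Qed.

Lemma amplitude_cscal c (phi : X) l : amplitude (cscal c phi) l = (c * amplitude phi l)%C.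
Proof. reflexivity. Qed.

Lemma amplitude_scal (r : R) (phi : X) l :
  amplitude (scal r phi) l = (RtoC r * amplitude phi l)%C.
Proof. rewrite <- cscal_RtoC; apply amplitude_cscal. Qed.

Lemma amplitude_perm (phi : X) l m : Permutation l m -> amplitude phi l = amplitude phi m.
Proof. exact (@value_compat _ _ _ phi l m). Qed.

Lemma pairing_bound v (phi : X) : Cmod (pairing v phi) <= norm phi * snorm v.
Proof. exact (op_norm_bound (@tensor_inner_positive h) phi v). Qed.

Lemma norm_least (phi : X) M : 0 <= M ->
  (forall v, Cmod (pairing v phi) <= M * snorm v) -> norm phi <= M.
Proof. exact (@op_norm_least _ _ _ phi M). Qed.

Lemma norm_approx (phi : X) e : 0 < e ->
  exists v, snorm v <= 1 /\ norm phi - e <= Cmod (pairing v phi).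
Proof.
intro He; destruct (Classical_Prop.classic
  (exists v, snorm v <= 1 /\ norm phi - e <= Cmod (pairing v phi))) as [H|H]; [exact H|].
exfalso; assert (norm phi <= norm phi - e); [|lra].
apply (proj2 (op_norm_lub phi)); intros r [v [Hv ->]].
destruct (Rle_lt_dec (norm phi - e) (Cmod (pairing v phi))) as [H1|H1];
  [exfalso; eauto|left; exact H1].
Qed.

Lemma fock_vector (p : list h -> C) :
  (forall l m, Permutation l m -> p l = p m) ->
  (exists M, forall v, Cmod (antilin_ext p v) <= M * snorm v) ->
  exists phi : X, forall l, amplitude phi l = p l.
Proof. intros H1 H2; exists (Build_functional H1 H2); reflexivity. Qed.

(** * The semi-inner product of combinations *)

Lemma tensor_inner_conj (l m : list h) : tensor_inner l m = Cconj (tensor_inner m l).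
Proof.
revert m; induction l as [|f l IH]; intros [|g m]; simpl;
  try (apply injective_projections; simpl; ring).
rewrite Cmult_conj, <- IH, <- inner_conj; reflexivity.
Qed.

Lemma kernel_form_cons_r (K : list h -> list h -> C) v c b u :
  kernel_form K v ((c, b) :: u) =
  (c * antilin_ext (fun b' => K b' b) v + kernel_form K v u)%C.
Proof.
unfold kernel_form; rewrite <- antilin_ext_mult, <- antilin_ext_plus; reflexivity.
Qed.

Lemma antilin_ext_conj (B : Type) (p : B -> C) v :
  antilin_ext p v = Cconj (lin_ext (fun b => Cconj (p b)) v).
Proof.
induction v as [|[c b] v IH]; simpl; [apply injective_projections; simpl; ring|].
rewrite IH, Cplus_conj, Cmult_conj, Cconj_conj; reflexivity.
Qed.

Lemma kernel_form_conj u v :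
  kernel_form (@tensor_inner h) v u = Cconj (kernel_form (@tensor_inner h) u v).
Proof.
induction u as [|[c b] u IH].
- transitivity (RtoC 0); [|apply injective_projections; simpl; ring].
  induction v as [|[c b] v IH]; [reflexivity|].
  unfold kernel_form in *; simpl in *; rewrite IH; ring.
- rewrite kernel_form_cons_r, IH; unfold kernel_form at 2; simpl.
  rewrite Cplus_conj, Cmult_conj, Cconj_conj; f_equal; f_equal.
  rewrite antilin_ext_conj; f_equal; apply lin_ext_ext; intro m.
  symmetry; apply tensor_inner_conj.
Qed.

Lemma kernel_form_bound u v :
  Cmod (kernel_form (@tensor_inner h) u v) <= snorm u * snorm v.
Proof.
set (k := kernel_form (@tensor_inner h)).
set (z := k u v); set (a := snorm u); set (b := snorm v).
assert (Ha : 0 <= a) by apply seminorm_ge_0; assert (Hb : 0 <= b) by apply seminorm_ge_0.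
assert (Haa : Re (k u u) = a ^ 2)
  by (symmetry; apply (seminorm_sq (@tensor_inner_positive h))).
assert (Hbb : Re (k v v) = b ^ 2)
  by (symmetry; apply (seminorm_sq (@tensor_inner_positive h))).
assert (main : forall t, 0 <= a ^ 2 - 2 * t * Cmod z ^ 2 + t ^ 2 * Cmod z ^ 2 * b ^ 2).
{ intro t.
  pose proof (@tensor_inner_positive h (u ++ comb_scal (RtoC (- t) * Cconj z)%C v)) as H.
  rewrite kernel_form_app_l, !kernel_form_app_r, !kernel_form_scal_l,
    !kernel_form_scal_r in H; fold k in H.
  rewrite (kernel_form_conj u v : k v u = Cconj (k u v)) in H; fold z in H.
  replace (Cconj (RtoC (- t) * Cconj z)) with (RtoC (- t) * z)%C in H by Ceq.
  replace (k u u + RtoC (- t) * Cconj z * z +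
    (RtoC (- t) * z * Cconj z + RtoC (- t) * z * (RtoC (- t) * Cconj z * k v v)))%C
    with (k u u + RtoC (- 2 * t) * (z * Cconj z)
      + RtoC (t ^ 2) * ((z * Cconj z) * k v v))%C in H
    by (rewrite RtoC_mult; simpl pow; rewrite !RtoC_mult, RtoC_opp; Ceq).
  rewrite <- Cmod2_conj, !re_plus, !re_scal_l, re_RtoC, Haa, Hbb in H.
  simpl Nat.add in H; lra. }
destruct (Req_dec b 0) as [E|E].
- destruct (Req_dec (Cmod z) 0) as [E0|E0]; [rewrite E0; apply Rmult_le_pos; assumption|].
  exfalso; assert (Hz : 0 < Cmod z ^ 2) by (apply pow_lt; pose proof (Cmod_ge_0 z); lra).
  pose proof (main ((a ^ 2 + 1) / Cmod z ^ 2)) as H; rewrite E in H.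
  replace (a ^ 2 - 2 * ((a ^ 2 + 1) / Cmod z ^ 2) * Cmod z ^ 2 +
    ((a ^ 2 + 1) / Cmod z ^ 2) ^ 2 * Cmod z ^ 2 * 0 ^ 2)
    with (a ^ 2 - 2 * (a ^ 2 + 1)) in H by (field; lra).
  pose proof (pow2_ge_0 a); lra.
- assert (Hb2 : 0 < b ^ 2) by (apply pow_lt; lra).
  pose proof (main (/ b ^ 2)) as H.
  replace (a ^ 2 - 2 * / b ^ 2 * Cmod z ^ 2 + (/ b ^ 2) ^ 2 * Cmod z ^ 2 * b ^ 2)
    with (a ^ 2 - Cmod z ^ 2 / b ^ 2) in H by (field; exact E).
  assert (H1 : Cmod z ^ 2 <= (a * b) ^ 2).
  { rewrite Rpow_mult_distr.
    replace (Cmod z ^ 2) with (Cmod z ^ 2 / b ^ 2 * b ^ 2) by (field; exact E).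
    apply Rmult_le_compat_r; lra. }
  apply Rsqr_incr_0_var; [rewrite !Rsqr_pow2; exact H1|].
  apply Rmult_le_pos; assumption.
Qed.

(** * Vectors represented by combinations *)

(** The norm of [phi + t x] is at least [|<v, phi + t x>| / |v|] for all real [t];
    comparing the terms of first order in [t] gives the real part of the inner product. *)
Lemma inner_combination (x : X) v : (forall l, amplitude x l = lin_ext (tensor_inner l) v) ->
  norm x = snorm v /\ forall phi, inner x phi = pairing v phi.
Proof.
intro Hx.
assert (Hform : forall u, pairing u x = kernel_form (@tensor_inner h) u v).
{ intro u; apply antilin_ext_ext, Hx. }
assert (Hvv : pairing v x = RtoC (snorm v ^ 2)).
{ rewrite Hform; pose proof (kernel_form_conj v v) as H.
  rewrite (seminorm_sq (@tensor_inner_positive h)).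
  destruct (kernel_form (@tensor_inner h) v v) as [a b]; simpl.
  injection H; intro Hb; unfold RtoC; f_equal; lra. }
assert (Hn : norm x = snorm v).
{ apply Rle_antisym.
  - apply norm_least; [apply seminorm_ge_0|]; intro u; rewrite Hform, Rmult_comm.
    apply kernel_form_bound.
  - destruct (Req_dec (snorm v) 0) as [E|E]; [rewrite E; apply norm_nonneg|].
    assert (0 < snorm v) by (pose proof (seminorm_ge_0 (@tensor_inner h) v); lra).
    pose proof (pairing_bound v x) as H1.
    rewrite Hvv, Cmod_R, Rabs_pos_eq in H1 by apply pow2_ge_0; simpl in H1.
    rewrite Rmult_1_r in H1; apply Rmult_le_reg_r in H1; assumption. }
split; [exact Hn|].
assert (Hre : forall phi, re x phi = Re (pairing v phi)).
{ intro phi; set (m := Re (pairing v phi)); set (s := snorm v) in *.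
  assert (main : forall t, (m + t * s ^ 2) ^ 2 <=
    s ^ 2 * (norm phi ^ 2 + 2 * t * re x phi + t ^ 2 * s ^ 2)).
  { intro t.
    pose proof (pairing_bound v (plus phi (scal t x))) as H; fold s in H.
    assert (E : pairing v (plus phi (scal t x)) = (pairing v phi + RtoC (t * s ^ 2))%C).
    { rewrite RtoC_mult, <- Hvv; unfold pairing.
      rewrite <- antilin_ext_mult, <- antilin_ext_plus; apply antilin_ext_ext; intro l.
      rewrite amplitude_plus, amplitude_scal; reflexivity. }
    rewrite E in H.
    pose proof (re_le_Cmod (pairing v phi + RtoC (t * s ^ 2))%C) as H1.
    rewrite re_plus, re_RtoC in H1; fold m in H1.
    assert (H2 : (m + t * s ^ 2) ^ 2 <= (norm (plus phi (scal t x)) * s) ^ 2).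
    { rewrite <- (pow2_abs (m + t * s ^ 2)); apply pow_incr; split; [apply Rabs_pos|lra]. }
    rewrite Rpow_mult_distr, norm_sq_plus, re_scal_right, norm_rscal, Hn in H2.
    rewrite Rpow_mult_distr, pow2_abs, (re_sym phi x) in H2; lra. }
  destruct (Req_dec s 0) as [E|E].
  - rewrite E in Hn.
    assert (Ex : x = zero) by exact (norm_zero_eq Hn).
    assert (E1 : re x phi = 0) by (unfold re; rewrite Ex, inner_zero_l; reflexivity).
    rewrite E1; pose proof (main 0) as H; rewrite E in H; nra.
  - assert (Hs : 0 < s ^ 2) by (apply pow_lt; pose proof (seminorm_ge_0 (@tensor_inner h) v);
      unfold s in *; lra).
    set (d := re x phi - m); set (q := norm phi ^ 2).
    assert (Hd : forall t, 0 <= s ^ 2 * q - m ^ 2 + 2 * t * (s ^ 2 * d)).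
    { intro t; pose proof (main t) as H; fold q in H; unfold d; nra. }
    destruct (Req_dec d 0) as [E0|E0]; [unfold d in E0; lra|exfalso].
    assert (Hsd : s ^ 2 * d <> 0) by (apply Rmult_integral_contrapositive_currified; lra).
    pose proof (Hd (- (s ^ 2 * q - m ^ 2 + 1) / (2 * (s ^ 2 * d)))) as H.
    replace (2 * (- (s ^ 2 * q - m ^ 2 + 1) / (2 * (s ^ 2 * d))) * (s ^ 2 * d))
      with (- (s ^ 2 * q - m ^ 2 + 1)) in H by (field; split; [exact E0|lra]).
    lra. }
intro phi; rewrite inner_re_im, !Hre.
replace (pairing v (cscal Ci phi)) with (Ci * pairing v phi)%C.
- destruct (pairing v phi); simpl; f_equal; ring.
- unfold pairing; rewrite <- antilin_ext_mult; reflexivity.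
Qed.

(** * Antilinearity of amplitudes in each argument *)

(** Such a combination has seminorm zero. This is how boundedness alone forces the
    amplitudes to be antilinear in each argument. *)
Lemma pairing_null v : (forall m, antilin_ext (fun l => tensor_inner l m) v = 0) ->
  forall phi : X, pairing v phi = 0.
Proof.
intros Hv phi.
assert (Hk : forall u, kernel_form (@tensor_inner h) v u = 0).
{ induction u as [|[c b] u IH].
  - unfold kernel_form; simpl; clear; induction v as [|[c b] v IH]; simpl; [easy|].
    rewrite IH; ring.
  - rewrite kernel_form_cons_r, Hv, IH; ring. }
apply Cmod_eq_0, Rle_antisym; [|apply Cmod_ge_0].
eapply Rle_trans; [apply pairing_bound|].
unfold seminorm; rewrite Hk; simpl; rewrite sqrt_0; lra.
Qed.

Lemma amplitude_plus_arg (phi : X) (f g : h) l :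
  amplitude phi (plus f g :: l) = (amplitude phi (f :: l) + amplitude phi (g :: l))%C.
Proof.
pose proof (@pairing_null ((RtoC 1, plus f g :: l) :: (RtoC (-1), f :: l)
  :: (RtoC (-1), g :: l) :: nil)) as H.
assert (H0 : pairing ((RtoC 1, plus f g :: l) :: (RtoC (-1), f :: l)
  :: (RtoC (-1), g :: l) :: nil) phi = 0).
{ apply H; intros [|k m]; simpl; [Ceq|].
  rewrite inner_plus_l.
  replace (Cconj 1) with (RtoC 1) by Ceq; replace (Cconj (RtoC (-1))) with (- RtoC 1)%C by Ceq.
  ring. }
unfold pairing in H0; simpl in H0.
replace (Cconj 1) with (RtoC 1) in H0 by Ceq.
replace (Cconj (RtoC (-1))) with (- RtoC 1)%C in H0 by Ceq.
assert (Hgen : forall a b c : C,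
  (1 * a + (- (1) * b + (- (1) * c + 0)))%C = 0 -> a = (b + c)%C).
{ intros a b c E; replace a with
    ((1 * a + (- (1) * b + (- (1) * c + 0))) + b + c)%C by ring.
  rewrite E; ring. }
exact (Hgen _ _ _ H0).
Qed.

Lemma amplitude_cscal_arg (phi : X) c f l :
  amplitude phi (cscal c f :: l) = (Cconj c * amplitude phi (f :: l))%C.
Proof.
pose proof (@pairing_null ((RtoC 1, cscal c f :: l) :: ((- c)%C, f :: l) :: nil)) as H.
assert (H0 : pairing ((RtoC 1, cscal c f :: l) :: ((- c)%C, f :: l) :: nil) phi = 0).
{ apply H; intros [|k m]; simpl; [Ceq|].
  rewrite inner_cscal_l, Copp_conj; replace (Cconj 1) with (RtoC 1) by Ceq; ring. }
unfold pairing in H0; simpl in H0; rewrite Copp_conj in H0.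
replace (Cconj 1) with (RtoC 1) in H0 by Ceq.
assert (Hgen : forall a b d : C, (1 * a + (- d * b + 0))%C = 0 -> a = (d * b)%C).
{ intros a b d E; replace a with ((1 * a + (- d * b + 0)) + d * b)%C by ring.
  rewrite E; ring. }
exact (Hgen _ _ _ H0).
Qed.

End FockBasics.

(** * Truncation to finitely many particles *)

Section Truncation.

Variable h : HilbertSpace.
Notation X := (fock h).
Notation snorm := (seminorm (@tensor_inner h)).

Lemma tensor_inner_length (l m : list h) : length l <> length m -> tensor_inner l m = 0.
Proof.
revert m; induction l as [|f l IH]; intros [|g m] H; simpl in *; try reflexivity;
  [contradiction|].
rewrite IH by lia; ring.
Qed.

Definition particle_sign (N : nat) (l : list h) : R :=
  if (length l <=? N)%nat then 1 else -1.

Lemma particle_sign_sq N l : particle_sign N l * particle_sign N l = 1.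
Proof. unfold particle_sign; destruct (_ <=? _)%nat; ring. Qed.

Definition reflect_comb N (v : list (C * list h)) :=
  map (fun cb => ((RtoC (particle_sign N (snd cb)) * fst cb)%C, snd cb)) v.

Lemma reflect_comb_antilin N p (v : list (C * list h)) :
  antilin_ext (fun l => RtoC (particle_sign N l) * p l)%C v = antilin_ext p (reflect_comb N v).
Proof.
induction v as [|[c l] v IH]; simpl; [reflexivity|].
rewrite IH, Cmult_conj; f_equal.
replace (Cconj (RtoC (particle_sign N l))) with (RtoC (particle_sign N l)) by Ceq; ring.
Qed.

Lemma reflect_comb_seminorm N v : snorm (reflect_comb N v) = snorm v.
Proof.
assert (Hlin : forall l v, lin_ext (tensor_inner l) (reflect_comb N v) =
  (RtoC (particle_sign N l) * lin_ext (tensor_inner l) v)%C).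
{ intro l; clear v; induction v as [|[c m] v IH]; simpl; [ring|].
  rewrite IH; destruct (Nat.eq_dec (length l) (length m)) as [E|E].
  - unfold particle_sign; rewrite E; ring.
  - rewrite (tensor_inner_length E); ring. }
unfold seminorm; do 2 f_equal; unfold kernel_form.
rewrite <- reflect_comb_antilin; apply antilin_ext_ext; intro l.
rewrite Hlin, Cmult_assoc, <- RtoC_mult, particle_sign_sq; ring.
Qed.

Lemma reflection_le N (phi psi : X) :
  (forall l, amplitude psi l = (RtoC (particle_sign N l) * amplitude phi l)%C) ->
  norm psi <= norm phi.
Proof.
intro H; apply norm_least; [apply norm_nonneg|]; intro v.
unfold pairing; rewrite (antilin_ext_ext (q := fun l =>
  (RtoC (particle_sign N l) * amplitude phi l)%C)) by exact H.
rewrite reflect_comb_antilin, <- (reflect_comb_seminorm N v); apply pairing_bound.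
Qed.

(** Product vectors of different lengths are orthogonal, so that changing the sign of those
    beyond [N] particles preserves the semi-inner product. *)
Lemma reflection N (phi : X) : exists psi : X, norm psi = norm phi /\
  forall l, amplitude psi l = (RtoC (particle_sign N l) * amplitude phi l)%C.
Proof.
destruct (@fock_vector h (fun l => RtoC (particle_sign N l) * amplitude phi l)%C) as [psi Hpsi].
- intros l m H; rewrite (amplitude_perm phi H); f_equal.
  unfold particle_sign; rewrite (Permutation_length H); reflexivity.
- exists (norm phi); intro v; rewrite reflect_comb_antilin, <- (reflect_comb_seminorm N v).
  apply pairing_bound.
- exists psi; split; [|exact Hpsi]; apply Rle_antisym.
  + apply (reflection_le Hpsi).
  + apply (@reflection_le N); intro l.
    rewrite Hpsi, Cmult_assoc, <- RtoC_mult, particle_sign_sq; ring.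
Qed.

Definition is_truncation (N : nat) (phi psi : X) : Prop :=
  forall l, amplitude psi l = if (length l <=? N)%nat then amplitude phi l else 0.

(** The truncation is the average of a vector and its reflection; the parallelogram
    identity then gives the norm of the remainder. *)
Lemma truncation N (phi : X) : exists psi : X, is_truncation N phi psi /\
  norm (minus phi psi) ^ 2 = norm phi ^ 2 - norm psi ^ 2.
Proof.
destruct (reflection N phi) as [r [Hn Hr]].
exists (scal (1 / 2) (plus phi r)); split.
- intro l; rewrite amplitude_scal, amplitude_plus, Hr; unfold particle_sign.
  destruct (amplitude phi l); destruct (_ <=? _)%nat;
    apply injective_projections; simpl; field.
- replace (minus phi (scal (1 / 2) (plus phi r))) with (scal (1 / 2) (minus phi r)).
  2:{ apply inner_ext; intro e; repeat progress inner_simpl.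
      destruct (inner e phi), (inner e r); apply injective_projections; simpl; field. }
  rewrite !norm_rscal, !Rpow_mult_distr, !pow2_abs, norm_sq_plus, norm_sq_minus, Hn; lra.
Qed.

Lemma truncation_unique N (phi psi psi' : X) :
  is_truncation N phi psi -> is_truncation N phi psi' -> psi = psi'.
Proof. intros H H'; apply fock_eq; intro l; rewrite H, H'; reflexivity. Qed.

Lemma antilin_ext_truncate (p q : list h -> C) v :
  (forall l, (length l <= list_max (map (fun cb => length (snd cb)) v))%nat -> p l = q l) ->
  antilin_ext p v = antilin_ext q v.
Proof.
induction v as [|[c l] v IH]; intro H; [reflexivity|]; simpl in *.
rewrite IH by (intros m Hm; apply H; lia).
rewrite H by lia; reflexivity.
Qed.

(** A combination on which [phi] nearly attains its norm involves product vectors of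
    bounded length only, so that the truncations have nearly the same norm as [phi]. *)
Lemma truncation_cvg (phi : X) e : 0 < e -> exists N0, forall N psi, (N0 <= N)%nat ->
  is_truncation N phi psi -> norm (minus psi phi) < e.
Proof.
intro He; set (n := norm phi); assert (Hn : 0 <= n) by apply norm_nonneg.
set (d := Rmin 1 (e ^ 2 / (2 * n + 1))).
assert (He2 : 0 < e ^ 2) by (apply pow_lt; exact He).
assert (Hd : 0 < d) by (apply Rmin_pos; [lra|apply Rdiv_lt_0_compat; lra]).
destruct (norm_approx phi Hd) as [v [Hv1 Hv2]]; fold n in Hv2.
exists (list_max (map (fun cb => length (snd cb)) v)); intros N psi HN Hpsi.
destruct (truncation N phi) as [psi' [H1 H2]].
rewrite <- (truncation_unique Hpsi H1) in H2; fold n in H2.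
assert (E : pairing v psi = pairing v phi).
{ apply antilin_ext_truncate; intros l Hl; rewrite (Hpsi l).
  assert (Hle : (length l <= N)%nat) by lia.
  apply Nat.leb_le in Hle; rewrite Hle; reflexivity. }
pose proof (pairing_bound v psi) as H3; rewrite E in H3.
pose proof (norm_nonneg psi) as Hp.
assert (H4 : n - d <= norm psi) by nra.
assert (Hde : d * (2 * n + 1) <= e ^ 2).
{ replace (e ^ 2) with (e ^ 2 / (2 * n + 1) * (2 * n + 1)) by (field; lra).
  apply Rmult_le_compat_r; [lra|apply Rmin_r]. }
assert (H5 : norm (minus phi psi) ^ 2 < e ^ 2).
{ rewrite H2; destruct (Rle_dec n d) as [C|C]; [|nra].
  assert (d <= 1) by apply Rmin_l; nra. }
rewrite norm_minus_sym; pose proof (norm_nonneg (minus phi psi)).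
destruct (Rlt_dec (norm (minus phi psi)) e) as [H7|H7]; [exact H7|].
exfalso; assert (e ^ 2 <= norm (minus phi psi) ^ 2) by (apply pow_incr; lra); lra.
Qed.

End Truncation.

(** * Complex-valued functions of a real variable *)

Definition cderive (u : R -> C) (t : R) (d : C) : Prop :=
  is_derive (fun r => Re (u r)) t (Re d) /\ is_derive (fun r => Im (u r)) t (Im d).

Lemma cderive_ext (u v : R -> C) t d :
  (forall r, u r = v r) -> cderive u t d -> cderive v t d.
Proof.
intros H [H1 H2]; split; [revert H1|revert H2]; apply is_derive_ext; intro r; rewrite H;
  reflexivity.
Qed.

Lemma cderive_unique u t d d' : cderive u t d -> cderive u t d' -> d = d'.
Proof.
intros [H1 H2] [H1' H2']; apply is_derive_unique in H1; apply is_derive_unique in H2.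
apply is_derive_unique in H1'; apply is_derive_unique in H2'.
apply injective_projections; unfold Re, Im in *; congruence.
Qed.

Lemma cderive_const c t : cderive (fun _ => c) t 0.
Proof. split; apply (@is_derive_const R_AbsRing R_NormedModule). Qed.

Lemma cderive_plus u v t d e : cderive u t d -> cderive v t e ->
  cderive (fun r => (u r + v r)%C) t (d + e)%C.
Proof.
intros [H1 H2] [H1' H2']; split.
- exact (@is_derive_plus R_AbsRing R_NormedModule _ _ t _ _ H1 H1').
- exact (@is_derive_plus R_AbsRing R_NormedModule _ _ t _ _ H2 H2').
Qed.

Lemma is_derive_Rmult (u v : R -> R) t du dv : is_derive u t du -> is_derive v t dv ->
  is_derive (fun r => u r * v r) t (du * v t + u t * dv).
Proof. intros Hu Hv; exact (is_derive_mult u v t du dv Hu Hv Rmult_comm). Qed.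

Lemma cderive_mult u v t d e : cderive u t d -> cderive v t e ->
  cderive (fun r => (u r * v r)%C) t (d * v t + u t * e)%C.
Proof.
intros [H1 H2] [H1' H2']; split.
- replace (Re (d * v t + u t * e)) with
    ((Re d * Re (v t) + Re (u t) * Re e) - (Im d * Im (v t) + Im (u t) * Im e))
    by (unfold Re, Im; simpl; ring).
  exact (@is_derive_minus R_AbsRing R_NormedModule _ _ t _ _
    (is_derive_Rmult H1 H1') (is_derive_Rmult H2 H2')).
- replace (Im (d * v t + u t * e)) with
    ((Re d * Im (v t) + Re (u t) * Im e) + (Im d * Re (v t) + Im (u t) * Re e))
    by (unfold Re, Im; simpl; ring).
  exact (@is_derive_plus R_AbsRing R_NormedModule _ _ t _ _
    (is_derive_Rmult H1 H2') (is_derive_Rmult H2 H1')).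
Qed.

Lemma cderive_scal c u t d : cderive u t d -> cderive (fun r => (c * u r)%C) t (c * d)%C.
Proof.
intro H; replace (c * d)%C with (0 * u t + c * d)%C by ring.
exact (cderive_mult (cderive_const c t) H).
Qed.

Lemma cderive_RtoC (u : R -> R) t d : is_derive u t d -> cderive (fun r => RtoC (u r)) t (RtoC d).
Proof.
intro H; split; [exact H|].
change (is_derive (fun _ : R => 0) t (0 : R)).
exact (@is_derive_const R_AbsRing R_NormedModule 0 t).
Qed.

(** * The complex exponential *)

Definition cexp (z : C) : C := (RtoC (exp (Re z)) * cis (Im z))%C.

Lemma cexp_plus z w : cexp (z + w)%C = (cexp z * cexp w)%C.
Proof. unfold cexp; rewrite re_plus, im_plus, exp_plus, cis_plus, RtoC_mult; ring. Qed.

Lemma cexp_0 : cexp 0 = 1.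
Proof. unfold cexp; simpl; rewrite exp_0, cis_0; ring. Qed.

Lemma Cmod_cexp z : Cmod (cexp z) = exp (Re z).
Proof.
unfold cexp; rewrite Cmod_mult, Cmod_cis, Cmod_R, Rabs_pos_eq; [ring|].
left; apply exp_pos.
Qed.

Lemma cexp_conj z : Cconj (cexp z) = cexp (Cconj z).
Proof.
unfold cexp; rewrite Cmult_conj, cis_conj.
replace (Cconj (RtoC (exp (Re z)))) with (RtoC (exp (Re z))) by Ceq; reflexivity.
Qed.

Lemma cexp_real (x : R) : cexp (RtoC x) = RtoC (exp x).
Proof. unfold cexp; rewrite re_RtoC, im_RtoC, cis_0; ring. Qed.

Lemma cexp_imag (x : R) : cexp (0, x) = cis x.
Proof. unfold cexp; unfold Re, Im; simpl; rewrite exp_0; ring. Qed.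

Lemma cderive_cexp u t d : cderive u t d -> cderive (fun r => cexp (u r)) t (d * cexp (u t))%C.
Proof.
intros [H1 H2].
assert (E1 : is_derive (fun r => exp (Re (u r))) t (Re d * exp (Re (u t)))).
{ apply (@is_derive_comp R_AbsRing R_NormedModule exp (fun r => Re (u r)) t); [|exact H1].
  auto_derive; [easy|ring]. }
pose proof (is_derive_cos_comp H2) as E2; pose proof (is_derive_sin_comp H2) as E3.
assert (E4 : cderive (fun r => cis (Im (u r))) t ((0, Im d) * cis (Im (u t)))%C).
{ split; simpl.
  - replace (0 * cos (Im (u t)) - Im d * sin (Im (u t))) with (Im d * - sin (Im (u t))) by ring.
    exact E2.
  - replace (0 * sin (Im (u t)) + Im d * cos (Im (u t))) with (Im d * cos (Im (u t))) by ring.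
    exact E3. }
pose proof (cderive_mult (cderive_RtoC E1) E4) as H.
unfold cexp; match type of H with cderive _ _ ?a =>
  replace (d * (RtoC (exp (Re (u t))) * cis (Im (u t))))%C with a; [exact H|] end.
destruct d as [d1 d2]; unfold cis; apply injective_projections; simpl; ring.
Qed.

(** [z ^ n / n!]; the recursion keeps factorials out of later computations. *)
Fixpoint exp_term (z : C) (n : nat) : C :=
  match n with O => 1 | S m => (z * RtoC (/ INR (S m)) * exp_term z m)%C end.

Fixpoint exp_sum (z : C) (n : nat) : C :=
  match n with O => 1 | S m => (exp_sum z m + exp_term z (S m))%C end.

Lemma exp_term_scal t z n : exp_term (RtoC t * z)%C n = (RtoC (t ^ n) * exp_term z n)%C.
Proof.
induction n as [|n IH]; [simpl; ring|].
cbn [exp_term pow]; rewrite IH, !RtoC_mult; ring.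
Qed.

Lemma Cmod_exp_term z n : Cmod (exp_term z n) = Cmod z ^ n / INR (fact n).
Proof.
induction n as [|n IH]; [simpl; rewrite Cmod_1; field|].
cbn [exp_term]; rewrite !Cmod_mult, IH, Cmod_R, Rabs_pos_eq.
2:{ left; apply Rinv_0_lt_compat, lt_0_INR; lia. }
rewrite fact_simpl, mult_INR; simpl pow; field.
split; [apply INR_fact_neq_0|apply not_0_INR; lia].
Qed.

Lemma cderive_exp_sum z n t :
  cderive (fun r => exp_sum (RtoC r * z)%C n) t
    (match n with O => 0 | S m => (z * exp_sum (RtoC t * z)%C m)%C end).
Proof.
assert (Hterm : forall n, cderive (fun r => exp_term (RtoC r * z)%C (S n)) t
  (z * exp_term (RtoC t * z)%C n)%C).
{ intro k; apply cderive_ext with (fun r => (exp_term z (S k) * RtoC (r ^ S k))%C).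
  { intro r; rewrite exp_term_scal; ring. }
  replace (z * exp_term (RtoC t * z)%C k)%C with
    (exp_term z (S k) * RtoC (INR (S k) * t ^ k))%C.
  - apply cderive_scal, cderive_RtoC.
    replace (INR (S k) * t ^ k) with (INR (S k) * 1 * t ^ (Init.Nat.pred (S k)))
      by (cbn [Init.Nat.pred]; ring).
    exact (is_derive_pow (fun r => r) (S k) t 1 (@is_derive_id R_AbsRing t)).
  - rewrite exp_term_scal; cbn [exp_term].
    rewrite RtoC_mult, RtoC_inv by (apply not_0_INR; lia); field.
    intro H; apply RtoC_inj in H; revert H; apply not_0_INR; lia. }
induction n as [|n IH]; [exact (cderive_const 1 t)|].
cbn [exp_sum].
replace (z * exp_sum (RtoC t * z)%C n)%C with
  ((match n with O => 0 | S m => (z * exp_sum (RtoC t * z)%C m)%C end)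
   + z * exp_term (RtoC t * z)%C n)%C.
- apply cderive_plus; [exact IH|apply Hterm].
- destruct n; cbn [exp_sum]; [simpl; ring|ring].
Qed.

(** The derivative of [exp (- t z)] times the partial sum telescopes to a single term. *)
Lemma exp_sum_remainder z n :
  Cmod (cexp (- z)%C * exp_sum z n - 1)%C <= Cmod z * exp (Cmod z) * (Cmod z ^ n / INR (fact n)).
Proof.
set (g := fun r => (cexp (RtoC r * - z)%C * exp_sum (RtoC r * z)%C n)%C).
assert (Hg : forall t, cderive g t (- (z * cexp (RtoC t * - z)%C * exp_term (RtoC t * z)%C n))%C).
{ intro t.
  assert (Hl : cderive (fun r => (RtoC r * - z)%C) t (- z)%C).
  { apply cderive_ext with (fun r => (- z * RtoC r)%C); [intro; ring|].
    assert (Hid : is_derive (fun r : R => r) t 1) by exact (@is_derive_id R_AbsRing t).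
    pose proof (cderive_scal (- z)%C (cderive_RtoC Hid)) as H; rewrite Cmult_1_r in H; exact H. }
  pose proof (cderive_mult (cderive_cexp Hl) (cderive_exp_sum z n t)) as H.
  match type of H with cderive _ _ ?a =>
    replace (- (z * cexp (RtoC t * - z)%C * exp_term (RtoC t * z)%C n))%C with a;
    [exact H|] end.
  destruct n; cbn [exp_sum exp_term]; ring. }
set (w := (cexp (- z)%C * exp_sum z n - 1)%C).
set (M := Cmod z * exp (Cmod z) * (Cmod z ^ n / INR (fact n))).
assert (HM : 0 <= M).
{ unfold M; apply Rmult_le_pos; [apply Rmult_le_pos; [apply Cmod_ge_0|left; apply exp_pos]|].
  rewrite <- Cmod_exp_term; apply Cmod_ge_0. }
assert (g1 : g 1 = (w + 1)%C).
{ unfold g, w; rewrite !Cmult_1_l; ring. }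
assert (g0 : g 0 = 1).
{ unfold g; rewrite !Cmult_0_l, cexp_0.
  assert (E : exp_sum 0 n = 1); [|rewrite E; ring].
  clear; induction n as [|n IH]; [reflexivity|]; cbn [exp_sum exp_term]; rewrite IH; ring. }
assert (Hbound : forall t, 0 <= t <= 1 ->
  Cmod (- (z * cexp (RtoC t * - z)%C * exp_term (RtoC t * z)%C n))%C <= M).
{ intros t Ht; rewrite Cmod_opp, !Cmod_mult, Cmod_cexp, exp_term_scal, Cmod_mult, Cmod_exp_term.
  rewrite Cmod_R, Rabs_pos_eq by (apply pow_le; lra).
  unfold M; apply Rmult_le_compat.
  - apply Rmult_le_pos; [apply Cmod_ge_0|left; apply exp_pos].
  - rewrite <- Cmod_exp_term; apply Rmult_le_pos; [apply pow_le; lra|apply Cmod_ge_0].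
  - apply Rmult_le_compat_l; [apply Cmod_ge_0|].
    rewrite re_scal_l.
    assert (Hz : t * Re (- z)%C <= Cmod z).
    { rewrite <- (Cmod_opp z); pose proof (re_le_Cmod (- z)%C).
      pose proof (Rle_abs (Re (- z)%C)); pose proof (Rabs_pos (Re (- z)%C)); nra. }
    destruct Hz as [Hz|Hz]; [left; apply exp_increasing, Hz|rewrite Hz; right; reflexivity].
  - rewrite <- (Rmult_1_l (_ / _)) at 2; apply Rmult_le_compat_r.
    + rewrite <- Cmod_exp_term; apply Cmod_ge_0.
    + rewrite <- (pow1 n); apply pow_incr; lra. }
(* the mean value inequality for the real part of [conj w * g] *)
destruct (MVT_gen (fun r => Re (Cconj w * g r)%C) 0 1 (fun t =>
  Re (Cconj w * - (z * cexp (RtoC t * - z)%C * exp_term (RtoC t * z)%C n))%C)) as [c [Hc E]].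
- intros t _; apply (cderive_scal (Cconj w) (Hg t)).
- intros t _; apply continuity_pt_filterlim.
  exact (@is_derive_continuous R_NormedModule _ t _ (proj1 (cderive_scal (Cconj w) (Hg t)))).
- rewrite Rmin_left, Rmax_right in Hc by lra.
  rewrite g1, g0 in E.
  assert (Ew : Re (Cconj w * (w + 1))%C - Re (Cconj w * 1)%C = Cmod w ^ 2).
  { replace (Cconj w * (w + 1))%C with (w * Cconj w + Cconj w * 1)%C by ring.
    rewrite <- Cmod2_conj, re_plus, re_RtoC; ring. }
  rewrite Ew in E.
  assert (H : Cmod w ^ 2 <= Cmod w * M).
  { rewrite E, Rminus_0_r, Rmult_1_r.
    eapply Rle_trans; [apply Rle_abs|]; eapply Rle_trans; [apply re_le_Cmod|].
    rewrite Cmod_mult, Cmod_conj; apply Rmult_le_compat_l; [apply Cmod_ge_0|].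
    apply Hbound; exact Hc. }
  destruct (Req_dec (Cmod w) 0) as [E0|E0]; [lra|].
  pose proof (Cmod_ge_0 w); simpl in H; nra.
Qed.

Lemma exp_sum_cvg z e : 0 < e -> exists N, forall n, (N <= n)%nat ->
  Cmod (exp_sum z n - cexp z)%C < e.
Proof.
intro He.
set (K := exp (Re z) * (Cmod z * exp (Cmod z)) + 1).
assert (HK : 0 < K).
{ assert (0 <= exp (Re z) * (Cmod z * exp (Cmod z))); [|unfold K; lra].
  repeat apply Rmult_le_pos; try apply Cmod_ge_0; left; apply exp_pos. }
assert (He' : 0 < e / K) by (apply Rdiv_lt_0_compat; assumption).
destruct (cv_speed_pow_fact (Cmod z) _ He') as [N HN].
exists N; intros n Hn; specialize (HN n Hn); unfold Rdist in HN.
assert (Hp : 0 <= Cmod z ^ n / INR (fact n)) by (rewrite <- Cmod_exp_term; apply Cmod_ge_0).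
rewrite Rminus_0_r, Rabs_pos_eq in HN by exact Hp.
replace (exp_sum z n - cexp z)%C with (cexp z * (cexp (- z)%C * exp_sum z n - 1))%C.
2:{ replace (cexp z * (cexp (- z)%C * exp_sum z n - 1))%C
      with (cexp z * cexp (- z)%C * exp_sum z n - cexp z)%C by ring.
    rewrite <- cexp_plus; replace (z + - z)%C with (RtoC 0) by ring; rewrite cexp_0; ring. }
rewrite Cmod_mult, Cmod_cexp.
pose proof (exp_sum_remainder z n) as H.
assert (Hx := exp_pos (Re z)).
assert (H1 : exp (Re z) * Cmod (cexp (- z)%C * exp_sum z n - 1)%C <=
  exp (Re z) * (Cmod z * exp (Cmod z) * (Cmod z ^ n / INR (fact n))))
  by (apply Rmult_le_compat_l; lra).
assert (H2 : K * (Cmod z ^ n / INR (fact n)) < e).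
{ replace e with (K * (e / K)) by (field; lra); apply Rmult_lt_compat_l; lra. }
unfold K in H2; lra.
Qed.

Lemma exp_sum_real_le x n : 0 <= x -> Re (exp_sum (RtoC x) n) <= exp x.
Proof.
intro Hx.
assert (Ht : forall n, 0 <= Re (exp_term (RtoC x) n)).
{ clear n; induction n as [|n IH]; [simpl; lra|].
  cbn [exp_term]; rewrite <- RtoC_mult, re_scal_l; apply Rmult_le_pos; [|exact IH].
  apply Rmult_le_pos; [exact Hx|left; apply Rinv_0_lt_compat, lt_0_INR; lia]. }
assert (Hmono : forall m, (n <= m)%nat -> Re (exp_sum (RtoC x) n) <= Re (exp_sum (RtoC x) m)).
{ intros m Hm; induction Hm as [|m Hm IH]; [lra|].
  cbn [exp_sum]; rewrite re_plus; pose proof (Ht (S m)); lra. }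
apply le_epsilon; intros e He.
destruct (exp_sum_cvg (RtoC x) He) as [N HN].
specialize (HN (Nat.max n N) ltac:(lia)); rewrite cexp_real in HN.
pose proof (Hmono (Nat.max n N) ltac:(lia)).
pose proof (re_le_Cmod (exp_sum (RtoC x) (Nat.max n N) - RtoC (exp x))%C) as H1.
replace (Re (exp_sum (RtoC x) (Nat.max n N) - RtoC (exp x))%C)
  with (Re (exp_sum (RtoC x) (Nat.max n N)) - exp x) in H1
  by (destruct (exp_sum (RtoC x) (Nat.max n N)); simpl; ring).
pose proof (Rle_abs (Re (exp_sum (RtoC x) (Nat.max n N)) - exp x)); lra.
Qed.

(** * Exponential vectors *)

Section ExponentialVectors.

Variable h : HilbertSpace.
Notation X := (fock h).
Notation snorm := (seminorm (@tensor_inner h)).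

(** [1 / sqrt n!] *)
Fixpoint weight (n : nat) : R :=
  match n with O => 1 | S m => / sqrt (INR (S m)) * weight m end.

Fixpoint prod_amp (g : h) (l : list h) : C :=
  match l with nil => 1 | f :: l' => (inner f g * prod_amp g l')%C end.

Definition exp_amp (g : h) (l : list h) : C := (RtoC (weight (length l)) * prod_amp g l)%C.

(** The exponential vector, the sum of all [g (x) ... (x) g / sqrt k!], up to [n] particles. *)
Fixpoint exp_comb (g : h) (n : nat) : list (C * list h) :=
  match n with
  | O => (RtoC 1, nil) :: nil
  | S m => exp_comb g m ++ ((RtoC (weight (S m)), repeat g (S m)) :: nil)
  end.

Lemma sqrt_INR_S_pos n : 0 < sqrt (INR (S n)).
Proof. apply sqrt_lt_R0, lt_0_INR; lia. Qed.

Lemma sqrt_INR_S_sq n : sqrt (INR (S n)) * sqrt (INR (S n)) = INR (S n).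
Proof. apply sqrt_sqrt, pos_INR. Qed.

Lemma weight_pos n : 0 < weight n.
Proof.
induction n as [|n IH]; cbn [weight]; [lra|].
apply Rmult_lt_0_compat; [apply Rinv_0_lt_compat, sqrt_INR_S_pos|exact IH].
Qed.

Lemma prod_amp_repeat f g n :
  (RtoC (weight n) * (RtoC (weight n) * prod_amp g (repeat f n)))%C = exp_term (inner f g) n.
Proof.
induction n as [|n IH]; [simpl; ring|].
cbn [weight repeat prod_amp exp_term]; rewrite <- IH.
replace (/ INR (S n)) with (/ sqrt (INR (S n)) * / sqrt (INR (S n))).
- rewrite !RtoC_mult; ring.
- rewrite <- Rinv_mult, sqrt_INR_S_sq; reflexivity.
Qed.

Lemma prod_amp_perm g l m : Permutation l m -> prod_amp g l = prod_amp g m.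
Proof.
induction 1 as [|f l m _ IH|f k l|l m n _ IH1 _ IH2]; simpl.
- reflexivity.
- rewrite IH; reflexivity.
- ring.
- rewrite IH1; exact IH2.
Qed.

Lemma tensor_inner_repeat (g : h) l : tensor_inner l (repeat g (length l)) = prod_amp g l.
Proof. induction l as [|f l IH]; simpl; [reflexivity|rewrite IH; reflexivity]. Qed.

Lemma lin_ext_exp_comb g n l : lin_ext (tensor_inner l) (exp_comb g n) =
  if (length l <=? n)%nat then exp_amp g l else 0.
Proof.
induction n as [|n IH].
- destruct l as [|f l]; simpl; [unfold exp_amp; simpl; ring|ring].
- cbn [exp_comb]; rewrite lin_ext_app, IH; cbn [lin_ext].
  destruct (Nat.eq_dec (length l) (S n)) as [E|E].
  + replace (length l <=? n)%nat with false by (symmetry; apply Nat.leb_gt; lia).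
    replace (length l <=? S n)%nat with true by (symmetry; apply Nat.leb_le; lia).
    rewrite <- E, tensor_inner_repeat; unfold exp_amp; ring.
  + rewrite tensor_inner_length by (rewrite repeat_length; exact E).
    replace (length l <=? S n)%nat with (length l <=? n)%nat; [ring|].
    destruct (Nat.leb_spec (length l) n), (Nat.leb_spec (length l) (S n)); lia.
Qed.

Lemma antilin_exp_comb g n p : antilin_ext p (exp_comb g (S n)) =
  (antilin_ext p (exp_comb g n) + RtoC (weight (S n)) * p (repeat g (S n)))%C.
Proof.
cbn [exp_comb]; rewrite antilin_ext_app; cbn [antilin_ext]; f_equal.
replace (Cconj (RtoC (weight (S n)))) with (RtoC (weight (S n))) by Ceq; ring.
Qed.

Lemma antilin_exp_comb_0 (g : h) p : antilin_ext p (exp_comb g 0) = p nil.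
Proof. apply antilin_ext_single. Qed.

Lemma antilin_exp_amp f g n : antilin_ext (exp_amp g) (exp_comb f n) = exp_sum (inner f g) n.
Proof.
induction n as [|n IH]; [rewrite antilin_exp_comb_0; unfold exp_amp; simpl; ring|].
rewrite antilin_exp_comb, IH; cbn [exp_sum]; f_equal.
unfold exp_amp; rewrite repeat_length; apply prod_amp_repeat.
Qed.

Lemma antilin_exp_comb_ext g n p q : (forall l, (length l <= n)%nat -> p l = q l) ->
  antilin_ext p (exp_comb g n) = antilin_ext q (exp_comb g n).
Proof.
intro H; induction n as [|n IH].
- rewrite !antilin_exp_comb_0; apply H; simpl; lia.
- rewrite !antilin_exp_comb, IH by (intros l Hl; apply H; lia).
  rewrite H; [reflexivity|rewrite repeat_length; lia].
Qed.

Lemma exp_comb_seminorm g n : snorm (exp_comb g n) <= sqrt (exp (norm g ^ 2)).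
Proof.
unfold seminorm; apply sqrt_le_1_alt; unfold kernel_form.
rewrite (@antilin_exp_comb_ext g n _ (exp_amp g)).
- rewrite antilin_exp_amp, inner_norm; apply exp_sum_real_le, pow2_ge_0.
- intros l Hl; rewrite lin_ext_exp_comb; apply Nat.leb_le in Hl; rewrite Hl; reflexivity.
Qed.

Lemma exp_vector (g : h) : exists phi : X, forall l, amplitude phi l = exp_amp g l.
Proof.
apply fock_vector.
- intros l m H; unfold exp_amp; rewrite (prod_amp_perm g H), (Permutation_length H); reflexivity.
- exists (sqrt (exp (norm g ^ 2))); intro v.
  set (n := list_max (map (fun cb => length (snd cb)) v)).
  rewrite (antilin_ext_truncate (q := fun l => lin_ext (tensor_inner l) (exp_comb g n))).
  + rewrite Rmult_comm; eapply Rle_trans; [exact (kernel_form_bound v (exp_comb g n))|].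
    apply Rmult_le_compat_l; [apply seminorm_ge_0|apply exp_comb_seminorm].
  + intros l Hl; rewrite lin_ext_exp_comb; apply Nat.leb_le in Hl; fold n in Hl.
    rewrite Hl; reflexivity.
Qed.

Definition exp_vec (g : h) : X := proj1_sig (constructive_indefinite_description _ (exp_vector g)).

Lemma amplitude_exp_vec g l : amplitude (exp_vec g) l = exp_amp g l.
Proof. exact (proj2_sig (constructive_indefinite_description _ (exp_vector g)) l). Qed.

Lemma inner_exp_truncation g n psi phi : is_truncation n (exp_vec g) psi ->
  inner psi phi = pairing (exp_comb g n) phi.
Proof.
intro H; apply inner_combination; intro l.
rewrite H, amplitude_exp_vec, lin_ext_exp_comb; reflexivity.
Qed.

Lemma inner_exp_cvg g (phi : X) e : 0 < e -> exists N0, forall N, (N0 <= N)%nat ->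
  Cmod (pairing (exp_comb g N) phi - inner (exp_vec g) phi)%C < e.
Proof.
intro He.
assert (Hn : 0 < norm phi + 1) by (pose proof (norm_nonneg phi); lra).
assert (He' : 0 < e / (norm phi + 1)) by (apply Rdiv_lt_0_compat; lra).
destruct (truncation_cvg (exp_vec g) He') as [N0 HN0].
exists N0; intros N HN; destruct (truncation N (exp_vec g)) as [psi [Hpsi _]].
specialize (HN0 N psi HN Hpsi).
rewrite <- (inner_exp_truncation phi Hpsi), <- inner_minus_l.
eapply Rle_lt_trans; [apply inner_bound|].
apply Rle_lt_trans with (e / (norm phi + 1) * norm phi).
- apply Rmult_le_compat_r; [apply norm_nonneg|left; exact HN0].
- replace e with (e / (norm phi + 1) * (norm phi + 1)) at 2 by (field; lra).
  apply Rmult_lt_compat_l; lra.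
Qed.

Lemma inner_exp_eventually g (phi : X) c :
  (forall e, 0 < e -> exists N0, forall N, (N0 <= N)%nat ->
    Cmod (pairing (exp_comb g N) phi - c)%C < e) ->
  inner (exp_vec g) phi = c.
Proof.
intro H.
assert (E : (inner (exp_vec g) phi - c)%C = 0).
{ apply Cmod_small with 1; intros e He; rewrite Rmult_1_l; left; assert (He2 : 0 < e / 2) by lra.
  destruct (H _ He2) as [N1 H1]; destruct (inner_exp_cvg g phi He2) as [N2 H2].
  specialize (H1 (Nat.max N1 N2) ltac:(lia)); specialize (H2 (Nat.max N1 N2) ltac:(lia)).
  set (z := pairing (exp_comb g (Nat.max N1 N2)) phi) in *.
  replace (inner (exp_vec g) phi - c)%C with
    ((z - c) + - (z - inner (exp_vec g) phi))%C by ring.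
  eapply Rle_lt_trans; [apply Cmod_triangle|]; rewrite Cmod_opp; lra. }
replace (inner (exp_vec g) phi) with (inner (exp_vec g) phi - c + c)%C by ring.
rewrite E; ring.
Qed.

Lemma inner_exp_finite g (phi : X) n :
  (forall l, (n < length l)%nat -> amplitude phi l = 0) ->
  inner (exp_vec g) phi = pairing (exp_comb g n) phi.
Proof.
intro H; apply inner_exp_eventually; intros e He; exists n; intros N HN.
assert (E : pairing (exp_comb g N) phi = pairing (exp_comb g n) phi).
{ induction HN as [|N HN IH]; [reflexivity|].
  unfold pairing in *; rewrite antilin_exp_comb, IH, H by (rewrite repeat_length; lia); ring. }
rewrite E; replace (pairing (exp_comb g n) phi - pairing (exp_comb g n) phi)%C
  with (RtoC 0) by ring.
rewrite Cmod_0; exact He.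
Qed.

Lemma inner_exp_exp f g : inner (exp_vec f) (exp_vec g) = cexp (inner f g).
Proof.
apply inner_exp_eventually; intros e He.
destruct (exp_sum_cvg (inner f g) He) as [N HN]; exists N; intros n Hn.
unfold pairing; rewrite (antilin_ext_ext (q := exp_amp g)) by apply amplitude_exp_vec.
rewrite antilin_exp_amp; apply HN, Hn.
Qed.

(** * Totality of the exponential vectors *)

Lemma amplitude_repeat_scal (phi : X) (r : R) g n m :
  amplitude phi (repeat (cscal (RtoC r) g) n ++ m) =
  (RtoC (r ^ n) * amplitude phi (repeat g n ++ m))%C.
Proof.
revert m; induction n as [|n IH]; intro m; [simpl; ring|].
cbn [repeat app pow]; rewrite amplitude_cscal_arg.
rewrite (amplitude_perm phi (Permutation_middle (repeat (cscal (RtoC r) g) n) m g)), IH.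
rewrite <- (amplitude_perm phi (Permutation_middle (repeat g n) m g)), RtoC_mult.
replace (Cconj (RtoC r)) with (RtoC r) by Ceq; ring.
Qed.

Lemma pairing_exp_comb_scal (phi : X) (r : R) g n :
  Re (pairing (exp_comb (cscal (RtoC r) g) n) phi) =
  sum_n (fun k => scal (pow_n r k) (weight k * Re (amplitude phi (repeat g k)))) n.
Proof.
assert (Hk : forall k, Re (RtoC (weight k) * amplitude phi (repeat (cscal (RtoC r) g) k))%C =
  scal (pow_n r k) (weight k * Re (amplitude phi (repeat g k)))).
{ intro k; rewrite pow_n_pow.
  change (Re (RtoC (weight k) * amplitude phi (repeat (cscal (RtoC r) g) k))%C =
    r ^ k * (weight k * Re (amplitude phi (repeat g k)))).
  rewrite <- (app_nil_r (repeat (cscal (RtoC r) g) k)), amplitude_repeat_scal, app_nil_r.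
  rewrite !re_scal_l; ring. }
induction n as [|n IH].
- rewrite sum_O, <- Hk; unfold pairing; rewrite antilin_exp_comb_0.
  cbn [weight repeat]; rewrite Cmult_1_l; reflexivity.
- rewrite sum_Sn, <- IH, <- Hk; unfold pairing; rewrite antilin_exp_comb; apply re_plus.
Qed.

Lemma pseries_zero (a : nat -> R) : (forall r, is_pseries a r 0) -> forall n, a n = 0.
Proof.
intros H n.
assert (Hex : forall b, (forall r, is_pseries b r 0) -> Rbar_lt 0 (CV_radius b)).
{ intros b Hb; apply Rbar_lt_le_trans with (Finite 1); [simpl; lra|].
  apply (proj1 (CV_radius_bounded b)).
  destruct (filterlim_bounded (K := R_AbsRing) (V := R_NormedModule) b) as [M HM].
  - exists 0; apply ex_series_lim_0; exists 0.
    apply (is_series_ext (fun k => scal (pow_n 1 k) (b k))); [|exact (Hb 1)].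
    intro k; rewrite pow_n_pow, pow1; apply (scal_one (b k)).
  - exists M; intro k; rewrite pow1, Rmult_1_r; exact (HM k). }
assert (H0 : forall r, is_pseries (fun _ => 0) r 0).
{ intro r; apply (is_series_ext (fun _ => 0)).
  - intro k; symmetry; apply (@scal_zero_r R_Ring R_ModuleSpace).
  - apply filterlim_ext with (fun _ : nat => 0); [|apply filterlim_const].
    intro k; induction k as [|k IH]; [rewrite sum_O; reflexivity|].
    rewrite sum_Sn, <- IH; symmetry; exact (Rplus_0_l 0). }
apply (PSeries_ext_recip a (fun _ => 0) n); [apply Hex, H|apply Hex, H0|].
apply filter_forall; intro r.
rewrite (is_pseries_unique _ _ _ (H r)), (is_pseries_unique _ _ _ (H0 r)); reflexivity.
Qed.

(** Scaling [g] by [r] turns [<exp g, phi>] into a power series in [r] with these amplitudes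
    as coefficients, up to positive factors. *)
Lemma exp_total_diagonal (phi : X) : (forall g, inner (exp_vec g) phi = 0) ->
  forall g n, amplitude phi (repeat g n) = 0.
Proof.
assert (Hre : forall phi : X, (forall g, inner (exp_vec g) phi = 0) ->
  forall g n, Re (amplitude phi (repeat g n)) = 0).
{ clear phi; intros phi H g n.
  pose proof (@pseries_zero (fun k => weight k * Re (amplitude phi (repeat g k)))) as Hz.
  assert (E : weight n * Re (amplitude phi (repeat g n)) = 0).
  { apply Hz; intro r; unfold is_pseries, is_series.
    refine (filterlim_R_intro _); intros e He.
    destruct (inner_exp_cvg (cscal (RtoC r) g) phi He) as [N HN].
    exists N; intros k Hk; specialize (HN k Hk).
    rewrite H in HN; rewrite <- pairing_exp_comb_scal, Rminus_0_r.
    eapply Rle_lt_trans; [apply re_le_Cmod|].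
    replace (pairing (exp_comb (cscal (RtoC r) g) k) phi) with
      (pairing (exp_comb (cscal (RtoC r) g) k) phi - 0)%C by ring.
    exact HN. }
  pose proof (weight_pos n); apply Rmult_integral in E; destruct E as [E|E]; [lra|exact E]. }
intros H g n.
assert (H1 : forall g, inner (exp_vec g) (cscal Ci phi) = 0).
{ intro g'; rewrite inner_cscal_r, H; ring. }
pose proof (Hre phi H g n) as E1; pose proof (Hre _ H1 g n) as E2.
rewrite amplitude_cscal in E2.
destruct (amplitude phi (repeat g n)) as [a b]; unfold Re in E1, E2; simpl in E1, E2.
apply injective_projections; simpl; lra.
Qed.

(** Polarization by differentiation: diagonal values of a symmetric antilinear form
    determine the others. *)
Lemma cderive_amplitude (phi : X) (f g : h) l n :
  cderive (fun r => amplitude phi (l ++ @repeat h (plus g (cscal (RtoC r) f)) n)) 0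
    (RtoC (INR n) * amplitude phi (l ++ f :: repeat g (Init.Nat.pred n)))%C.
Proof.
revert l; induction n as [|n IH]; intro l.
- replace (RtoC (INR 0) * amplitude phi (l ++ f :: repeat g (Init.Nat.pred 0)))%C with (RtoC 0)
    by (simpl; ring).
  exact (cderive_const (amplitude phi (l ++ nil)) 0).
- set (gr := fun r => (plus g (cscal (RtoC r) f) : h)).
  apply cderive_ext with (fun r => (amplitude phi ((g :: l) ++ repeat (gr r) n)
    + RtoC r * amplitude phi ((f :: l) ++ repeat (gr r) n))%C).
  { intro r; change (amplitude phi ((g :: l) ++ repeat (gr r) n)
      + RtoC r * amplitude phi ((f :: l) ++ repeat (gr r) n)
      = amplitude phi (l ++ gr r :: repeat (gr r) n))%C.
    rewrite <- (amplitude_perm phi (Permutation_middle l (repeat (gr r) n) (gr r))).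
    unfold gr at 3; rewrite amplitude_plus_arg, amplitude_cscal_arg.
    replace (Cconj (RtoC r)) with (RtoC r) by Ceq; reflexivity. }
  assert (Hid : is_derive (fun r : R => r) 0 1) by exact (@is_derive_id R_AbsRing 0).
  pose proof (cderive_plus (IH (g :: l)) (cderive_mult (cderive_RtoC Hid) (IH (f :: l)))) as H.
  cbv beta in H.
  match type of H with cderive _ _ ?a =>
    replace (RtoC (INR (S n)) * amplitude phi (l ++ f :: repeat g (Init.Nat.pred (S n))))%C
      with a; [exact H|] end.
  assert (E0 : plus g (cscal (RtoC 0) f) = g) by vec.
  rewrite E0; cbn [Init.Nat.pred].
  assert (E1 : amplitude phi ((f :: l) ++ repeat g n) = amplitude phi (l ++ f :: repeat g n))
    by (apply amplitude_perm, Permutation_middle).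
  rewrite E1, S_INR, RtoC_plus.
  destruct n as [|n]; [simpl INR; ring|]; cbn [Init.Nat.pred].
  assert (E2 : amplitude phi ((g :: l) ++ f :: repeat g n) =
    amplitude phi (l ++ f :: repeat g (S n))).
  { apply amplitude_perm; cbn [repeat].
    transitivity (l ++ g :: f :: repeat g n); [apply Permutation_middle|].
    apply Permutation_app_head, perm_swap. }
  rewrite E2; ring.
Qed.

Lemma exp_total (phi : X) : (forall g, inner (exp_vec g) phi = 0) -> phi = zero.
Proof.
intro H; pose proof (exp_total_diagonal H) as Hd.
assert (Hgen : forall l n g, amplitude phi (l ++ repeat g n) = 0).
{ induction l as [|f l IH]; intros n g; [apply Hd|].
  pose proof (cderive_amplitude phi f g l (S n)) as D.
  assert (D0 : cderive (fun r => amplitude phi (l ++ @repeat h (plus g (cscal (RtoC r) f)) (S n)))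
    0 0).
  { apply cderive_ext with (fun _ => RtoC 0); [intro r; symmetry; apply IH|].
    apply cderive_const. }
  pose proof (cderive_unique D D0) as E; cbn [Init.Nat.pred] in E.
  transitivity (amplitude phi (l ++ f :: repeat g n));
    [apply amplitude_perm, Permutation_middle|].
  assert (Hn : RtoC (INR (S n)) <> 0).
  { intro E0; apply RtoC_inj in E0; revert E0; apply not_0_INR; lia. }
  transitivity (/ RtoC (INR (S n)) * (RtoC (INR (S n)) * amplitude phi (l ++ f :: repeat g n)))%C;
    [field; exact Hn|rewrite E; ring]. }
apply fock_eq; intro l; rewrite <- (app_nil_r l); exact (Hgen l O zero).
Qed.

End ExponentialVectors.

(** * Total families in a Hilbert space *)

Section TotalFamilies.

Variables (X : HilbertSpace) (B : Type).
Implicit Types (x y z : X) (u v : list (C * B)).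

Lemma comb_app (e : B -> X) u v : comb e (u ++ v) = plus (comb e u) (comb e v).
Proof.
induction u as [|[c b] u IH]; simpl; [rewrite plus_zero_l; reflexivity|].
rewrite IH; vec.
Qed.

Lemma comb_comb_scal (e : B -> X) c v : comb e (comb_scal c v) = cscal c (comb e v).
Proof. induction v as [|[a b] v IH]; simpl; [vec|rewrite IH; vec]. Qed.

Lemma quadratic_min a b : (forall t, 0 <= 2 * t * a + t ^ 2 * b) -> a = 0.
Proof.
intro H; destruct (Req_dec a 0) as [E|E]; [exact E|exfalso].
pose proof (H (- a / (Rabs b + 1))) as H1.
assert (Hb : 0 < Rabs b + 1) by (pose proof (Rabs_pos b); lra).
apply (Rmult_le_compat_r ((Rabs b + 1) ^ 2)) in H1; [|apply pow2_ge_0].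
replace ((2 * (- a / (Rabs b + 1)) * a + (- a / (Rabs b + 1)) ^ 2 * b) * (Rabs b + 1) ^ 2)
  with (- a ^ 2 * (2 * (Rabs b + 1) - b)) in H1 by (field; lra).
assert (Ha : 0 < a ^ 2) by (rewrite <- (pow2_abs a); apply pow_lt, Rabs_pos_lt, E).
pose proof (Rle_abs b); nra.
Qed.

(** The point of the closed span nearest to [x] differs from [x] by a vector orthogonal to
    the family; the parallelogram law makes minimizing combinations a Cauchy filter. *)
Lemma total_dense (e : B -> X) : (forall x, (forall b, inner (e b) x = 0) -> x = zero) ->
  forall x d, 0 < d -> exists v, norm (minus (comb e v) x) < d.
Proof.
intros Htot x.
destruct (completeness (fun r => exists v, r = - norm (minus (comb e v) x))) as [m [Hm1 Hm2]].
{ exists 0; intros r [v ->]; pose proof (norm_nonneg (minus (comb e v) x)); lra. }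
{ exists (- norm (minus (comb e nil) x)), nil; reflexivity. }
set (d := - m).
assert (Hd : forall v, d <= norm (minus (comb e v) x)).
{ intro v; pose proof (Hm1 _ (ex_intro _ v eq_refl)); unfold d; lra. }
assert (Hd0 : 0 <= d).
{ assert (m <= 0); [|unfold d; lra].
  apply Hm2; intros r [v ->]; pose proof (norm_nonneg (minus (comb e v) x)); lra. }
assert (Happ : forall eta, 0 < eta -> exists v, norm (minus (comb e v) x) < d + eta).
{ intros eta He; destruct (Classical_Prop.classic
    (exists v, norm (minus (comb e v) x) < d + eta)) as [H|H]; [exact H|exfalso].
  assert (m <= m - eta); [|lra].
  apply Hm2; intros r [v ->].
  destruct (Rlt_dec (norm (minus (comb e v) x)) (d + eta)); [exfalso; eauto|].
  unfold d in *; lra. }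
assert (Hpar : forall eta u v, norm (minus (comb e u) x) < d + eta ->
  norm (minus (comb e v) x) < d + eta ->
  norm (minus (comb e u) (comb e v)) ^ 2 <= 8 * d * eta + 4 * eta ^ 2).
{ intros eta u v Hu Hv.
  pose proof (norm_sq_minus (minus (comb e u) x) (minus (comb e v) x)) as P2.
  assert (E2 : minus (minus (comb e u) x) (minus (comb e v) x) = minus (comb e u) (comb e v))
    by vec.
  assert (E1 : plus (minus (comb e u) x) (minus (comb e v) x) =
    scal 2 (minus (comb e (comb_scal (RtoC (1 / 2)) (u ++ v))) x)).
  { rewrite comb_comb_scal, comb_app; apply inner_ext; intro a; repeat progress inner_simpl.
    destruct (inner a (comb e u)), (inner a (comb e v)), (inner a x).
    apply injective_projections; simpl; field. }
  assert (P1 : norm (plus (minus (comb e u) x) (minus (comb e v) x)) ^ 2 =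
    norm (minus (comb e u) x) ^ 2 + 2 * re (minus (comb e u) x) (minus (comb e v) x)
    + norm (minus (comb e v) x) ^ 2) by exact (norm_sq_plus _ _).
  rewrite E1, norm_rscal, Rabs_pos_eq in P1 by lra; rewrite E2 in P2.
  pose proof (Hd (comb_scal (RtoC (1 / 2)) (u ++ v))) as H.
  set (a := norm (minus (comb e (comb_scal (RtoC (1 / 2)) (u ++ v))) x)) in *.
  assert (d ^ 2 <= a ^ 2) by (apply pow_incr; lra).
  pose proof (norm_nonneg (minus (comb e u) x)); pose proof (norm_nonneg (minus (comb e v) x)).
  assert (norm (minus (comb e u) x) ^ 2 <= (d + eta) ^ 2) by (apply pow_incr; lra).
  assert (norm (minus (comb e v) x) ^ 2 <= (d + eta) ^ 2) by (apply pow_incr; lra).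
  rewrite Rpow_mult_distr in P1; nra. }
destruct (@shrinking_limit X _ (comb e) (fun eta v => norm (minus (comb e v) x) < d + eta))
  as [p Hp].
{ intros a b v Hab Hv; lra. }
{ exact Happ. }
{ intros eps Heps.
  set (eta := Rmin 1 (eps ^ 2 / (8 * d + 5))).
  assert (Hsq : 0 < eps ^ 2) by (apply pow_lt, Heps).
  assert (He : 0 < eta) by (apply Rmin_pos; [lra|apply Rdiv_lt_0_compat; lra]).
  assert (He1 : eta <= 1) by apply Rmin_l.
  assert (He2 : eta * (8 * d + 5) <= eps ^ 2).
  { replace (eps ^ 2) with (eps ^ 2 / (8 * d + 5) * (8 * d + 5)) by (field; lra).
    apply Rmult_le_compat_r; [lra|apply Rmin_r]. }
  exists eta; split; [exact He|]; intros u v Hu Hv.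
  pose proof (Hpar eta u v Hu Hv) as H; pose proof (norm_nonneg (minus (comb e u) (comb e v))).
  destruct (Rlt_dec (norm (minus (comb e u) (comb e v))) eps) as [L|L]; [exact L|exfalso].
  assert (eps ^ 2 <= norm (minus (comb e u) (comb e v)) ^ 2) by (apply pow_incr; lra).
  nra. }
assert (Hpx : norm (minus p x) <= d).
{ apply le_epsilon; intros eta He; assert (He2 : 0 < eta / 2) by lra.
  destruct (Hp _ He2) as [v [H2 H1]].
  pose proof (norm_minus_triangle p (comb e v) x) as T.
  rewrite (norm_minus_sym p (comb e v)) in T; lra. }
assert (Hmin : forall y v, y = comb e v -> d <= norm (minus (plus p y) x)).
{ intros y w ->; apply le_epsilon; intros eta He.
  destruct (Hp _ He) as [v [_ H1]].
  pose proof (Hd (v ++ w)) as H; rewrite comb_app in H.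
  pose proof (norm_minus_triangle (plus (comb e v) (comb e w)) (plus p (comb e w)) x) as T.
  replace (minus (plus (comb e v) (comb e w)) (plus p (comb e w)))
    with (minus (comb e v) p) in T by vec.
  lra. }
assert (Horth : forall b, inner (e b) (minus p x) = 0).
{ intro b; rewrite <- (inner_zero_l (minus p x)).
  apply inner_eq_of_re; intro c; unfold re at 2; rewrite inner_zero_l; simpl.
  rewrite re_sym; unfold re; rewrite inner_cscal_l, <- inner_cscal_r.
  fold (re (minus p x) (cscal (Cconj c) (e b))).
  apply quadratic_min with (norm (cscal (Cconj c) (e b)) ^ 2); intro t.
  pose proof (Hmin _ ((RtoC t * Cconj c, b) :: nil)%C eq_refl) as H; cbn [comb] in H.
  replace (minus (plus p (plus (cscal (RtoC t * Cconj c)%C (e b)) zero)) x)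
    with (plus (minus p x) (scal t (cscal (Cconj c) (e b)))) in H by vec.
  assert (H2 : norm (minus p x) ^ 2 <=
    norm (plus (minus p x) (scal t (cscal (Cconj c) (e b)))) ^ 2).
  { apply pow_incr; split; [apply norm_nonneg|lra]. }
  rewrite norm_sq_plus, re_scal_right, norm_rscal, Rpow_mult_distr, pow2_abs in H2; lra. }
assert (Ex : p = x).
{ apply norm_minus_eq; rewrite (Htot _ Horth), norm_zero'; lra. }
intros eta He; destruct (Hp eta He) as [v [_ H]]; exists v; rewrite <- Ex; exact H.
Qed.

(** The correspondence [comb e v |-> comb e' v] preserves norms, so that the closure of its
    graph is a function, defined everywhere by density and completeness. *)
Lemma isometric_extension (e e' : B -> X) :
  (forall a b, inner (e' a) (e' b) = inner (e a) (e b)) ->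
  (forall x d, 0 < d -> exists v, norm (minus (comb e v) x) < d) ->
  exists V : X -> X,
    (forall x y, V (plus x y) = plus (V x) (V y)) /\
    (forall (c : C) x, V (cscal c x) = cscal c (V x)) /\
    (forall x, norm (V x) = norm x) /\
    forall b, V (e b) = e' b.
Proof.
intros Hin Hdense.
assert (Hcomb : forall u v, inner (comb e' u) (comb e' v) = inner (comb e u) (comb e v)).
{ assert (H1 : forall a v, inner (e' a) (comb e' v) = inner (e a) (comb e v)).
  { intros a v; induction v as [|[c b] v IH]; simpl; [rewrite !inner_zero_r; reflexivity|].
    rewrite !inner_plus_r, !inner_cscal_r, Hin, IH; reflexivity. }
  intros u v; induction u as [|[c b] u IH]; simpl; [rewrite !inner_zero_l; reflexivity|].
  rewrite !inner_plus_l, !inner_cscal_l, H1, IH; reflexivity. }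
assert (Hnorm : forall v, norm (comb e' v) = norm (comb e v)).
{ intro v; apply Rsqr_inj; try apply norm_nonneg.
  rewrite !Rsqr_pow2, !norm_sq; unfold re; rewrite Hcomb; reflexivity. }
assert (Hdiff : forall u v, norm (minus (comb e' u) (comb e' v)) = norm (minus (comb e u) (comb e v))).
{ intros u v; pose proof (Hnorm (u ++ comb_scal (RtoC (-1)) v)) as H.
  rewrite !comb_app, !comb_comb_scal in H.
  replace (minus (comb e' u) (comb e' v)) with (plus (comb e' u) (cscal (RtoC (-1)) (comb e' v)))
    by (rewrite <- opp_cscal; reflexivity).
  replace (minus (comb e u) (comb e v)) with (plus (comb e u) (cscal (RtoC (-1)) (comb e v)))
    by (rewrite <- opp_cscal; reflexivity).
  exact H. }
set (T := fun x y => exists v, x = comb e v /\ y = comb e' v).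
set (R0 := op_closure T : X -> X -> Prop).
assert (Rplus0 : forall x y x' y', R0 x y -> R0 x' y' -> R0 (plus x x') (plus y y')).
{ apply op_closure_plus; intros x y x' y' [v [-> ->]] [v' [-> ->]].
  exists (v ++ v'); rewrite !comb_app; auto. }
assert (Rscal0 : forall (c : C) x y, R0 x y -> R0 (cscal c x) (cscal c y)).
{ apply op_closure_cscal; intros c x y [v [-> ->]].
  exists (comb_scal c v); rewrite !comb_comb_scal; auto. }
assert (Rnorm : forall x y, R0 x y -> norm y = norm x).
{ intros x y H.
  assert (Hle : forall d, 0 < d -> Rabs (norm y - norm x) <= 2 * d).
  { intros d Hd; destruct (H d Hd) as [x' [y' [[v [-> ->]] [H1 H2]]]]; pose proof (Hnorm v) as Hv.
    pose proof (norm_minus_triangle y (comb e' v) zero) as T1.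
    pose proof (norm_minus_triangle (comb e' v) y zero) as T2.
    pose proof (norm_minus_triangle x (comb e v) zero) as T3.
    pose proof (norm_minus_triangle (comb e v) x zero) as T4.
    assert (Ez : forall z, minus z zero = z) by (intro z; vec).
    rewrite !Ez in *.
    rewrite (norm_minus_sym y (comb e' v)) in T1; rewrite (norm_minus_sym x (comb e v)) in T3.
    apply Rabs_le; lra. }
  destruct (Req_dec (norm y) (norm x)) as [E|E]; [exact E|exfalso].
  assert (Hp : 0 < Rabs (norm y - norm x)) by (apply Rabs_pos_lt; lra).
  pose proof (Hle (Rabs (norm y - norm x) / 4) ltac:(lra)); lra. }
assert (Runique : forall x y y', R0 x y -> R0 x y' -> y = y').
{ intros x y y' H H'.
  pose proof (Rnorm _ _ (Rplus0 _ _ _ _ H (Rscal0 (RtoC (-1)) _ _ H'))) as E.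
  apply norm_minus_eq.
  replace (minus y y') with (plus y (cscal (RtoC (-1)) y')) by (rewrite <- opp_cscal; reflexivity).
  rewrite E; replace (plus x (cscal (RtoC (-1)) x)) with (minus x x)
    by (rewrite <- opp_cscal; reflexivity).
  rewrite minus_self, norm_zero'; lra. }
assert (Rtotal : forall x, exists y, R0 x y).
{ intro x.
  destruct (@shrinking_limit X _ (comb e') (fun d v => norm (minus (comb e v) x) < d)) as [y Hy].
  - intros a b v Hab Hv; lra.
  - exact (Hdense x).
  - intros eps Heps; exists (eps / 2); split; [lra|]; intros u v Hu Hv; rewrite Hdiff.
    pose proof (norm_minus_triangle (comb e u) x (comb e v)) as Tr.
    rewrite (norm_minus_sym x (comb e v)) in Tr; lra.
  - exists y; intros d Hd; destruct (Hy d Hd) as [v [H1 H2]].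
    exists (comb e v), (comb e' v); split; [exists v; auto|auto]. }
set (V := fun x => proj1_sig (constructive_indefinite_description _ (Rtotal x))).
assert (HV : forall x, R0 x (V x))
  by (intro x; exact (proj2_sig (constructive_indefinite_description _ (Rtotal x)))).
exists V; split; [|split; [|split]].
- intros x y; apply (Runique (plus x y)); [apply HV|apply Rplus0; apply HV].
- intros c x; apply (Runique (cscal c x)); [apply HV|apply Rscal0, HV].
- intro x; apply Rnorm, HV.
- intro b; apply (Runique (e b)); [apply HV|].
  apply op_closure_incl; exists ((RtoC 1, b) :: nil); cbn [comb]; split; vec.
Qed.

Lemma isometry_ext (e : B -> X) (S T : X -> X) :
  (forall x d, 0 < d -> exists v, norm (minus (comb e v) x) < d) ->
  (forall x y, S (plus x y) = plus (S x) (S y)) ->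
  (forall (c : C) x, S (cscal c x) = cscal c (S x)) ->
  (forall x, norm (S x) = norm x) ->
  (forall x y, T (plus x y) = plus (T x) (T y)) ->
  (forall (c : C) x, T (cscal c x) = cscal c (T x)) ->
  (forall x, norm (T x) = norm x) ->
  (forall b, S (e b) = T (e b)) -> forall x, S x = T x.
Proof.
intros Hd Sp Ss Sn Tp Ts Tn H x.
assert (Hminus : forall V : X -> X, (forall x y, V (plus x y) = plus (V x) (V y)) ->
  (forall (c : C) x, V (cscal c x) = cscal c (V x)) ->
  forall x y, minus (V x) (V y) = V (minus x y)).
{ intros V Vp Vs y z; unfold minus; rewrite Vp, !opp_cscal, Vs; reflexivity. }
assert (Hcomb : forall v, S (comb e v) = T (comb e v)).
{ assert (S0 : S zero = zero) by (apply norm_zero_eq; rewrite Sn; apply norm_zero').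
  assert (T0 : T zero = zero) by (apply norm_zero_eq; rewrite Tn; apply norm_zero').
  induction v as [|[c b] v IH]; simpl; [rewrite S0, T0; reflexivity|].
  rewrite Sp, Tp, Ss, Ts, H, IH; reflexivity. }
apply norm_minus_eq; apply le_epsilon; intros eps Heps; rewrite Rplus_0_l.
assert (He2 : 0 < eps / 2) by lra; destruct (Hd x _ He2) as [v Hv].
pose proof (norm_minus_triangle (S x) (S (comb e v)) (T x)) as Tr.
rewrite (Hcomb v) in Tr at 2.
rewrite (Hminus S Sp Ss), (Hminus T Tp Ts), Sn, Tn, (norm_minus_sym x (comb e v)) in Tr.
lra.
Qed.

End TotalFamilies.

(** * The Weyl system of Fock space *)

Section FockWeyl.

Variable h : HilbertSpace.
Notation X := (fock h).
Implicit Types (f g F G P : h).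

(** [i / sqrt 2]: the Weyl operator of [P] maps the vacuum to a multiple of the exponential
    vector of [i P / sqrt 2]. *)
Definition iroot : C := (0, / sqrt 2).

Lemma inv_sqrt2_sq : / sqrt 2 * / sqrt 2 = / 2.
Proof. rewrite <- Rinv_mult, sqrt_sqrt; lra. Qed.

Lemma iroot_conj : Cconj iroot = (- iroot)%C.
Proof. apply injective_projections; simpl; ring. Qed.

Lemma iroot_sq : (iroot * iroot)%C = RtoC (- / 2).
Proof.
unfold iroot; apply injective_projections; simpl; [|ring].
pose proof inv_sqrt2_sq; lra.
Qed.

Lemma iroot_neq_0 : iroot <> 0.
Proof.
intro H; injection H; intro E; pose proof (Rlt_sqrt2_0).
apply (Rinv_neq_0_compat (sqrt 2)) in E; [exact E|lra].
Qed.

(** The vector [W(P) vacuum], obtained before [W] itself. *)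
Definition displaced_vac P : X :=
  cscal (RtoC (exp (- (norm P ^ 2 / 4)))) (exp_vec (cscal iroot P)).

Lemma inner_displaced F G : inner (displaced_vac F) (displaced_vac G) =
  cexp (RtoC (- (norm F ^ 2 / 4) - norm G ^ 2 / 4) + RtoC (/ 2) * inner F G)%C.
Proof.
unfold displaced_vac; rewrite inner_cscal_l, inner_cscal_r, inner_exp_exp.
rewrite inner_cscal_l, inner_cscal_r.
replace (Cconj (RtoC (exp (- (norm F ^ 2 / 4))))) with (cexp (RtoC (- (norm F ^ 2 / 4))))
  by (rewrite cexp_real; Ceq).
rewrite <- cexp_real, <- !cexp_plus; f_equal.
replace (Cconj iroot * (iroot * inner F G))%C with (- (iroot * iroot) * inner F G)%C
  by (rewrite iroot_conj; ring).
rewrite iroot_sq; destruct (inner F G); apply injective_projections; simpl; field.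
Qed.

Lemma displaced_translate F P Q :
  inner (cscal (cis (- (1 / 2) * symp F P)) (displaced_vac (plus F P)))
    (cscal (cis (- (1 / 2) * symp F Q)) (displaced_vac (plus F Q)))
  = inner (displaced_vac P) (displaced_vac Q).
Proof.
rewrite inner_cscal_l, inner_cscal_r, !inner_displaced, cis_conj, <- !cexp_imag, <- !cexp_plus.
f_equal; rewrite !norm_sq_plus; unfold symp, re.
rewrite inner_plus_l, !inner_plus_r, inner_norm, (inner_conj F P).
destruct (inner F P), (inner F Q), (inner P Q); unfold Re, Im, Cconj.
apply injective_projections; simpl; field.
Qed.

Lemma displaced_total (x : X) : (forall P, inner (displaced_vac P) x = 0) -> x = zero.
Proof.
intro H; apply exp_total; intro g.
pose proof (H (cscal (/ iroot)%C g)) as E; unfold displaced_vac in E.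
rewrite inner_cscal_l, cscal_assoc in E.
replace (iroot * / iroot)%C with (RtoC 1) in E by (field; exact iroot_neq_0).
replace (cscal 1 g) with g in E by vec.
set (r := exp (- (norm (cscal (/ iroot)%C g) ^ 2 / 4))) in E.
assert (Hr : RtoC r <> 0)
  by (intro H0; apply RtoC_inj in H0; pose proof (exp_pos (- (norm (cscal (/ iroot)%C g) ^ 2 / 4)));
      unfold r in H0; lra).
replace (Cconj (RtoC r)) with (RtoC r) in E by Ceq.
replace (inner (exp_vec g) x) with (/ RtoC r * (RtoC r * inner (exp_vec g) x))%C
  by (field; exact Hr).
rewrite E; ring.
Qed.

(** * One-particle vectors *)

Lemma one_particle_exists f : exists phi : X, forall l, amplitude phi l = tensor_inner l (f :: nil).
Proof.
assert (E : forall l, tensor_inner l (f :: nil) =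
  lin_ext (tensor_inner l) ((RtoC 1, f :: nil) :: nil)) by (intro l; cbn [lin_ext]; ring).
apply fock_vector.
- intros l m H; destruct l as [|g [|g' l]].
  + apply Permutation_nil in H; rewrite H; reflexivity.
  + apply Permutation_length_1_inv in H; rewrite H; reflexivity.
  + rewrite !tensor_inner_length; [reflexivity| |]; [rewrite <- (Permutation_length H)|];
      simpl; lia.
- exists (seminorm (@tensor_inner h) ((RtoC 1, f :: nil) :: nil)); intro v.
  rewrite (antilin_ext_ext (q := fun l => lin_ext (tensor_inner l) ((RtoC 1, f :: nil) :: nil)))
    by exact E.
  rewrite Rmult_comm; apply kernel_form_bound.
Qed.

Definition one_particle f : X :=
  proj1_sig (constructive_indefinite_description _ (one_particle_exists f)).

Lemma amplitude_one_particle f l : amplitude (one_particle f) l = tensor_inner l (f :: nil).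
Proof. exact (proj2_sig (constructive_indefinite_description _ (one_particle_exists f)) l). Qed.

Lemma one_particle_combination f : norm (one_particle f) = norm f /\
  forall phi, inner (one_particle f) phi = amplitude phi (f :: nil).
Proof.
destruct (@inner_combination h (one_particle f) ((RtoC 1, f :: nil) :: nil)) as [H1 H2].
- intro l; rewrite amplitude_one_particle; cbn [lin_ext]; ring.
- split.
  + rewrite H1; unfold seminorm, kernel_form; cbn [lin_ext antilin_ext tensor_inner].
    rewrite inner_norm.
    replace (Cconj 1 * (1 * (RtoC (norm f ^ 2) * 1) + 0) + 0)%C with (RtoC (norm f ^ 2)) by Ceq.
    rewrite re_RtoC; apply sqrt_pow2, norm_nonneg.
  + intro phi; rewrite H2; apply antilin_ext_single.
Qed.

Definition fock_vac_field f : X := cscal iroot (one_particle f).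

Lemma tensor_inner_one l f : tensor_inner l (f :: nil) =
  match l with g :: nil => inner g f | _ => 0 end.
Proof. destruct l as [|g [|g' l]]; simpl; ring. Qed.

Lemma norm_fock_vac_field f : norm (fock_vac_field f) = / sqrt 2 * norm f.
Proof.
unfold fock_vac_field; rewrite norm_cscal, (proj1 (one_particle_combination f)); f_equal.
unfold iroot, Cmod; simpl.
replace (0 * (0 * 1) + / sqrt 2 * (/ sqrt 2 * 1)) with ((/ sqrt 2) ^ 2) by ring.
apply sqrt_pow2; left; apply Rinv_0_lt_compat, Rlt_sqrt2_0.
Qed.

Lemma fock_vac_field_linear : is_linear fock_vac_field.
Proof.
apply is_linear_intro with 1.
- intros f g; apply fock_eq; intro l; unfold fock_vac_field.
  rewrite amplitude_plus, !amplitude_cscal, !amplitude_one_particle, !tensor_inner_one.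
  destruct l as [|k [|k' l]]; try ring.
  transitivity (iroot * (inner k f + inner k g))%C; [|ring].
  f_equal; exact (inner_plus_r k f g).
- intros r f; apply fock_eq; intro l; unfold fock_vac_field.
  change (amplitude (cscal iroot (one_particle (scal r f))) l =
    amplitude (scal r (cscal iroot (one_particle f))) l).
  rewrite amplitude_scal, !amplitude_cscal, !amplitude_one_particle, !tensor_inner_one.
  destruct l as [|k [|k' l]]; try ring.
  rewrite inner_scal_r; ring.
- intro f.
  change (norm (fock_vac_field f) <= 1 * norm f); rewrite norm_fock_vac_field.
  pose proof (norm_nonneg f); pose proof (Rlt_sqrt2_0).
  assert (/ sqrt 2 <= 1).
  { rewrite <- Rinv_1; apply Rinv_le_contravar; [lra|].
    rewrite <- sqrt_1; apply sqrt_le_1_alt; lra. }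
  nra.
Qed.

Lemma norm_displaced P : norm (displaced_vac P) ^ 2 = 1.
Proof.
rewrite norm_sq; unfold re; rewrite inner_displaced, inner_norm.
rewrite <- RtoC_mult, <- RtoC_plus, cexp_real, re_RtoC.
replace (_ + _) with 0 by field; apply exp_0.
Qed.

(** All inner products are explicit; with [n = |d|^2] the squared error is
    [2 + n / 2 - (2 + n) exp (- n / 4)], at most [n^2 / 4]. *)
Lemma fock_vac_field_approx d :
  norm (minus (minus (displaced_vac d) (displaced_vac zero)) (fock_vac_field d)) <= norm d ^ 2.
Proof.
set (n := norm d ^ 2).
assert (Hn : 0 <= n) by apply pow2_ge_0.
assert (E1 : re (displaced_vac d) (displaced_vac zero) = exp (- (n / 4))).
{ unfold re; rewrite inner_displaced, inner_zero_r, norm_zero'.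
  replace (RtoC (- (norm d ^ 2 / 4) - 0 ^ 2 / 4) + RtoC (/ 2) * 0)%C
    with (RtoC (- (n / 4))) by (unfold n; apply injective_projections; simpl; field).
  rewrite cexp_real; reflexivity. }
assert (E2 : re (displaced_vac d) (fock_vac_field d) = n / 2 * exp (- (n / 4))).
{ rewrite re_sym; unfold re, fock_vac_field.
  rewrite inner_cscal_l, (proj2 (one_particle_combination d)); unfold displaced_vac.
  rewrite amplitude_cscal, amplitude_exp_vec; unfold exp_amp; cbn [length weight prod_amp].
  rewrite inner_cscal_r, inner_norm; fold n.
  replace (/ sqrt (INR 1) * 1) with 1 by (simpl INR; rewrite sqrt_1; field).
  replace (Cconj iroot * (RtoC (exp (- (n / 4))) * (1 * (iroot * RtoC n * 1))))%C
    with (- (iroot * iroot) * RtoC (exp (- (n / 4)) * n))%C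
    by (rewrite iroot_conj, RtoC_mult; ring).
  rewrite iroot_sq, <- RtoC_opp, re_scal_l, re_RtoC; field. }
assert (E3 : re (displaced_vac zero) (fock_vac_field d) = 0).
{ rewrite re_sym; unfold re, fock_vac_field.
  rewrite inner_cscal_l, (proj2 (one_particle_combination d)); unfold displaced_vac.
  rewrite amplitude_cscal, amplitude_exp_vec; unfold exp_amp; cbn [length prod_amp].
  rewrite inner_cscal_r, inner_zero_r.
  match goal with |- Re ?z = 0 => replace z with (RtoC 0) by ring end; reflexivity. }
assert (E4 : norm (fock_vac_field d) ^ 2 = n / 2).
{ rewrite norm_fock_vac_field, Rpow_mult_distr; fold n.
  replace ((/ sqrt 2) ^ 2) with (/ 2) by (rewrite <- inv_sqrt2_sq; ring); field. }
assert (E : norm (minus (minus (displaced_vac d) (displaced_vac zero)) (fock_vac_field d)) ^ 2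
  = 2 + n / 2 - (2 + n) * exp (- (n / 4))).
{ rewrite norm_sq_minus, re_minus_l, E2, E3, E4, norm_sq_minus, E1, !norm_displaced; field. }
assert (He : 1 - n / 4 <= exp (- (n / 4))).
{ pose proof (exp_ineq1_le (- (n / 4))); lra. }
set (a := norm (minus (minus (displaced_vac d) (displaced_vac zero)) (fock_vac_field d))) in *.
assert (Ha : 0 <= a) by apply norm_nonneg.
assert (a ^ 2 <= n ^ 2) by (rewrite E; nra).
destruct (Rle_dec a n) as [L|L]; [exact L|exfalso].
assert (n ^ 2 < a ^ 2) by (simpl; nra); lra.
Qed.

Lemma displaced_dense (x : X) e : 0 < e -> exists v, norm (minus (comb displaced_vac v) x) < e.
Proof. apply total_dense, displaced_total. Qed.

(** Translating [displaced_vac] by [F], with the phase that the Weyl relations dictate,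
    preserves inner products and therefore extends to an isometry. *)
Lemma fock_weyl_exists : exists W : weyl_system h X, forall P, coh W P = displaced_vac P.
Proof.
set (e' := fun F P => cscal (cis (- (1 / 2) * symp F P)) (displaced_vac (plus F P))).
assert (Hex : forall F, exists V : X -> X,
    (forall x y, V (plus x y) = plus (V x) (V y)) /\
    (forall (c : C) x, V (cscal c x) = cscal c (V x)) /\
    (forall x, norm (V x) = norm x) /\
    forall P, V (displaced_vac P) = e' F P).
{ intro F; apply isometric_extension; [apply displaced_translate|exact displaced_dense]. }
set (V := fun F => proj1_sig (constructive_indefinite_description _ (Hex F))).
assert (HV : forall F, (forall x y, V F (plus x y) = plus (V F x) (V F y)) /\
    (forall (c : C) x, V F (cscal c x) = cscal c (V F x)) /\
    (forall x, norm (V F x) = norm x) /\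
    forall P, V F (displaced_vac P) = e' F P)
  by (intro F; exact (proj2_sig (constructive_indefinite_description _ (Hex F)))).
assert (Vp := fun F => proj1 (HV F)).
assert (Vs := fun F => proj1 (proj2 (HV F))).
assert (Vn := fun F => proj1 (proj2 (proj2 (HV F)))).
assert (Ve := fun F => proj2 (proj2 (proj2 (HV F)))).
assert (V0 : forall x, V zero x = x).
{ apply (isometry_ext displaced_dense); auto.
  intro P; rewrite Ve; unfold e'.
  assert (E : symp (zero : h) P = 0) by (unfold symp; rewrite inner_zero_l; reflexivity).
  rewrite E, plus_zero_l, Rmult_0_r, cis_0; apply cscal_one. }
assert (Vc : forall F G x, V F (V G x) = cscal (cis (- (1 / 2) * symp F G)) (V (plus F G) x)).
{ intros F G; apply (isometry_ext displaced_dense).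
  - intros; rewrite !Vp; reflexivity.
  - intros; rewrite !Vs; reflexivity.
  - intros; rewrite !Vn; reflexivity.
  - intros; rewrite Vp; vec.
  - intros; rewrite Vs; vec.
  - intros; rewrite norm_cscal, Vn, Cmod_cis; ring.
  - intro P; rewrite Ve; unfold e' at 1; rewrite Vs, !Ve; unfold e'.
    rewrite !cscal_assoc, <- !cis_plus, symp_plus_l, symp_plus_r; f_equal.
    + f_equal; ring.
    + f_equal; vec. }
assert (Vvac : forall F, V F (displaced_vac zero) = displaced_vac F).
{ intro F; rewrite Ve; unfold e'.
  assert (E : symp F (zero : h) = 0) by (unfold symp; rewrite inner_zero_r; reflexivity).
  rewrite E, plus_zero_r, Rmult_0_r, cis_0; apply cscal_one. }
unshelve eexists.
- refine (@Build_weyl_system h X V (displaced_vac zero) fock_vac_field Vp Vs Vn V0 Vc _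
    fock_vac_field_linear _).
  + intros x e He; destruct (displaced_dense x He) as [v Hv]; exists v.
    replace (comb (fun F => V F (displaced_vac zero)) v) with (comb displaced_vac v); [exact Hv|].
    clear Hv; induction v as [|[c P] v IH]; simpl; [reflexivity|].
    rewrite IH, Vvac; reflexivity.
  + intro d; rewrite Vvac; apply fock_vac_field_approx.
- intro P; exact (Vvac P).
Qed.

End FockWeyl.

(** * Segal operators generate the Weyl groups *)

Section SegalWeyl.

Variables (h : HilbertSpace) (W : weyl_system h (fock h)).
Hypothesis W_coh : forall P, coh W P = displaced_vac P.
Notation X := (fock h).
Implicit Types (f g P : h) (phi psi : X).

Lemma contract_ext f (p q : list h -> C) l :
  (forall m, S (length m) = length l -> p m = q m) -> contract f p l = contract f q l.
Proof.
revert p q; induction l as [|g l IH]; intros p q H; [reflexivity|].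
simpl; rewrite H by reflexivity; f_equal; apply IH.
intros m Hm; apply H; simpl; lia.
Qed.

Lemma contract_mult f (c : C) (p : list h -> C) l :
  contract f (fun m => c * p m)%C l = (c * contract f p l)%C.
Proof.
revert p; induction l as [|g l IH]; intro p; simpl; [ring|].
rewrite (IH (fun m => p (g :: m))); ring.
Qed.

Lemma contract_zero f l : contract f (fun _ => RtoC 0) l = 0.
Proof. induction l as [|g l IH]; simpl; [reflexivity|rewrite IH; ring]. Qed.

Lemma contract_cscal f (c : C) (p : list h -> C) l :
  contract (cscal c f) p l = (c * contract f p l)%C.
Proof.
revert p; induction l as [|g l IH]; intro p; simpl; [ring|].
rewrite IH, inner_cscal_r; ring.
Qed.

Lemma contract_repeat f g (p : list h -> C) n :
  contract f p (repeat g (S n)) = (RtoC (INR (S n)) * inner g f * p (repeat g n))%C.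
Proof.
revert p; induction n as [|n IH]; intro p; [simpl; ring|].
change (contract f p (repeat g (S (S n)))) with
  (inner g f * p (repeat g (S n)) + contract f (fun m => p (g :: m)) (repeat g (S n)))%C.
rewrite IH; change (g :: repeat g n) with (repeat g (S n)).
rewrite (S_INR (S n)), RtoC_plus; ring.
Qed.

(** * The action of the group on coherent vectors, as explicit curves *)

(** The coefficient of the exponential vector in [W (r f) (coh P)] when [s = -1], and its
    conjugate when [s = 1]. *)
Definition gaussian f P (s : R) (r : R) : C :=
  cexp (- (norm (plus (scal r f) P) ^ 2 / 4), s * (1 / 2) * (r * symp f P)).

Lemma weyl_displaced_vac f P r :
  W (scal r f) (coh W P) =
  cscal (gaussian f P (-1) r) (exp_vec (plus (cscal iroot P) (cscal (RtoC r) (cscal iroot f)))).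
Proof.
rewrite weyl_coh, W_coh; unfold displaced_vac; rewrite cscal_assoc; f_equal.
- unfold gaussian, cexp; rewrite symp_scal_l; unfold Re, Im; cbn [fst snd].
  rewrite Cmult_comm; f_equal; f_equal; ring.
- f_equal; vec.
Qed.

Lemma gaussian_0 f P s : gaussian f P s 0 = RtoC (exp (- (norm P ^ 2 / 4))).
Proof.
unfold gaussian; rewrite <- cexp_real; f_equal.
rewrite vscal_0, plus_zero_l; unfold RtoC; f_equal; ring.
Qed.

Lemma gaussian_conj f P s r : Cconj (gaussian f P s r) = gaussian f P (- s) r.
Proof.
unfold gaussian; rewrite cexp_conj; f_equal; unfold Cconj; simpl; f_equal; ring.
Qed.

Lemma cderive_gaussian f P s : cderive (gaussian f P s) 0
  (((- (1 / 2) * re f P)%R, (s * (1 / 2) * symp f P)%R) * RtoC (exp (- (norm P ^ 2 / 4))))%C.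
Proof.
rewrite <- (gaussian_0 f P s); unfold gaussian at 1; apply cderive_cexp; split; simpl.
- assert (Hd : is_derive (fun r => plus (scal r f) P) 0 f).
  { pose proof (@is_derive_plus R_AbsRing h _ _ 0 _ _ (is_derive_scal_id f 0)
      (@is_derive_const R_AbsRing h P 0)) as H.
    rewrite plus_zero_r in H; exact H. }
  pose proof (is_derive_norm_sq Hd) as H.
  pose proof (is_derive_scal _ _ (- (1 / 4)) _ H) as H1.
  assert (E : - (1 / 4) * (2 * re (plus (scal 0 f) P) f) = - (1 / 2) * re f P).
  { rewrite vscal_0, plus_zero_l, (re_sym P f); field. }
  rewrite <- E; revert H1; apply is_derive_ext; intro r.
  change (- (1 / 4) * norm (plus (scal r f) P) ^ 2 = - (norm (plus (scal r f) P) ^ 2 / 4)); field.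
- auto_derive; [easy|ring].
Qed.

(** * The Segal operator on finite particle vectors *)

(** The derivative at [r = 0] of the pairing of [phi] with the first [n] components of the
    exponential vector of [g + r f]. *)
Definition comb_derivative f g phi : nat -> C :=
  fix d (n : nat) : C := match n with
  | O => 0
  | S m => (d m + RtoC (weight (S m)) * (RtoC (INR (S m)) * amplitude phi (f :: repeat g m)))%C
  end.

Lemma cderive_pairing f g phi n :
  cderive (fun r => pairing (exp_comb (plus g (cscal (RtoC r) f)) n) phi) 0
    (comb_derivative f g phi n).
Proof.
induction n as [|n IH].
- exact (cderive_const (pairing (exp_comb g 0) phi) 0).
- apply cderive_ext with (fun r => (pairing (exp_comb (plus g (cscal (RtoC r) f)) n) phi +
    RtoC (weight (S n)) * amplitude phi (@repeat h (plus g (cscal (RtoC r) f)) (S n)))%C).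
  { intro r; unfold pairing; rewrite antilin_exp_comb; reflexivity. }
  exact (cderive_plus IH (cderive_scal _ (cderive_amplitude phi f g nil (S n)))).
Qed.

Lemma weight_succ n : weight (S n) * INR (S n) = weight n * sqrt (INR (S n)).
Proof.
cbn [weight]; rewrite <- (sqrt_INR_S_sq n) at 2; field.
pose proof (sqrt_INR_S_pos n); lra.
Qed.

Lemma pairing_annihilation f g phi psi : annihilation f phi psi -> forall n,
  comb_derivative (cscal iroot f) g phi (S n) =
  (Cconj iroot * pairing (exp_comb g n) psi)%C.
Proof.
intros [_ Hpsi] n.
assert (Hk : forall k, (RtoC (weight (S k)) * (RtoC (INR (S k)) *
    amplitude phi (cscal iroot f :: repeat g k)))%C =
  (Cconj iroot * (RtoC (weight k) * amplitude psi (repeat g k)))%C).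
{ intro k; rewrite amplitude_cscal_arg, Hpsi, repeat_length.
  rewrite (Cmult_assoc (RtoC (weight (S k)))), <- RtoC_mult, weight_succ, RtoC_mult; ring. }
induction n as [|n IH].
- cbn [comb_derivative]; rewrite Hk; unfold pairing; rewrite antilin_exp_comb_0.
  cbn [weight repeat]; ring.
- change (comb_derivative (cscal iroot f) g phi (S (S n))) with
    (comb_derivative (cscal iroot f) g phi (S n) + RtoC (weight (S (S n))) *
      (RtoC (INR (S (S n))) * amplitude phi (cscal iroot f :: repeat g (S n))))%C.
  rewrite IH, Hk; unfold pairing; rewrite antilin_exp_comb; ring.
Qed.

Lemma pairing_creation f g phi psi : creation f phi psi -> forall n,
  pairing (exp_comb g (S n)) psi = (inner g f * pairing (exp_comb g n) phi)%C.
Proof.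
intros [_ Hpsi].
assert (Hk : forall k, (RtoC (weight (S k)) * amplitude psi (repeat g (S k)))%C =
  (inner g f * (RtoC (weight k) * amplitude phi (repeat g k)))%C).
{ intro k; rewrite Hpsi, repeat_length, contract_repeat.
  transitivity (RtoC (weight (S k) * INR (S k) * / sqrt (INR (S k)))
    * (inner g f * amplitude phi (repeat g k)))%C; [rewrite !RtoC_mult; ring|].
  rewrite weight_succ.
  replace (weight k * sqrt (INR (S k)) * / sqrt (INR (S k))) with (weight k)
    by (pose proof (sqrt_INR_S_pos k); field; lra).
  ring. }
induction n as [|n IH].
- unfold pairing; rewrite antilin_exp_comb, Hk, !antilin_exp_comb_0, Hpsi.
  cbn [contract weight repeat]; ring.
- unfold pairing in *; rewrite antilin_exp_comb, IH, Hk, (antilin_exp_comb g n); ring.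
Qed.

Lemma cderive_inner_l (u : R -> X) t du y :
  is_derive u t du -> cderive (fun r => inner (u r) y) t (inner du y).
Proof.
intro H; split; [exact (is_derive_re y H)|].
exact (is_derive_linear (is_linear_symp_l y) H).
Qed.

(** Pairing with an exponential vector turns annihilation into a derivative and creation
    into a multiplication; both sides of the weak relation are then the derivative of
    the same Gaussian times a polynomial. *)
Lemma segal_core_weak f phi psi1 psi2 : annihilation f phi psi1 -> creation f phi psi2 ->
  weak_field W f phi (cscal Ci (cscal (RtoC (/ sqrt 2)) (plus psi1 psi2))).
Proof.
intros H1 H2 P; pose proof (proj1 H1) as [N HN].
set (g := cscal iroot P).
set (E := pairing (exp_comb g (S N)) phi).
set (A := pairing (exp_comb g N) psi1).
set (S0 := RtoC (exp (- (norm P ^ 2 / 4)))).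
assert (Hphi : forall g n, (N <= n)%nat -> inner (exp_vec g) phi = pairing (exp_comb g n) phi).
{ intros k n Hn; apply inner_exp_finite; intros l Hl; apply HN; lia. }
assert (Hpsi1 : inner (exp_vec g) psi1 = A).
{ apply inner_exp_finite; intros l Hl; rewrite (proj2 H1), HN by (simpl; lia); ring. }
assert (Hpsi2 : inner (exp_vec g) psi2 = (inner g f * E)%C).
{ rewrite (@inner_exp_finite h g psi2 (S (S N))).
  - apply (pairing_creation g H2).
  - intros l Hl; rewrite (proj2 H2).
    rewrite (contract_ext f (p := amplitude phi) (q := fun _ => RtoC 0)), contract_zero; [ring|].
    intros m Hm; apply HN; lia. }
pose proof (cderive_inner_l phi (coh_group_derive W f P)) as D.
assert (D' : cderive (fun r => inner (W (scal r f) (coh W P)) phi) 0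
  (((- (1 / 2) * re f P)%R, (1 * (1 / 2) * symp f P)%R) * S0 * E + S0 * (Cconj iroot * A))%C).
{ apply cderive_ext with (fun r => (gaussian f P 1 r *
    pairing (exp_comb (plus g (cscal (RtoC r) (cscal iroot f))) (S N)) phi)%C).
  { intro r; rewrite weyl_displaced_vac, inner_cscal_l, gaussian_conj; fold g.
    rewrite <- Hphi by lia; f_equal; f_equal; ring. }
  pose proof (cderive_mult (cderive_gaussian f P 1) (cderive_pairing (cscal iroot f) g phi (S N)))
    as H.
  cbv beta in H; rewrite (pairing_annihilation g H1 N), gaussian_0 in H; fold A in H.
  replace (pairing (exp_comb (plus g (cscal (RtoC 0) (cscal iroot f))) (S N)) phi) with E in H;
    [exact H|].
  unfold E; do 2 f_equal; vec. }
rewrite (cderive_unique D D'), W_coh; unfold displaced_vac; fold g S0.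
rewrite !inner_cscal_r, inner_cscal_l, inner_plus_r, Hpsi1, Hpsi2.
replace (Cconj S0) with S0 by (unfold S0; Ceq).
assert (Eg : inner g f = (- iroot * inner P f)%C).
{ unfold g; rewrite inner_cscal_l, iroot_conj; reflexivity. }
assert (Ei : (Ci * RtoC (/ sqrt 2))%C = iroot) by (unfold iroot; Ceq).
assert (Ep : (- (1 / 2) * re f P, 1 * (1 / 2) * symp f P) = (iroot * iroot * inner P f)%C).
{ rewrite iroot_sq; unfold re, symp; rewrite (inner_conj P f).
  destruct (inner P f); unfold Re, Im, Cconj; apply injective_projections; simpl; field. }
rewrite iroot_conj, Eg, Ep.
transitivity (- ((Ci * RtoC (/ sqrt 2)) * (S0 * (A + - iroot * inner P f * E))))%C;
  [rewrite Ei; ring|ring].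
Qed.

Lemma segal_weak f y z : op_cscal Ci (segal f) y z -> weak_field W f y z.
Proof.
intros [z' [Hz ->]]; apply weak_field_closed; intros e He.
destruct (Hz e He) as [y1 [z1 [[psi1 [psi2 [H1 [H2 ->]]]] [Hy1 Hz1]]]].
exists y1, (cscal Ci (cscal (RtoC (/ sqrt 2)) (plus psi1 psi2))).
split; [apply segal_core_weak; assumption|split; [exact Hy1|]].
match goal with |- norm ?v < _ =>
  assert (E : v = cscal Ci (minus (cscal (RtoC (/ sqrt 2)) (plus psi1 psi2)) z')) by vec end.
rewrite E, norm_cscal, Cmod_Ci, Rmult_1_l; exact Hz1.
Qed.

(** * Coherent vectors in the domain of the Segal operator *)

Lemma is_linear_amplitude_re l : is_linear (fun phi => Re (amplitude phi l)).
Proof.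
apply is_linear_intro with (seminorm (@tensor_inner h) ((RtoC 1, l) :: nil)).
- intros x y; apply re_plus.
- intros r x; change (Re (amplitude (scal r x) l) = r * Re (amplitude x l)).
  rewrite amplitude_scal; apply re_scal_l.
- intro x; pose proof (pairing_bound ((RtoC 1, l) :: nil) x) as Hb.
  unfold pairing in Hb; rewrite antilin_ext_single, Rmult_comm in Hb.
  exact (Rle_trans _ _ _ (re_le_Cmod (amplitude x l)) Hb).
Qed.

Lemma cderive_amplitude_curve (u : R -> X) t du l :
  is_derive u t du -> cderive (fun r => amplitude (u r) l) t (amplitude du l).
Proof.
intro H; split; [exact (is_derive_linear (is_linear_amplitude_re l) H)|].
assert (E : forall x : X, Im (amplitude x l) = Re (amplitude (cscal (- Ci)%C x) l)).
{ intro x; rewrite amplitude_cscal; destruct (amplitude x l); unfold Re, Im; simpl; ring. }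
rewrite E; apply is_derive_ext with (fun r => Re (amplitude (cscal (- Ci)%C (u r)) l)).
{ intro r; symmetry; apply E. }
exact (is_derive_linear (is_linear_amplitude_re l)
  (is_derive_linear (is_linear_cscal (- Ci)%C) H)).
Qed.

Lemma cderive_prod_amp f g l :
  cderive (fun r => prod_amp (plus g (cscal (RtoC r) f)) l) 0 (contract f (prod_amp g) l).
Proof.
induction l as [|k l IH]; [exact (cderive_const 1 0)|].
assert (Hk : cderive (fun r => inner k (plus g (cscal (RtoC r) f))) 0 (inner k f)).
{ apply cderive_ext with (fun r => (inner k g + inner k f * RtoC r)%C).
  { intro r; rewrite inner_plus_r, inner_cscal_r; ring. }
  assert (Hid : is_derive (fun r : R => r) 0 1) by exact (@is_derive_id R_AbsRing 0).
  pose proof (cderive_plus (cderive_const (inner k g) 0)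
    (cderive_scal (inner k f) (cderive_RtoC Hid))) as H.
  rewrite Cplus_0_l, Cmult_1_r in H; exact H. }
pose proof (cderive_mult Hk IH) as H; cbv beta in H.
assert (E0 : plus g (cscal (RtoC 0) f) = g) by vec.
rewrite E0 in H; cbn [prod_amp contract].
change (fun m => prod_amp g (k :: m)) with (fun m => (inner k g * prod_amp g m)%C).
rewrite contract_mult; exact H.
Qed.

Lemma amplitude_field f P l :
  amplitude (field W f P) l =
  (RtoC (exp (- (norm P ^ 2 / 4))) * RtoC (weight (length l)) *
    (- (RtoC (/ 2) * inner f P) * prod_amp (cscal iroot P) l
     + iroot * contract f (prod_amp (cscal iroot P)) l))%C.
Proof.
set (g := cscal iroot P); set (S0 := RtoC (exp (- (norm P ^ 2 / 4)))).
pose proof (cderive_amplitude_curve l (coh_group_derive W f P)) as D.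
assert (D' : cderive (fun r => amplitude (W (scal r f) (coh W P)) l) 0
  (((- (1 / 2) * re f P)%R, (-1 * (1 / 2) * symp f P)%R) * S0 * (RtoC (weight (length l)) * prod_amp g l)
   + S0 * (RtoC (weight (length l)) * contract (cscal iroot f) (prod_amp g) l))%C).
{ apply cderive_ext with (fun r => (gaussian f P (-1) r * (RtoC (weight (length l)) *
    prod_amp (plus g (cscal (RtoC r) (cscal iroot f))) l))%C).
  { intro r; rewrite weyl_displaced_vac, amplitude_cscal, amplitude_exp_vec; reflexivity. }
  pose proof (cderive_mult (cderive_gaussian f P (-1))
    (cderive_scal (RtoC (weight (length l))) (cderive_prod_amp (cscal iroot f) g l))) as H.
  cbv beta in H; rewrite gaussian_0 in H.
  assert (E0 : plus g (cscal (RtoC 0) (cscal iroot f)) = g) by vec.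
  rewrite E0 in H; exact H. }
rewrite (cderive_unique D D'), contract_cscal.
assert (Ep : (- (1 / 2) * re f P, -1 * (1 / 2) * symp f P) = (- (RtoC (/ 2) * inner f P))%C).
{ unfold re, symp; destruct (inner f P); apply injective_projections; simpl; field. }
rewrite Ep; ring.
Qed.

(** Annihilation and creation map a truncated coherent vector to truncations of two fixed
    vectors, the first a multiple of the coherent vector; both truncations converge. *)
Lemma segal_coh f P : op_cscal Ci (segal f) (coh W P) (field W f P).
Proof.
set (g := cscal iroot P); set (S0 := RtoC (exp (- (norm P ^ 2 / 4)))).
assert (Hw : forall l, amplitude (coh W P) l = (S0 * (RtoC (weight (length l)) * prod_amp g l))%C).
{ intro l; rewrite W_coh; unfold displaced_vac; rewrite amplitude_cscal, amplitude_exp_vec.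
  reflexivity. }
set (a := cscal (inner f g) (coh W P)).
(* the image of the coherent vector under creation *)
set (b := cscal (/ iroot)%C (plus (field W f P) (cscal (RtoC (/ 2) * inner f P)%C (coh W P)))).
assert (Hb : forall l, amplitude b l =
  (S0 * (RtoC (weight (length l)) * contract f (prod_amp g) l))%C).
{ intro l; unfold b; rewrite amplitude_cscal, amplitude_plus, amplitude_cscal, Hw.
  rewrite amplitude_field; fold g S0; field; exact iroot_neq_0. }
set (r := RtoC (/ sqrt 2)).
assert (Hri : (Ci * r)%C = iroot) by (unfold r, iroot; Ceq).
exists (cscal r (plus a b)); split.
2:{ rewrite cscal_assoc, Hri; unfold a, b.
  assert (E : inner f g = (iroot * inner f P)%C) by (unfold g; apply inner_cscal_r).
  rewrite E, cscal_plus_r, !cscal_assoc, cscal_plus_r, cscal_assoc.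
  replace (iroot * / iroot)%C with (RtoC 1) by (field; exact iroot_neq_0).
  replace (iroot * (iroot * inner f P))%C with (- (RtoC (/ 2) * inner f P))%C.
  2:{ rewrite Cmult_assoc, iroot_sq, RtoC_opp; ring. }
  vec. }
intros e He; assert (He2 : 0 < e / 2) by lra.
destruct (truncation_cvg (coh W P) He) as [N1 HN1].
destruct (truncation_cvg a He2) as [N2 HN2]; destruct (truncation_cvg b He2) as [N3 HN3].
set (N := Nat.max N1 (Nat.max N2 N3)).
destruct (truncation (S N) (coh W P)) as [phi [Hphi _]].
destruct (truncation N a) as [psi1 [Hpsi1 _]].
destruct (truncation (S (S N)) b) as [psi2 [Hpsi2 _]].
assert (Hfin : finite_particle phi).
{ exists (S N); intros l Hl; rewrite Hphi.
  replace (length l <=? S N)%nat with false by (symmetry; apply Nat.leb_gt; exact Hl).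
  reflexivity. }
exists phi, (cscal r (plus psi1 psi2)); split; [|split].
- exists psi1, psi2; split; [|split; [|reflexivity]]; split; try exact Hfin.
  + intro l; rewrite Hpsi1, Hphi; unfold a; rewrite amplitude_cscal, !Hw.
    cbn [length prod_amp Nat.leb]; destruct (length l <=? N)%nat; [|ring].
    transitivity (RtoC (sqrt (INR (S (length l))) * weight (S (length l)))
      * (inner f g * S0 * prod_amp g l))%C; [|rewrite RtoC_mult; ring].
    replace (sqrt (INR (S (length l))) * weight (S (length l))) with (weight (length l)); [ring|].
    cbn [weight]; pose proof (sqrt_INR_S_pos (length l)); field; lra.
  + intro l; rewrite Hpsi2, Hb.
    destruct l as [|k l]; [simpl; ring|].
    destruct (Nat.leb_spec (length (k :: l)) (S (S N))) as [Hl|Hl].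
    * rewrite (contract_ext f (p := amplitude phi)
        (q := fun m => (S0 * RtoC (weight (length l)) * prod_amp g m)%C)).
      -- rewrite contract_mult; cbn [length weight]; rewrite RtoC_mult; ring.
      -- intros m Hm; simpl in Hm, Hl; assert (Em : length m = length l) by lia.
         rewrite Hphi, Hw, Em.
         replace (length l <=? S N)%nat with true by (symmetry; apply Nat.leb_le; lia).
         ring.
    * rewrite (contract_ext f (p := amplitude phi) (q := fun _ => RtoC 0)), contract_zero; [ring|].
      intros m Hm; rewrite Hphi.
      replace (length m <=? S N)%nat with false by (symmetry; apply Nat.leb_gt; lia).
      reflexivity.
- apply (HN1 (S N)); [unfold N; lia|exact Hphi].
- match goal with |- norm ?v < _ =>
    assert (E : v = cscal r (plus (minus psi1 a) (minus psi2 b))) by vec end.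
  rewrite E, norm_cscal; unfold r; rewrite Cmod_R, Rabs_pos_eq
    by (left; apply Rinv_0_lt_compat, Rlt_sqrt2_0).
  assert (Hr1 : / sqrt 2 <= 1).
  { rewrite <- Rinv_1; apply Rinv_le_contravar; [lra|].
    rewrite <- sqrt_1; apply sqrt_le_1_alt; lra. }
  assert (Hr0 : 0 < / sqrt 2) by (apply Rinv_0_lt_compat, Rlt_sqrt2_0).
  assert (H : norm (plus (minus psi1 a) (minus psi2 b)) < e).
  { eapply Rle_lt_trans; [apply norm_plus_le|].
    pose proof (HN2 N psi1 ltac:(unfold N; lia) Hpsi1).
    pose proof (HN3 (S (S N)) psi2 ltac:(unfold N; lia) Hpsi2); lra. }
  pose proof (norm_nonneg (plus (minus psi1 a) (minus psi2 b))).
  change (/ sqrt 2 * norm (plus (minus psi1 a) (minus psi2 b)) < e); nra.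
Qed.

Lemma contract_plus f (p q : list h -> C) l :
  contract f (fun m => p m + q m)%C l = (contract f p l + contract f q l)%C.
Proof.
revert p q; induction l as [|g l IH]; intros p q; simpl; [ring|].
rewrite (IH (fun m => p (g :: m)) (fun m => q (g :: m))); ring.
Qed.

Lemma finite_particle_plus phi psi :
  finite_particle phi -> finite_particle psi -> finite_particle (plus phi psi).
Proof.
intros [n Hn] [m Hm]; exists (Nat.max n m); intros l Hl.
rewrite amplitude_plus, Hn, Hm by lia; ring.
Qed.

Lemma finite_particle_cscal c phi : finite_particle phi -> finite_particle (cscal c phi).
Proof. intros [n Hn]; exists n; intros l Hl; rewrite amplitude_cscal, Hn by lia; ring. Qed.

Lemma segal_plus f x y x' y' : segal f x y -> segal f x' y' -> segal f (plus x x') (plus y y').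
Proof.
apply op_closure_plus; clear; intros x y x' y' [a [b [[H1 Ha] [[_ Hb] ->]]]]
  [a' [b' [[H1' Ha'] [[_ Hb'] ->]]]].
exists (plus a a'), (plus b b').
pose proof (finite_particle_plus H1 H1') as Hf.
split; [|split]; [split; [exact Hf|]|split; [exact Hf|]|vec].
- intro l; rewrite !amplitude_plus, Ha, Ha'; ring.
- intro l; rewrite !amplitude_plus, Hb, Hb'.
  rewrite <- Cmult_plus_distr_l, <- contract_plus; reflexivity.
Qed.

Lemma segal_cscal f c x y : segal f x y -> segal f (cscal c x) (cscal c y).
Proof.
apply op_closure_cscal; clear; intros c x y [a [b [[H1 Ha] [[_ Hb] ->]]]].
exists (cscal c a), (cscal c b).
pose proof (finite_particle_cscal c H1) as Hf.
split; [|split]; [split; [exact Hf|]|split; [exact Hf|]|vec].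
- intro l; rewrite !amplitude_cscal, Ha; ring.
- intro l; rewrite !amplitude_cscal, Hb.
  transitivity (RtoC (/ sqrt (INR (length l))) * (c * contract f (amplitude x) l))%C; [ring|].
  rewrite <- contract_mult; reflexivity.
Qed.

(** The Segal operator is caught between the coherent vectors, a core, and the weak
    relation: it generates the Weyl group. *)
Lemma segal_generator f y z :
  op_cscal Ci (segal f) y z <-> generator (fun r => W (scal r f)) y z.
Proof.
split; [intro H; apply weak_field_generator, segal_weak, H|].
apply generator_core.
- exists (zero : X); split; [|vec].
  pose proof (segal_coh f zero) as [z' [Hz _]].
  pose proof (segal_cscal 0 Hz) as H.
  replace (cscal 0 (coh W zero)) with (zero : X) in H by vec.
  replace (cscal 0 z') with (zero : X) in H by vec; exact H.
- intros x1 y1 x2 y2 [a1 [H1 ->]] [a2 [H2 ->]].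
  exists (plus a1 a2); split; [apply segal_plus; assumption|vec].
- intros c x1 y1 [a1 [H1 ->]]; exists (cscal c a1); split; [apply segal_cscal, H1|vec].
- intros x1 y1 H; exists (cscal (- Ci)%C y1); split.
  2:{ vec; destruct (inner e y1); apply injective_projections; simpl; ring. }
  apply op_closure_closed; intros e He.
  destruct (H e He) as [x2 [y2 [[z2 [Hz ->]] [Hx Hy]]]].
  exists x2, z2; split; [exact Hz|split; [exact Hx|]].
  match goal with |- norm ?v < _ =>
    assert (E : v = cscal (- Ci)%C (minus (cscal Ci z2) y1)) end.
  { vec; destruct (inner e0 z2), (inner e0 y1); apply injective_projections; simpl; ring. }
  rewrite E, norm_cscal, Cmod_opp, Cmod_Ci, Rmult_1_l; exact Hy.
- exact (segal_coh f).
Qed.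

Lemma segal_weak_field f y z : op_cscal Ci (segal f) y z <-> weak_field W f y z.
Proof.
split; [apply segal_weak|].
intro H; apply segal_generator, weak_field_generator, H.
Qed.

End SegalWeyl.

Theorem corollary3p1 (h : HilbertSpace) (f : R -> h)
    (hf : continuous_on unit_interval f) :
  let A := fun t => op_cscal Ci (segal (f t)) in
  let Y := maximal_continuity_subspace A in
  exists U : R -> R -> fock h -> fock h,
    evolution_system A Y U /\
    (forall V, evolution_system A Y V ->
       forall s t, 0 <= s -> s <= t -> t <= 1 -> forall x, V t s x = U t s x) /\
    (forall s t, 0 <= s -> s <= t -> t <= 1 ->
       closable (integral_operator A s t) /\
       (exists S, is_exp (op_closure (integral_operator A s t)) S /\
          forall x, U t s x = S (cscal (phase f s t) x)) /\
       (exists W, is_weyl (RInt f s t) W /\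
          forall x, U t s x = W (cscal (phase f s t) x))).
Proof.
intros A Y; destruct (fock_weyl_exists h) as [W HW].
assert (HA : forall t y z, A t y z <-> weak_field W (f t) y z).
{ intros t y z; apply segal_weak_field, HW. }
exists (path_evolution W f); split; [|split].
- exact (path_evolution_system hf HA).
- exact (evolution_unique hf HA).
- intros s t Hs Hst Ht.
  destruct (path_evolution_formulas hf HA Hs Hst Ht) as [H1 [H2 H3]].
  split; [exact H1|split]; exists (W (RInt f s t)); split; auto.
  apply weyl_is_exp, segal_generator, HW.
Qed.
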